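(* Let $Q$ be a quiver whose underlying undirected graph is a simply laced Dynkin diagram (type $A$, $D$ or $E$), let $\mathbb{F}_q$ be a finite field with $q$ elements, let $\mathrm{Rep}(Q)$ be the abelian category of finite-dimensional representations of $Q$ over $\mathbb{F}_q$, and let $K=K_0(\mathrm{Rep}(Q))$. Then the Hall algebra $\mathcal{H}$ of $\mathrm{Rep}(Q)$, with multiplication $m$, comultiplication $\Delta$, unit and counit as defined in the context, is a Hopf algebra object in the braided monoidal category $\mathrm{Vect}^K$; that is, it is a bialgebra object in $\mathrm{Vect}^K$ that admits an antipode which is a morphism in $\mathrm{Vect}^K$.
   Context: Representations: a representation of $Q$ assigns a finite-dimensional $\mathbb{F}_q$-vector space to each vertex and a linear map to each edge (equivalently, it is a functor from the free category on the directed graph to finite-dimensional $\mathbb{F}_q$-vector spaces); morphisms are natural transformations. $\mathrm{Rep}(Q)$ is a hereditary abelian category. Grothendieck group: $K=K_0(\mathrm{Rep}(Q))$ is the abelian group generated by isomorphism classes of objects, modulo $[C]=[A]+[B]$ for every short exact sequence $0\to A\to C\to B\to 0$. It carries the bilinear form determined by $\langle M,N\rangle=\dim_{\mathbb{F}_q}\mathrm{Hom}(M,N)-\dim_{\mathbb{F}_q}\mathrm{Ext}^1(M,N)$, which takes integer values. The category $\mathrm{Vect}^K$: objects are $K$-graded real vector spaces, morphisms are grade-preserving linear maps. The monoidal structure is the tensor product with $(V\otimes W)_d=\bigoplus_{n\in K}V_n\otimes W_{d-n}$ (unit $\mathbb{R}$ in degree $0$, usual associator). The braiding is $B_{V,W}(v\otimes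 w)=q^{-\langle n,m\rangle}\,w\otimes v$ for $v\in V_n$, $w\in W_m$, with $q=|\mathbb{F}_q|$ regarded as a real number. Hall algebra: let $\underline{X}$ be the set of isomorphism classes of objects of $\mathrm{Rep}(Q)$ and $\mathcal{H}=\mathbb{R}[\underline{X}]$ the real vector space with basis $\underline{X}$, with the basis element $[M]$ placed in the degree given by the class of $M$ in $K$. For objects $M,N,E$ let $P_{MN}^E$ be the number of pairs $(f,g)$ such that $0\to N\xrightarrow{f}E\xrightarrow{g}M\to 0$ is exact, and let $\mathrm{aut}(M)=|\mathrm{Aut}(M)|$. Define $$m([M]\otimes[N])=\sum_{[E]\in\underline{X}}\frac{P_{MN}^E}{\mathrm{aut}(M)\,\mathrm{aut}(N)}[E],\qquad \Delta([E])=\sum_{[M],[N]\in\underline{X}}\frac{P_{MN}^E}{\mathrm{aut}(E)}[N]\otimes[M]$$ (these sums are finite). The unit is $[0]$ and the counit sends $[0]$ to $1$ and $[M]$ to $0$ for $M\neq 0$. A bialgebra object in a braided monoidal category is an object with a monoid structure and a comonoid structure such that comultiplication and counit are monoid morphisms, where the product on $\mathcal{H}\otimes\mathcal{H}$ is $(m\otimes m)\circ(1\otimes B_{\mathcal{H},\mathcal{H}}\otimes 1)$. An antipode is a morphism $S$ with $m(S\otimes 1)\Delta=\eta\varepsilon=m(1\otimes S)\Delta$, where $\eta$ is the unit and $\varepsilon$ the counit. *)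

(* Defs.v *)
From HB Require Import structures.
From mathcomp Require Import all_boot all_order all_algebra.
From mathcomp Require Import finmap.
From mathcomp Require Import mathcomp_extra boolp classical_sets functions.
From mathcomp Require Import cardinality fsbigop reals.
From mathcomp Require Import monalg.

Set Implicit Arguments.
Unset Strict Implicit.
Unset Printing Implicit Defensive.

Import Order.TTheory GRing.Theory Num.Theory.
Import Quotient passmx.

Local Open Scope ring_scope.
Local Open Scope quotient_scope.

Record quiver := Quiver {
  vert : finType;
  edge : finType;
  src : edge -> vert;
  tgt : edge -> vert
}.

Definition nb_edges (Q : quiver) (u v : vert Q) : nat :=
  #|[set e : edge Q | ((src e == u) && (tgt e == v))
                   || ((src e == v) && (tgt e == u))]|.

(* The diagrams on the nodes 0, ..., n-1: for A_n the chain 0 - 1 - ... - n-1; *)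
(* for D_n and E_n the chain 0 - 1 - ... - n-2 together with the node n-1     *)
(* joined to n-3, resp. to 2.                                                 *)
Definition sym (r : rel nat) : rel nat := fun i j => r i j || r j i.

Definition edgeA : rel nat := sym (fun i j => j == i.+1).
Definition edgeD (n : nat) : rel nat :=
  sym (fun i j => ((j == i.+1) && (j < n.-1)%N)
               || ((i == n - 3)%N && (j == n.-1))).
Definition edgeE (n : nat) : rel nat :=
  sym (fun i j => ((j == i.+1) && (j < n.-1)%N)
               || ((i == 2%N) && (j == n.-1))).

Definition simply_laced_dynkin (n : nat) (r : rel nat) : Prop :=
  [\/ (1 <= n)%N /\ r = edgeA,
      (4 <= n)%N /\ r = edgeD n
    | (6 <= n <= 8)%N /\ r = edgeE n].

(* The underlying undirected multigraph is isomorphic to such a diagram; in   *)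
(* particular it has neither loops nor multiple edges.                        *)
Definition dynkin_quiver (Q : quiver) : Prop :=
  exists (n : nat) (r : rel nat) (phi : 'I_n -> vert Q),
    [/\ simply_laced_dynkin n r, bijective phi
      & forall i j, nb_edges (phi i) (phi j) = r i j].

HB.instance Definition _ (F : finFieldType) (U V : vectType F) :=
  isCountable.Build 'Hom(U, V)
    (pcan_pickleK (can_pcan VectorInternalTheory.v2rK)).
HB.instance Definition _ (F : finFieldType) (U V : vectType F) :=
  isFinite.Build 'Hom(U, V)
    (pcan_enumP (can_pcan (VectorInternalTheory.v2rK
                           : @cancel _ 'Hom(U, V) _ _))).

Section Rep.
Variables (Q : quiver) (F : finFieldType).

Record rep := Rep {
  obj : vert Q -> vectType F;
  arr : forall e : edge Q, 'Hom(obj (src e), obj (tgt e))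
}.
Implicit Types M N E : rep.

Definition natural M N (f : {dffun forall v, 'Hom(obj M v, obj N v)}) : bool :=
  [forall e, (f (tgt e) \o arr M e)%VF == (arr N e \o f (src e))%VF].

Record rhom M N := RHom {
  rmap :> {dffun forall v, 'Hom(obj M v, obj N v)};
  rhom_natural : natural rmap
}.

HB.instance Definition _ M N := [isSub for @rmap M N].
HB.instance Definition _ M N := [Finite of rhom M N by <:].

Lemma mk_natural M N (f : forall v, 'Hom(obj M v, obj N v)) :
  (forall e x, f (tgt e) (arr M e x) = arr N e (f (src e) x)) ->
  natural [ffun v => f v].
Proof.
move=> H; apply/forallP => e; apply/eqP/lfunP => x.
by rewrite !comp_lfunE !ffunE H.
Qed.

Lemma rhomE M N (f : rhom M N) e x : f (tgt e) (arr M e x) = arr N e (f (src e) x).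
Proof. by move/forallP/(_ e)/eqP/lfunP/(_ x): (rhom_natural f); rewrite !comp_lfunE. Qed.

Lemma rhomP M N (f g : rhom M N) : (forall v x, f v x = g v x) <-> f = g.
Proof.
split=> [H|->//]; apply/val_inj/ffunP => v; apply/lfunP => x; exact: H.
Qed.

Definition mk_rhom M N (f : forall v, 'Hom(obj M v, obj N v)) H : rhom M N :=
  RHom (@mk_natural M N f H).

Lemma mk_rhomE M N f H v x : @mk_rhom M N f H v x = f v x.
Proof. by rewrite /= ffunE. Qed.

Lemma rid_subproof M e x :
  \1%VF (arr M e x) = arr M e (\1%VF x).
Proof. by rewrite !id_lfunE. Qed.
Definition rid M : rhom M M :=
  mk_rhom (f := fun=> \1%VF) (rid_subproof (M := M)).

Lemma rcomp_subproof M N E (g : rhom N E) (f : rhom M N) e x :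
  (g (tgt e) \o f (tgt e))%VF (arr M e x)
  = arr E e ((g (src e) \o f (src e))%VF x).
Proof. by rewrite !comp_lfunE !rhomE. Qed.
Definition rcomp M N E (g : rhom N E) (f : rhom M N) : rhom M E :=
  mk_rhom (f := fun v => (g v \o f v)%VF) (rcomp_subproof g f).

Lemma ridE M v x : rid M v x = x.
Proof. by rewrite mk_rhomE id_lfunE. Qed.
Lemma rcompE M N E (g : rhom N E) (f : rhom M N) v x :
  rcomp g f v x = g v (f v x).
Proof. by rewrite mk_rhomE comp_lfunE. Qed.

Definition is_iso M N (f : rhom M N) : bool :=
  [exists g : rhom N M, (rcomp g f == rid M) && (rcomp f g == rid N)].
Definition isorep M N : bool := [exists f : rhom M N, is_iso f].

Lemma isorepP M N :
  reflect (exists (f : rhom M N) (g : rhom N M),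
             (forall v x, g v (f v x) = x) /\ (forall v x, f v (g v x) = x))
          (isorep M N).
Proof.
apply: (iffP existsP) => [[f /existsP[g /andP[/eqP gf /eqP fg]]]|[f [g [gf fg]]]].
  by exists f, g; split=> v x; rewrite -rcompE (gf, fg) ridE.
exists f; apply/existsP; exists g; apply/andP.
by split; apply/eqP/rhomP => v x; rewrite rcompE ridE (gf, fg).
Qed.

Lemma isorep_refl M : isorep M M.
Proof. by apply/isorepP; exists (rid M), (rid M); split=> v x; rewrite !ridE. Qed.

Lemma isorep_sym M N : isorep M N -> isorep N M.
Proof. by move=> /isorepP[f [g [gf fg]]]; apply/isorepP; exists g, f. Qed.

Lemma isorep_trans N M E : isorep M N -> isorep N E -> isorep M E.
Proof.
move=> /isorepP[f [g [gf fg]]] /isorepP[f' [g' [gf' fg']]]; apply/isorepP.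
exists (rcomp f' f), (rcomp g g').
by split=> v x; rewrite !rcompE ?gf' ?fg.
Qed.

(* Exactness of 0 -> N -f-> E -g-> M -> 0.                                    *)
Definition short_exact N E M (f : rhom N E) (g : rhom E M) : bool :=
  [forall v, [&& lker (f v) == 0%VS, limg (f v) == lker (g v)
               & limg (g v) == fullv]].

Lemma short_exactP N E M (f : rhom N E) (g : rhom E M) :
  reflect [/\ forall v, injective (f v),
              forall v y, g v y = 0 <-> (exists x, y = f v x)
            & forall v z, exists y, z = g v y]
          (short_exact f g).
Proof.
apply: (iffP forallP) => [H|[fi ex gs] v].
  split=> v; have /and3P[k /eqP i /eqP s] := H v.
  - exact/lker0P.
  - move=> y; split=> [gy|[x ->]].
      have : y \in lker (g v) by rewrite memv_ker gy.
      by rewrite -i => /memv_imgP[x _ ->]; exists x.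
    by apply/eqP; rewrite -memv_ker -i memv_img ?memvf.
  - move=> z; have := memvf z; rewrite -s => /memv_imgP[y _ ->]; by exists y.
apply/and3P; split; first exact/lker0P.
- apply/eqP/vspaceP => y; rewrite memv_ker; apply/memv_imgP/eqP.
    by case=> x _ yE; apply/ex; exists x.
  by move=> /ex[x ->]; exists x; rewrite ?memvf.
- apply/eqP/vspaceP => z; rewrite memvf.
  by have [y ->] := gs v z; rewrite memv_img ?memvf.
Qed.

Definition zero_rep : rep := @Rep (fun=> 'rV[F]_0) (fun=> 0).

(* Isomorphism classes. Arbitrary representations form a proper class from    *)
(* the point of view of the universes of the library, so that the set of      *)
(* isomorphism classes is built from the representations by matrices, the     *)
(* class of M being that of its matrices in some bases (see cls_eqP, rreprK).  *)
Definition mxrep := {d : vert Q -> nat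
                   & forall e : edge Q, 'M[F]_(d (src e), d (tgt e))}.

Definition rep_of_mx (A : mxrep) : rep :=
  @Rep (fun v => 'rV[F]_(tag A v)) (fun e => linfun (mulmxr (tagged A e))).

Definition mx_of_rep M : mxrep :=
  existT (fun d : vert Q -> nat => forall e, 'M[F]_(d (src e), d (tgt e)))
    (fun v => \dim {:obj M v})
    (fun e => mxof (vbasis {:obj M (src e)}) (vbasis {:obj M (tgt e)})
                (arr M e)).

Lemma rep_of_mxK M : isorep M (rep_of_mx (mx_of_rep M)).
Proof.
have cP v := vbasisP {:obj M v}.
pose N := rep_of_mx (mx_of_rep M).
pose f v : 'Hom(obj M v, obj N v) := linfun (rVof (vbasis {:obj M v})).
pose g v : 'Hom(obj N v, obj M v) := linfun (vecof (vbasis {:obj M v})).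
have fE v x : f v x = rVof (vbasis {:obj M v}) x by exact: lfunE.
have gE v x : g v x = vecof (vbasis {:obj M v}) x by exact: lfunE.
have fn e x : f (tgt e) (arr M e x) = arr N e (f (src e) x).
  by rewrite !fE [RHS]lfunE /= (rVof_app _ (cP _)).
have gn e x : g (tgt e) (arr N e x) = arr M e (g (src e) x).
  by rewrite !gE [arr N e x]lfunE /= -(hom_vecof _ (cP _)).
apply/isorepP; exists (mk_rhom fn), (mk_rhom gn).
by split=> v x; rewrite !mk_rhomE fE gE ?rVofK ?vecofK ?cP.
Qed.

Definition mxiso (A B : mxrep) : bool := isorep (rep_of_mx A) (rep_of_mx B).

Lemma mxiso_equiv : equiv_class_of mxiso.
Proof.
split=> [A|A B|B A C]; first exact: isorep_refl.
  by apply/idP/idP; exact: isorep_sym.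
exact: isorep_trans.
Qed.
Canonical mxiso_equivRel := EquivRelPack mxiso_equiv.

Definition isocls := {eq_quot mxiso}.
HB.instance Definition _ := Choice.on isocls.

Definition cls M : isocls := \pi_isocls (mx_of_rep M).
Definition rrepr (x : isocls) : rep := rep_of_mx (repr x).

Lemma cls_eqP M N : reflect (cls M = cls N) (isorep M N).
Proof.
have MK := rep_of_mxK M; have NK := rep_of_mxK N.
have -> : isorep M N = mxiso (mx_of_rep M) (mx_of_rep N).
  apply/idP/idP => H.
    exact: isorep_trans (isorep_trans (isorep_sym MK) H) NK.
  exact: isorep_trans (isorep_trans MK H) (isorep_sym NK).
by apply: (iffP idP) => [|/eqP]; rewrite ?piE // => H; apply/eqP; rewrite piE.
Qed.

Lemma rreprK x : cls (rrepr x) = x.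
Proof.
rewrite -[RHS]reprK; apply/eqP; rewrite piE.
exact: isorep_sym (rep_of_mxK _).
Qed.

Definition k0_rel : {pred {malg int[isocls]}} := fun x =>
  `[< forall J : {pred {malg int[isocls]}}, zmod_closed J ->
      (forall M N E (f : rhom N E) (g : rhom E M), short_exact f g ->
         << cls E >> - (<< cls N >> + << cls M >>) \in J) ->
      x \in J >].

Lemma k0_rel_closed : zmod_closed k0_rel.
Proof.
split=> [|x y /asboolP xI /asboolP yI]; apply/asboolP => J Jz Jr.
  exact: Jz.1.
by apply: Jz.2; [exact: xI|exact: yI].
Qed.
HB.instance Definition _ := GRing.isZmodClosed.Build _ k0_rel k0_rel_closed.

Definition K0 : zmodType := {quot k0_rel}.
Definition kpi (x : {malg int[isocls]}) : K0 := \pi_({quot k0_rel}) x.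
Definition kcls (x : isocls) : K0 := kpi << x >>.

Definition hom_dim M N (d : nat) : Prop :=
  exists phi : 'rV[F]_d -> rhom M N, bijective phi /\
    forall a u w v x,
      phi (a *: u + w) v x = a *: phi u v x + phi w v x.

Record ext M N := Ext {
  emid : rep;
  ein : rhom N emid;
  eout : rhom emid M;
  ext_exact : short_exact ein eout
}.

(* Morphisms of extensions with prescribed outer components: ext_map alpha 1  *)
(* xi xi' says that xi' is the push-out of xi along alpha, ext_map 1 gamma xi *)
(* xi' that xi is the pull-back of xi' along gamma, and ext_map 1 1 is the    *)
(* equivalence of extensions.                                                 *)
Definition ext_map M N M' N' (alpha : rhom N N') (gamma : rhom M M')
    (xi : ext M N) (xi' : ext M' N') : Prop :=
  exists beta : rhom (emid xi) (emid xi'),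
    rcomp beta (ein xi) = rcomp (ein xi') alpha /\
    rcomp (eout xi') beta = rcomp gamma (eout xi).

Definition ext_equiv M N : ext M N -> ext M N -> Prop :=
  ext_map (rid N) (rid M).

Definition lfun_pair (U V U' V' : vectType F) (f : 'Hom(U, U'))
    (g : 'Hom(V, V')) (p : U * V) : U' * V' := (f p.1, g p.2).
Lemma lfun_pair_linear (U V U' V' : vectType F) (f : 'Hom(U, U'))
  (g : 'Hom(V, V')) : linear (lfun_pair f g).
Proof. by move=> a p p'; rewrite /lfun_pair /= !linearP. Qed.
HB.instance Definition _ (U V U' V' : vectType F) (f : 'Hom(U, U'))
    (g : 'Hom(V, V')) :=
  GRing.isLinear.Build F (U * V)%type (U' * V')%type _ (lfun_pair f g)
    (lfun_pair_linear f g).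

Definition dsum M N : rep :=
  @Rep (fun v => (obj M v * obj N v)%type)
       (fun e => linfun (lfun_pair (arr M e) (arr N e))).

Lemma dsum_arrE M N e (p : obj (dsum M N) (src e)) :
  arr (dsum M N) e p = (arr M e p.1, arr N e p.2).
Proof. exact: lfunE. Qed.

Lemma rdsum_subproof M N M' N' (f : rhom M M') (g : rhom N N') e
    (p : obj (dsum M N) (src e)) :
  linfun (lfun_pair (f (tgt e)) (g (tgt e))) (arr (dsum M N) e p) =
  arr (dsum M' N') e (linfun (lfun_pair (f (src e)) (g (src e))) p).
Proof. by rewrite !dsum_arrE !lfunE /= /lfun_pair /= !rhomE. Qed.
Definition rdsum M N M' N' (f : rhom M M') (g : rhom N N') :
    rhom (dsum M N) (dsum M' N') :=
  mk_rhom (M := dsum M N) (N := dsum M' N')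
    (f := fun v => linfun (lfun_pair (f v) (g v))) (rdsum_subproof f g).

Lemma rdsumE M N M' N' (f : rhom M M') (g : rhom N N') v p :
  rdsum f g v p = (f v p.1, g v p.2).
Proof. by rewrite mk_rhomE lfunE. Qed.

Definition dup (U : vectType F) (x : U) : U * U := (x, x).
Lemma dup_linear (U : vectType F) : linear (@dup U).
Proof. by []. Qed.
HB.instance Definition _ (U : vectType F) :=
  GRing.isLinear.Build F U (U * U)%type _ (@dup U) (@dup_linear U).

Definition fold (U : vectType F) (p : U * U) : U := p.1 + p.2.
Lemma fold_linear (U : vectType F) : linear (@fold U).
Proof. by move=> a p p'; rewrite /fold /= scalerDr addrACA. Qed.
HB.instance Definition _ (U : vectType F) :=
  GRing.isLinear.Build F (U * U)%type U _ (@fold U) (@fold_linear U).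

Lemma rdiag_subproof M e (x : obj M (src e)) :
  linfun (@dup (obj M (tgt e))) (arr M e x) =
  arr (dsum M M) e (linfun (@dup (obj M (src e))) x).
Proof. by rewrite dsum_arrE !lfunE. Qed.
Definition rdiag M : rhom M (dsum M M) :=
  mk_rhom (N := dsum M M) (f := fun v => linfun (@dup (obj M v)))
    (@rdiag_subproof M).

Lemma rfold_subproof M e (p : obj (dsum M M) (src e)) :
  linfun (@fold (obj M (tgt e))) (arr (dsum M M) e p) =
  arr M e (linfun (@fold (obj M (src e))) p).
Proof. by rewrite dsum_arrE !lfunE /fold /= linearD. Qed.
Definition rfold M : rhom (dsum M M) M :=
  mk_rhom (M := dsum M M) (f := fun v => linfun (@fold (obj M v)))
    (@rfold_subproof M).

Lemma rscale_subproof (a : F) M e x :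
  (a *: \1%VF : 'End(obj M (tgt e))) (arr M e x) =
  arr M e ((a *: \1%VF : 'End(obj M (src e))) x).
Proof. by rewrite !scale_lfunE !id_lfunE linearZ. Qed.
Definition rscale (a : F) M : rhom M M :=
  mk_rhom (f := fun=> a *: \1%VF) (rscale_subproof a (M := M)).

Lemma dsum_exact M1 N1 M2 N2 (xi1 : ext M1 N1) (xi2 : ext M2 N2) :
  short_exact (rdsum (ein xi1) (ein xi2)) (rdsum (eout xi1) (eout xi2)).
Proof.
have [i1 k1 s1] := short_exactP _ _ (ext_exact xi1).
have [i2 k2 s2] := short_exactP _ _ (ext_exact xi2).
apply/short_exactP; split=> v.
- by case=> [x1 x2] [y1 y2]; rewrite !rdsumE => -[/i1 -> /i2 ->].
- case=> [y1 y2]; rewrite rdsumE; split=> [[/k1[x1 ->] /k2[x2 ->]]|].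
    by exists (x1, x2); rewrite rdsumE.
  by case=> -[x1 x2]; rewrite rdsumE => -[-> ->]; congr (_, _);
    [apply/k1; exists x1|apply/k2; exists x2].
- case=> [z1 z2]; have [y1 ->] := s1 v z1; have [y2 ->] := s2 v z2.
  by exists (y1, y2); rewrite rdsumE.
Qed.
Definition ext_dsum M1 N1 M2 N2 (xi1 : ext M1 N1) (xi2 : ext M2 N2) :
    ext (dsum M1 M2) (dsum N1 N2) :=
  Ext (dsum_exact xi1 xi2).

(* xi represents the Baer sum of xi1 and xi2: the push-out along the fold map *)
(* of the pull-back along the diagonal of xi1 (+) xi2.                        *)
Definition baer_sum M N (xi1 xi2 xi : ext M N) : Prop :=
  exists zeta : ext M (dsum N N),
    ext_map (rid (dsum N N)) (rdiag M) zeta (ext_dsum xi1 xi2) /\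
    ext_map (rfold N) (rid M) zeta xi.

(* d is the dimension of the space Ext^1(M, N) of equivalence classes of      *)
(* extensions of M by N, with the Baer sum and the push-out along a.id_N as   *)
(* linear structure: phi induces a linear bijection from F^d to Ext^1(M, N).  *)
Definition ext_dim M N (d : nat) : Prop :=
  exists phi : 'rV[F]_d -> ext M N,
    [/\ forall xi, exists u, ext_equiv (phi u) xi,
        forall u w, ext_equiv (phi u) (phi w) -> u = w,
        forall u w, baer_sum (phi u) (phi w) (phi (u + w))
      & forall a u, ext_map (rscale a N) (rid M) (phi u) (phi (a *: u))].

Definition euler_form (chi : K0 -> K0 -> int) : Prop :=
  [/\ forall x y z, chi (x + y) z = chi x z + chi y z,
      forall x y z, chi x (y + z) = chi x y + chi x z
    & forall M N, exists h e : nat, [/\ hom_dim M N h, ext_dim M N e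
        & chi (kcls (cls M)) (kcls (cls N)) = h%:Z - e%:Z]].

(* The number P_{MN}^E.                                                       *)
Definition hall_nb M N E : nat :=
  #|[set p : rhom N E * rhom E M | short_exact p.1 p.2]|.

Definition aut M : nat := #|[set f : rhom M M | is_iso f]|.

End Rep.

Section EulerForm.
Variables (Q : quiver) (F : finFieldType).
Implicit Types M N E : rep Q F.
Lemma ext_equiv_sym M N (xi xi' : ext M N) :
  ext_equiv xi xi' -> ext_equiv xi' xi.
Proof.
case: xi xi' => [E f g xi] [E' f' g' xi'].
have /short_exactP[fi fg gs] := xi; have /short_exactP[fi' fg' gs'] := xi'.
move=> [/= b [/rhomP bf /rhomP bg]].
have {}bf v x : b v (f v x) = f' v x by have := bf v x; rewrite !rcompE ridE.
have {}bg v y : g' v (b v y) = g v y by have := bg v y; rewrite !rcompE ridE.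
have bi v : injective (b v).
  move=> y z /eqP; rewrite -subr_eq0 -linearB => /eqP yz; apply/eqP.
  rewrite -subr_eq0; have /fg[x xE] : g v (y - z) = 0.
    by rewrite -bg yz linear0.
  by move: yz; rewrite xE /= bf -(linear0 (f' v)) => /fi' ->; rewrite linear0.
have bs v z : exists y, z = b v y.
  have [y yE] := gs v (g' v z).
  have /fg'[x xE] : g' v (z - b v y) = 0 by rewrite linearB /= bg yE subrr.
  by exists (f v x + y); rewrite linearD /= bf -xE subrK.
have bK v : lker (b v) == 0%VS by apply/lker0P.
have cE v z : b v (((b v)^-1)%VF z) = z.
  by have [y ->] := bs v z; rewrite lker0_lfunK.
have cn e x : ((b (tgt e))^-1)%VF (arr E' e x) = arr E e (((b (src e))^-1)%VF x).
  by apply: bi; rewrite cE rhomE cE.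
exists (mk_rhom (M := E') (N := E) (f := fun v => ((b v)^-1)%VF) cn); split; apply/rhomP => v x; rewrite !rcompE ridE mk_rhomE /=.
  by apply: bi; rewrite cE bf.
by rewrite -bg cE.
Qed.

Lemma ext_equiv_trans M N (xi1 xi2 xi3 : ext M N) :
  ext_equiv xi1 xi2 -> ext_equiv xi2 xi3 -> ext_equiv xi1 xi3.
Proof.
move=> [b [/rhomP bf /rhomP bg]] [c [/rhomP cf /rhomP cg]].
exists (rcomp c b); split; apply/rhomP => v x.
  by have := bf v x; have := cf v x; rewrite !rcompE !ridE => <- ->.
by have := bg v x; have := cg v (b v x); rewrite !rcompE !ridE => -> ->.
Qed.

Lemma hom_dim_uniq M N d d' : hom_dim M N d -> hom_dim M N d' -> d = d'.
Proof.
have c k : hom_dim M N k -> #|{: rhom M N}| = (#|F| ^ k)%N.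
  by move=> [phi [/bij_eq_card <- _]]; rewrite card_mx mul1n.
move=> /c cd /c; rewrite cd => /eqP; by rewrite (eqn_exp2l _ _ (card_finNzRing_gt1 F)) => /eqP.
Qed.

Lemma ext_dim_uniq M N d d' : ext_dim M N d -> ext_dim M N d' -> d = d'.
Proof.
suff le k l : ext_dim M N k -> ext_dim M N l -> (k <= l)%N.
  by move=> dd dd'; apply/eqP; rewrite eqn_leq !le.
move=> [phi [_ phi_inj _ _]] [psi [psi_surj _ _ _]].
have [h hE] := choice (fun u => psi_surj (phi u)).
have hi : injective h.
  move=> u w uw; apply: phi_inj.
  by apply: (ext_equiv_trans (ext_equiv_sym (hE u))); rewrite uw; exact: hE.
have := leq_card h hi; rewrite !card_mx !mul1n leq_exp2l //.
exact: card_finNzRing_gt1.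
Qed.

Lemma add_int0 (g : int -> int) : (forall c c', g (c + c') = g c + g c') ->
  g 1 = 0 -> forall c, g c = 0.
Proof.
move=> gD g1; have g0 : g 0 = 0 by apply: (addrI (g 0)); rewrite -gD !addr0.
have gn n : g n%:Z = 0.
  by elim: n => // n IH; rewrite intS gD g1 IH.
case=> n; first exact: gn.
by rewrite NegzE; apply: (addIr (g n.+1%:Z)); rewrite -gD addNr g0 gn.
Qed.

Lemma euler_form_uniq (chi chi' : K0 Q F -> K0 Q F -> int) :
  euler_form chi -> euler_form chi' -> chi = chi'.
Proof.
move=> [Dl Dr E] [Dl' Dr' E'].
have gen (h : K0 Q F -> int) : (forall x y, h (x + y) = h x + h y) ->
    (forall x, h (kcls x) = 0) -> forall y, h y = 0.
  move=> hD h0 y.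
  have hZ : h 0 = 0 by apply: (addrI (h 0)); rewrite -hD !addr0.
  have pD x z : kpi (x + z) = kpi x + kpi z :> K0 Q F by exact: pi_add.
  have p0 : kpi 0 = 0 :> K0 Q F by apply: (addrI (kpi 0)); rewrite -pD !addr0.
  have [x ->] : exists x, y = kpi x by exists (repr y); rewrite /kpi reprK.
  rewrite [x]monalgE (big_morph _ pD p0) (big_morph h hD hZ) big1 // => k _.
  apply: (add_int0 (g := fun c => h (kpi << c *g k >>))) => [c c'|].
    by rewrite -hD -pD -monalgUD.
  exact: (h0 k).
apply/funext => x; apply/funext => y; apply/eqP; rewrite -subr_eq0; apply/eqP.
apply: (gen (fun x => chi x y - chi' x y)) => [u w|{}x].
  by rewrite Dl Dl' opprD addrACA.
apply: (gen (fun y => chi (kcls x) y - chi' (kcls x) y)) => [u w|{}y].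
  by rewrite Dr Dr' opprD addrACA.
rewrite -(rreprK x) -(rreprK y).
have [h [e [hd ed ->]]] := E (rrepr x) (rrepr y).
have [h' [e' [hd' ed' ->]]] := E' (rrepr x) (rrepr y).
by rewrite (hom_dim_uniq hd hd') (ext_dim_uniq ed ed') subrr.
Qed.
End EulerForm.

Section LinearFacts.
Variables (R : fieldType) (V W : lmodType R) (f : V -> W).
Hypothesis fl : linear f.
Lemma linD u v : f (u + v) = f u + f v.
Proof. by have := fl 1 u v; rewrite !scale1r. Qed.
Lemma lin0 : f 0 = 0.
Proof. by apply: (addrI (f 0)); rewrite -linD !addr0. Qed.
Lemma linZ a u : f (a *: u) = a *: f u.
Proof. by have := fl a u 0; rewrite lin0 !addr0. Qed.
Lemma linB u v : f (u - v) = f u - f v.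
Proof. by rewrite linD -scaleN1r linZ scaleN1r. Qed.
Lemma lin_sum I (r : seq I) (P : pred I) (g : I -> V) :
  f (\sum_(i <- r | P i) g i) = \sum_(i <- r | P i) f (g i).
Proof. by apply: (big_morph f); [exact: linD|exact: lin0]. Qed.
End LinearFacts.

Section Tensor.
Variables (R : fieldType) (V W : lmodType R).

Definition tpair : choiceType := (V * W)%type.
Definition tfree := {malg R[tpair]}.
Local Notation gen v w := (<< ((v, w) : tpair) >> : tfree).

Inductive tensor_gen : tfree -> Prop :=
| TensorDl v v' w : tensor_gen (gen (v + v') w - (gen v w + gen v' w))
| TensorDr v w w' : tensor_gen (gen v (w + w') - (gen v w + gen v w'))
| TensorZl a v w : tensor_gen (gen (a *: v) w - a *: gen v w)
| TensorZr a v w : tensor_gen (gen v (a *: w) - a *: gen v w).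

Definition tensor_rel : {pred tfree} := fun x =>
  `[< forall J : {pred tfree}, submod_closed J ->
      (forall y, tensor_gen y -> y \in J) -> x \in J >].

Lemma tensor_rel_submod : submod_closed tensor_rel.
Proof.
split=> [|a x y /asboolP xI /asboolP yI]; apply/asboolP => J Js Jg.
  exact: Js.1.
by apply: Js.2; [exact: xI|exact: yI].
Qed.

Lemma tensor_rel_gen x : tensor_gen x -> x \in tensor_rel.
Proof. by move=> xg; apply/asboolP => J _; exact. Qed.

Lemma tensor_rel_ind (J : {pred tfree}) : submod_closed J ->
  (forall y, tensor_gen y -> y \in J) -> {subset tensor_rel <= J}.
Proof. by move=> Js Jg x /asboolP; exact. Qed.

HB.instance Definition _ := GRing.isZmodClosed.Build tfree tensor_rel
  (GRing.submod_closedB tensor_rel_submod).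

Definition tensor := {quot tensor_rel}.
HB.instance Definition _ := GRing.Zmodule.on tensor.

Definition tpi (x : tfree) : tensor := \pi_tensor x.

Lemma tensor_pi_eq (x y : tfree) :
  (tpi x = tpi y) <-> (x - y \in tensor_rel).
Proof. by rewrite /tpi idealrBE; split=> [->|/eqP]. Qed.

Lemma tensor_piD (x y : tfree) :
  tpi (x + y) = tpi x + tpi y.
Proof. exact: pi_add. Qed.

Lemma tensor_piP (t : tensor) : exists x : tfree, t = tpi x.
Proof. by exists (repr t); rewrite /tpi reprK. Qed.

Definition tscale (a : R) (t : tensor) : tensor := tpi (a *: repr t).

Lemma tscale_pi a (x : tfree) : tscale a (tpi x) = tpi (a *: x).
Proof.
apply/tensor_pi_eq; rewrite -scalerBr -[_ *: _]addr0.
apply: tensor_rel_submod.2; last exact: tensor_rel_submod.1.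
by apply/tensor_pi_eq; rewrite /tpi reprK.
Qed.

Lemma tscaleA a b t : tscale a (tscale b t) = tscale (a * b) t.
Proof.
have [x ->] := tensor_piP t.
by rewrite (tscale_pi b) (tscale_pi a) (tscale_pi (a * b)) scalerA.
Qed.
Lemma tscale1 : left_id 1 tscale.
Proof. by move=> t; have [x ->] := tensor_piP t; rewrite tscale_pi scale1r. Qed.
Lemma tscaleDr : right_distributive tscale +%R.
Proof.
move=> a s t; have [x ->] := tensor_piP s; have [y ->] := tensor_piP t.
by rewrite -tensor_piD !tscale_pi scalerDr tensor_piD.
Qed.
Lemma tscaleDl t : {morph tscale^~ t : a b / a + b}.
Proof.
move=> a b; have [x ->] := tensor_piP t.
by rewrite !tscale_pi scalerDl tensor_piD.
Qed.

HB.instance Definition _ :=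
  GRing.Zmodule_isLmodule.Build R tensor tscaleA tscale1 tscaleDr tscaleDl.

Lemma tensor_piZ a (x : tfree) : tpi (a *: x) = a *: tpi x.
Proof. by rewrite -tscale_pi. Qed.

Definition tens (v : V) (w : W) : tensor := tpi (gen v w).

Lemma tensDl v v' w : tens (v + v') w = tens v w + tens v' w.
Proof. by rewrite -tensor_piD; apply/tensor_pi_eq/tensor_rel_gen; exact: TensorDl. Qed.
Lemma tensDr v w w' : tens v (w + w') = tens v w + tens v w'.
Proof. by rewrite -tensor_piD; apply/tensor_pi_eq/tensor_rel_gen; exact: TensorDr. Qed.
Lemma tensZl a v w : tens (a *: v) w = a *: tens v w.
Proof. by rewrite -tensor_piZ; apply/tensor_pi_eq/tensor_rel_gen; exact: TensorZl. Qed.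
Lemma tensZr a v w : tens v (a *: w) = a *: tens v w.
Proof. by rewrite -tensor_piZ; apply/tensor_pi_eq/tensor_rel_gen; exact: TensorZr. Qed.

Lemma tens0l w : tens 0 w = 0.
Proof. by rewrite -(scale0r (0 : V)) tensZl scale0r. Qed.
Lemma tens0r v : tens v 0 = 0.
Proof. by rewrite -(scale0r (0 : W)) tensZr scale0r. Qed.

Lemma tens_suml I (r : seq I) (P : pred I) (v : I -> V) w :
  tens (\sum_(i <- r | P i) v i) w = \sum_(i <- r | P i) tens (v i) w.
Proof.
by apply: (big_morph (tens^~ w)) => [x y|]; rewrite ?tensDl ?tens0l.
Qed.
Lemma tens_sumr I (r : seq I) (P : pred I) v (w : I -> W) :
  tens v (\sum_(i <- r | P i) w i) = \sum_(i <- r | P i) tens v (w i).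
Proof.
by apply: (big_morph (tens v)) => [x y|]; rewrite ?tensDr ?tens0r.
Qed.

Lemma tensor_gen_sum (t : tensor) :
  exists s : seq (V * W), t = \sum_(p <- s) tens p.1 p.2.
Proof.
have [x ->] := tensor_piP t; rewrite [x]monalgE.
have piS (r : seq (V * W)) (F : V * W -> tfree) :
  tpi (\sum_(i <- r) F i) = \sum_(i <- r) tpi (F i).
  apply: (big_morph tpi) => [y z|]; first exact: tensor_piD.
  by apply: (addrI (tpi 0)); rewrite -tensor_piD !addr0.
rewrite piS; exists [seq (x@_p *: p.1, p.2) | p <- msupp x].
rewrite big_map; apply: eq_bigr => -[v w] _ /=.
rewrite tensZl -tensor_piZ; congr (tpi _); apply/malgP => k.
by rewrite mcoeffZ !mcoeffU; case: eqP => _; rewrite ?mulr1 ?mulr0.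
Qed.

Lemma tensor_ind (P : tensor -> Prop) : P 0 ->
  (forall v w, P (tens v w)) -> (forall s t, P s -> P t -> P (s + t)) ->
  forall t, P t.
Proof.
move=> P0 Pt PD t; have [s ->] := tensor_gen_sum t.
by elim/big_ind: _ => // p _; exact: Pt.
Qed.

Definition bilin (U : lmodType R) (f : V -> W -> U) : Prop :=
  (forall w, linear (f^~ w)) /\ (forall v, linear (f v)).

(* The linear map induced by f (meaningful when f is bilinear).               *)
Definition tlift_free (U : lmodType R) (f : V -> W -> U) (x : tfree) : U :=
  \sum_(p <- msupp x) x@_p *: f p.1 p.2.
Definition tlift (U : lmodType R) (f : V -> W -> U) (t : tensor) : U :=
  tlift_free f (repr t).

Section Lift.
Variables (U : lmodType R) (f : V -> W -> U).

Lemma tlift_freeEw (d : {fset tpair}) (x : tfree) :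
  (msupp x `<=` d)%fset -> tlift_free f x = \sum_(p <- d) x@_p *: f p.1 p.2.
Proof.
move=> /fsubsetP xd; rewrite /tlift_free.
apply: big_fset_incl => [|p pd]; first exact/fsubsetP.
by move/mcoeff_outdom => ->; rewrite scale0r.
Qed.

Lemma tlift_free_linear : linear (tlift_free f).
Proof.
move=> a x y.
pose d := (msupp x `|` (msupp y `|` msupp (a *: x + y)))%fset.
have dx : (msupp x `<=` d)%fset.
  by apply/fsubsetP => p; rewrite !in_fsetU => ->.
have dy : (msupp y `<=` d)%fset.
  by apply/fsubsetP => p; rewrite !in_fsetU => ->; rewrite orbT.
have dz : (msupp (a *: x + y) `<=` d)%fset.
  by apply/fsubsetP => p; rewrite !in_fsetU => ->; rewrite !orbT.
rewrite (tlift_freeEw dx) (tlift_freeEw dy) (tlift_freeEw dz).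
rewrite scaler_sumr -big_split; apply: eq_bigr => p _ /=.
by rewrite mcoeffD mcoeffZ scalerDl scalerA.
Qed.

Lemma tlift_free_gen v w : tlift_free f (gen v w) = f v w.
Proof.
rewrite (@tlift_freeEw [fset (v, w)]%fset) ?msuppU_le // big_seq_fset1.
by rewrite mcoeffUU scale1r.
Qed.

Hypothesis f_bilin : bilin f.

Lemma tlift_free_rel x : x \in tensor_rel -> tlift_free f x = 0.
Proof.
have lin := tlift_free_linear.
have [fl fr] := f_bilin.
pose J : {pred tfree} := fun x => tlift_free f x == 0.
move=> xI; apply/eqP; suff: x \in J by [].
apply: (tensor_rel_ind _ _ xI).
  split=> [|a y z /eqP yJ /eqP zJ]; apply/eqP; first exact: lin0.
  by rewrite lin yJ zJ scaler0 addr0.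
move=> y []; intros; apply/eqP; rewrite (linB lin).
- by rewrite (linD lin) !tlift_free_gen (linD (fl w)) subrr.
- by rewrite (linD lin) !tlift_free_gen (linD (fr v)) subrr.
- by rewrite (linZ lin) !tlift_free_gen (linZ (fl w)) subrr.
- by rewrite (linZ lin) !tlift_free_gen (linZ (fr v)) subrr.
Qed.

Lemma tlift_pi x : tlift f (tpi x) = tlift_free f x.
Proof.
apply/eqP; rewrite -subr_eq0 /tlift -(linB tlift_free_linear).
apply/eqP/tlift_free_rel.
by apply/tensor_pi_eq; rewrite /tpi reprK.
Qed.

Lemma tlift_linear : linear (tlift f).
Proof.
move=> a s t; have [x ->] := tensor_piP s; have [y ->] := tensor_piP t.
by rewrite -tensor_piZ -tensor_piD !tlift_pi tlift_free_linear.
Qed.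

Lemma tliftE v w : tlift f (tens v w) = f v w.
Proof. by rewrite tlift_pi tlift_free_gen. Qed.

End Lift.
End Tensor.

Lemma linear_tens_ext (R : fieldType) (V W U : lmodType R)
    (f g : tensor V W -> U) : linear f -> linear g ->
  (forall v w, f (tens v w) = g (tens v w)) -> f =1 g.
Proof.
move=> fl gl fg.
apply: tensor_ind => [|v w|s t fs ft]; first by rewrite (lin0 fl) (lin0 gl).
  exact: fg.
by rewrite (linD fl) (linD gl) fs ft.
Qed.

Definition tmap (R : fieldType) (V V' W W' : lmodType R)
    (f : V -> V') (g : W -> W') : tensor V W -> tensor V' W' :=
  tlift (fun v w => tens (f v) (g w)).

Lemma tmap_bilin (R : fieldType) (V V' W W' : lmodType R) (f : V -> V')
    (g : W -> W') : linear f -> linear g ->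
  bilin (fun v w => tens (f v) (g w)).
Proof.
move=> fl gl; split=> u a x y /=; first by rewrite fl tensDl tensZl.
by rewrite gl tensDr tensZr.
Qed.

Lemma tmap_linear (R : fieldType) (V V' W W' : lmodType R) (f : V -> V')
    (g : W -> W') : linear f -> linear g -> linear (tmap f g).
Proof. by move=> fl gl; exact/tlift_linear/tmap_bilin. Qed.

Lemma tmapE (R : fieldType) (V V' W W' : lmodType R) (f : V -> V')
    (g : W -> W') : linear f -> linear g ->
  forall v w, tmap f g (tens v w) = tens (f v) (g w).
Proof. by move=> fl gl v w; rewrite /tmap tliftE //; exact: tmap_bilin. Qed.

Section FiniteSums.
Local Open Scope classical_set_scope.
Variables (I : choiceType) (V : zmodType).

Lemma fsum_seq (s : seq I) (f : I -> V) : uniq s ->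
  (forall i, f i != 0 -> i \in s) ->
  \sum_(i \in [set: I]) f i = \sum_(i <- s) f i.
Proof.
move=> us fs; rewrite (fsbigE s) //=; first last.
  by move=> i _; apply: contraNeq; exact: fs.
by apply: eq_bigl => i; rewrite in_setT.
Qed.

Lemma finite_suppP (f : I -> V) : finite_set [set i | f i != 0] <->
  exists2 s : seq I, uniq s & forall i, f i != 0 -> i \in s.
Proof.
split=> [/finite_seqP[s sE]|[s _ fs]].
  exists (undup s) => [|i fi]; first exact: undup_uniq.
  by rewrite mem_undup; have : [set` s] i by rewrite -sE.
exact: (sub_finite_set _ (finite_seq s)).
Qed.

Lemma finite_supp2 (f g : I -> V) : finite_set [set i | f i != 0] ->
  finite_set [set i | g i != 0] ->
  exists s : seq I, [/\ uniq s, forall i, f i != 0 -> i \in s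
                      & forall i, g i != 0 -> i \in s].
Proof.
move=> /finite_suppP[s _ fs] /finite_suppP[s' _ gs].
exists (undup (s ++ s')); split=> [|i /fs|i /gs]; first exact: undup_uniq.
  by rewrite mem_undup mem_cat => ->.
by rewrite mem_undup mem_cat orbC => ->.
Qed.

End FiniteSums.

Section Graded.
Local Open Scope classical_set_scope.
Variables (R : fieldType) (K : zmodType).

Definition homog_dec (V : lmodType R) (part : K -> {pred V}) (v : V)
    (f : K -> V) : Prop :=
  [/\ forall n, f n \in part n, finite_set [set n | f n != 0]
    & v = \sum_(n \in [set: K]) f n].

(* A K-graded vector space, given as the internal direct sum of its parts.    *)
Record grvect := GrVect {
  gsort :> lmodType R;
  gpart : K -> {pred gsort};
  gpart_submod : forall n, submod_closed (gpart n);
  gpart_direct : forall v, exists! f, homog_dec gpart v f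
}.

Section Criterion.
Variables (V : lmodType R) (part : K -> {pred V}).
Hypothesis part_submod : forall n, submod_closed (part n).

Lemma part0 n : 0 \in part n. Proof. exact: (part_submod n).1. Qed.
Lemma partP n a u v : u \in part n -> v \in part n -> a *: u + v \in part n.
Proof. exact: (part_submod n).2. Qed.

Lemma homog_decP a u v f g : homog_dec part u f -> homog_dec part v g ->
  homog_dec part (a *: u + v) (fun n => a *: f n + g n).
Proof.
move=> [fp fs ->] [gp gs ->]; have [s [us fS gS]] := finite_supp2 fs gs.
have hS n : a *: f n + g n != 0 -> n \in s.
  apply: contraNT => ns; move: (ns) (ns).
  move=> /(contraNN (fS n)); rewrite negbK => /eqP ->.
  by move=> /(contraNN (gS n)); rewrite negbK => /eqP ->; rewrite scaler0 addr0.
split=> [n||]; first exact: partP.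
  by apply/finite_suppP; exists s.
by rewrite !(fsum_seq us) // scaler_sumr -big_split.
Qed.

Lemma homog_dec1 n v : v \in part n ->
  homog_dec part v (fun m => if m == n then v else 0).
Proof.
move=> vn; have S m : (if m == n then v else 0) != 0 -> m \in [:: n].
  by rewrite inE; case: (m == n) => //; rewrite eqxx.
split=> [m||]; first by case: eqP => [->//|_]; exact: part0.
  by apply/finite_suppP; exists [:: n].
by rewrite (fsum_seq (s := [:: n])) // big_seq1 eqxx.
Qed.

Hypothesis part_gen : forall J : V -> Prop, J 0 ->
  (forall u v, J u -> J v -> J (u + v)) ->
  (forall n v, v \in part n -> J v) -> forall v, J v.
Hypothesis part_indep : forall (s : seq K) (f : K -> V), uniq s ->
  (forall n, f n \in part n) -> (forall n, f n != 0 -> n \in s) ->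
  \sum_(n <- s) f n = 0 -> forall n, f n = 0.

Lemma part_direct v : exists! f, homog_dec part v f.
Proof.
have [f fv] : exists f, homog_dec part v f.
  elim/part_gen: v => [|u v [f fu] [g gv]|n v vn].
  - by exists (fun m => if m == 0 then 0 else 0); apply/homog_dec1/part0.
  - exists (fun n => 1 *: f n + g n).
    by rewrite -[u]scale1r; exact: homog_decP.
  - by exists (fun m => if m == n then v else 0); exact: homog_dec1.
exists f; split=> // g gv; apply/funext => n; apply/eqP.
rewrite eq_sym -subr_eq0 -scaleN1r addrC; apply/eqP.
have [hp /finite_suppP[s us hs] h0] := homog_decP (-1) fv gv.
rewrite scaleN1r addNr (fsum_seq us hs) in h0.
exact: (part_indep us hp hs (esym h0)).
Qed.

End Criterion.

Section Components.
Variable V : grvect.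

Definition hcomp (n : K) (v : V) : V := projT1 (cid (gpart_direct v)) n.

Lemma hcompP v : homog_dec (@gpart V) v (hcomp^~ v).
Proof. by rewrite /hcomp; case: cid => f [/= H _]; exact: H. Qed.

Lemma hcomp_uniq v f : homog_dec (@gpart V) v f -> hcomp^~ v = f.
Proof.
have [g [_ gU]] := gpart_direct v.
by move=> /gU <-; rewrite -(gU _ (hcompP v)).
Qed.

Lemma hcomp_linear n : linear (hcomp n).
Proof.
move=> a u v.
have := hcomp_uniq (homog_decP (@gpart_submod V) a (hcompP u) (hcompP v)).
by move/(congr1 (@^~ n)).
Qed.

Lemma hcomp_homog n m v : v \in gpart n -> hcomp m v = if m == n then v else 0.
Proof.
move=> /(homog_dec1 (@gpart_submod V))/hcomp_uniq.
by move/(congr1 (@^~ m)).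
Qed.

End Components.

Definition is_grmor (V W : grvect) (f : V -> W) : Prop :=
  linear f /\ forall n v, v \in gpart n -> f v \in gpart n.

Definition gunit_part (n : K) : {pred R^o} := fun r => (n == 0) || (r == 0).

Lemma gunit_submod n : submod_closed (gunit_part n).
Proof.
split=> [|a u v]; first by rewrite unfold_in /= eqxx orbT.
rewrite !unfold_in; case: eqP => //= _ /eqP -> /eqP ->.
by rewrite scaler0 addr0.
Qed.

Lemma gunit_direct v : exists! f, homog_dec gunit_part v f.
Proof.
apply: part_direct => [|J J0 JD JH u|s f us fp fs f0 n].
- exact: gunit_submod.
- by apply: (JH 0); rewrite unfold_in eqxx.
have [n0|n0] := eqVneq n 0; last first.
  by have := fp n; rewrite unfold_in (negPf n0) => /eqP.
apply/eqP/negPn/negP => fn0; move: f0.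
rewrite (bigD1_seq n) ?fs //= big1 ?addr0 => [|m mn].
  by move=> H; rewrite H eqxx in fn0.
by have := fp m; rewrite unfold_in -n0 (negPf mn) => /eqP.
Qed.

Definition gunit : grvect := GrVect gunit_submod gunit_direct.

(* The tensor product: its part of degree d is spanned by the v (x) w with    *)
(* v in V_n and w in W_m, where n + m = d.                                    *)
Section GTensor.
Variables (V W : grvect).

Definition gtens_part (d : K) : {pred tensor V W} := fun t =>
  `[< exists s : seq (V * W), t = \sum_(p <- s) tens p.1 p.2 /\
      forall p, p \in s -> exists n m,
        [/\ n + m = d, p.1 \in gpart n & p.2 \in gpart m] >].

Lemma gtens_part_tens n m v w : v \in gpart n -> w \in gpart m ->
  tens v w \in gtens_part (n + m).
Proof.
move=> vn wm; apply/asboolP; exists [:: (v, w)]; rewrite big_seq1; split=> //.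
by move=> p; rewrite inE => /eqP ->; exists n, m.
Qed.

Lemma gtens_submod d : submod_closed (gtens_part d).
Proof.
split=> [|a t u /asboolP[s [-> sd]] /asboolP[s' [-> sd']]]; apply/asboolP.
  by exists [::]; rewrite big_nil.
exists ([seq (a *: p.1, p.2) | p <- s] ++ s').
rewrite big_cat big_map scaler_sumr; split=> [|p].
  by congr (_ + _); apply: eq_bigr => p _; rewrite tensZl.
rewrite mem_cat => /orP[/mapP[p' /sd[n [m [nm p1 p2]]] ->]|/sd' //].
exists n, m; split=> //=.
by have := (gpart_submod V n).2 a _ 0 p1 (gpart_submod V n).1; rewrite addr0.
Qed.

Let P n m : tensor V W -> tensor V W := tmap (@hcomp V n) (@hcomp W m).

Let P_linear n m : linear (P n m).
Proof. by apply: tmap_linear; exact: hcomp_linear. Qed.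

Let PE n m v w : P n m (tens v w) = tens (hcomp n v) (hcomp m w).
Proof. by apply: tmapE; exact: hcomp_linear. Qed.

Let PD n m s t : P n m (s + t) = P n m s + P n m t.
Proof. exact: linD. Qed.

Let P0 n m : P n m 0 = 0.
Proof. exact: lin0. Qed.

Let P_sum n m I (r : seq I) (f : I -> tensor V W) :
  P n m (\sum_(i <- r) f i) = \sum_(i <- r) P n m (f i).
Proof. exact: lin_sum. Qed.

Let P_part n m d t : t \in gtens_part d -> n + m != d -> P n m t = 0.
Proof.
move=> /asboolP[s [-> sd]] nm; rewrite P_sum big_seq big1 // => p /sd.
case=> [n' [m' [nm' p1 p2]]]; rewrite PE (hcomp_homog _ p1) (hcomp_homog _ p2).
case: eqP => [nE|_]; last exact: tens0l.
case: eqP => [mE|_]; last exact: tens0r.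
by rewrite nE mE nm' eqxx in nm.
Qed.

Let P_total t : exists s : seq K, forall s', uniq s' -> {subset s <= s'} ->
  t = \sum_(n <- s') \sum_(m <- s') P n m t.
Proof.
elim/tensor_ind: t => [|v w|t u [s sE] [s' s'E]].
- by exists [::] => s' _ _; rewrite !big1 // => n _; rewrite big1.
- have [_ /finite_suppP[s1 _ s1E] vE] := hcompP v.
  have [_ /finite_suppP[s2 _ s2E] wE] := hcompP w.
  exists (s1 ++ s2) => s us ss.
  rewrite (fsum_seq us) in vE; last first.
    by move=> n /s1E ns; apply: ss; rewrite mem_cat ns.
  rewrite (fsum_seq us) in wE; last first.
    by move=> n /s2E ns; apply: ss; rewrite mem_cat ns orbT.
  rewrite [in LHS]vE [in LHS]wE tens_suml; apply: eq_bigr => n _.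
  by rewrite tens_sumr; apply: eq_bigr => m _; rewrite PE.
- exists (s ++ s') => r ur rs.
  rewrite [in LHS](sE r) //; last first.
    by move=> n ns; apply: rs; rewrite mem_cat ns.
  rewrite [X in _ + X](s'E r) //; last first.
    by move=> n ns; apply: rs; rewrite mem_cat ns orbT.
  rewrite -big_split; apply: eq_bigr => n _.
  by rewrite -big_split; apply: eq_bigr => m _; rewrite PD.
Qed.

Lemma gtens_direct t : exists! f, homog_dec gtens_part t f.
Proof.
apply: part_direct => [|J J0 JD JH u|s f us fp fs f0 d].
- exact: gtens_submod.
- have [s ->] := tensor_gen_sum u; elim/big_ind: _ => // -[v w] _ /=.
  have [vp /finite_suppP[s1 us1 s1E] ->] := hcompP v.
  have [wp /finite_suppP[s2 us2 s2E] ->] := hcompP w.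
  rewrite (fsum_seq us1) // (fsum_seq us2) // tens_suml.
  elim/big_ind: _ => // n _; rewrite tens_sumr; elim/big_ind: _ => // m _.
  by apply: (JH (n + m)); exact: gtens_part_tens.
have Pf n m : P n m (f d) = 0.
  have [nmd|] := eqVneq (n + m) d; last by apply: P_part; exact: fp.
  have [->|fd] := eqVneq (f d) 0; first exact: P0.
  have := congr1 (P n m) f0; rewrite P0 P_sum (bigD1_seq d) ?fs //=.
  rewrite big1 ?addr0 // => k kd; apply: (P_part (fp k)).
  by rewrite nmd eq_sym.
have [r rE] := P_total (f d).
rewrite (rE (undup r)) ?undup_uniq // => [|n]; last by rewrite mem_undup.
by rewrite big1 // => n _; rewrite big1.
Qed.

Definition gtens : grvect := GrVect gtens_submod gtens_direct.

End GTensor.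

Definition gmap (V V' W W' : grvect) (f : V -> V') (g : W -> W') :
    gtens V W -> gtens V' W' := tmap f g.

(* (u (x) v) (x) w |-> u (x) (v (x) w) and its inverse.                       *)
Definition assoc (U V W : grvect) (t : gtens (gtens U V) W) :
    gtens U (gtens V W) :=
  tlift (fun (s : tensor U V) w =>
           tlift (fun u v => tens u (tens v w) : gtens U (gtens V W)) s) t.
Definition assoc_inv (U V W : grvect) (t : gtens U (gtens V W)) :
    gtens (gtens U V) W :=
  tlift (fun u (s : tensor V W) =>
           tlift (fun v w => tens (tens u v) w : gtens (gtens U V) W) s) t.

Definition lunit (V : grvect) (t : gtens gunit V) : V :=
  tlift (fun (r : R^o) v => r *: v) t.
Definition runit (V : grvect) (t : gtens V gunit) : V :=
  tlift (fun v (r : R^o) => r *: v) t.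

Section Braiding.
Variables (q : R) (chi : K -> K -> int).

Definition braid_pair (V W : grvect) (v : V) (w : W) : gtens W V :=
  \sum_(n \in [set: K]) \sum_(m \in [set: K])
    q ^ (- chi n m) *: (tens (hcomp m w) (hcomp n v) : gtens W V).

Definition braid (V W : grvect) (t : gtens V W) : gtens W V :=
  tlift (@braid_pair V W) t.

Lemma braid_pair_seq (V W : grvect) (v : V) (w : W) (s s' : seq K) :
  uniq s -> uniq s' -> (forall n, hcomp n v != 0 -> n \in s) ->
  (forall m, hcomp m w != 0 -> m \in s') ->
  braid_pair v w = \sum_(n <- s) \sum_(m <- s')
    q ^ (- chi n m) *: (tens (hcomp m w) (hcomp n v) : gtens W V).
Proof.
move=> us us' vs ws.
have inner n : \sum_(m \in [set: K])
    q ^ (- chi n m) *: (tens (hcomp m w) (hcomp n v) : gtens W V) =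
  \sum_(m <- s') q ^ (- chi n m) *: (tens (hcomp m w) (hcomp n v) : gtens W V).
  apply: fsum_seq => // m; apply: contraNT => /(contraNN (ws m)).
  by rewrite negbK => /eqP ->; rewrite tens0l scaler0.
rewrite /braid_pair (fsum_seq us) => [|n].
  by apply: eq_bigr => n _; exact: inner.
apply: contraNT => /(contraNN (vs n)); rewrite negbK inner => /eqP ->.
by rewrite big1 // => m _; rewrite tens0r scaler0.
Qed.

Lemma braid_pair_bilin (V W : grvect) : bilin (@braid_pair V W).
Proof.
split=> [w a u v|v a u w].
  have [_ uf _] := hcompP u; have [_ vf _] := hcompP v.
  have [s [us uS vS]] := finite_supp2 uf vf.
  have [_ /finite_suppP[s' us' wS] _] := hcompP w.
  have zS n : hcomp n (a *: u + v) != 0 -> n \in s.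
    rewrite hcomp_linear; apply: contraNT => ns; move: (ns) (ns).
    move=> /(contraNN (uS n)); rewrite negbK => /eqP ->.
    move=> /(contraNN (vS n)); rewrite negbK => /eqP ->.
    by rewrite scaler0 addr0.
  rewrite !(braid_pair_seq us us') // scaler_sumr -big_split.
  apply: eq_bigr => n _; rewrite scaler_sumr -big_split; apply: eq_bigr => m _.
  by rewrite hcomp_linear tensDr tensZr scalerDr /= !scalerA (mulrC a).
have [_ uf _] := hcompP u; have [_ wf _] := hcompP w.
have [s [us uS wS]] := finite_supp2 uf wf.
have [_ /finite_suppP[s' us' vS] _] := hcompP v.
have zS n : hcomp n (a *: u + w) != 0 -> n \in s.
  rewrite hcomp_linear; apply: contraNT => ns; move: (ns) (ns).
  move=> /(contraNN (uS n)); rewrite negbK => /eqP ->.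
  move=> /(contraNN (wS n)); rewrite negbK => /eqP ->.
  by rewrite scaler0 addr0.
rewrite !(braid_pair_seq us' us) // scaler_sumr -big_split.
apply: eq_bigr => n _; rewrite scaler_sumr -big_split; apply: eq_bigr => m _.
by rewrite hcomp_linear tensDl tensZl scalerDr /= !scalerA (mulrC a).
Qed.

Lemma braidE (V W : grvect) n m (v : V) (w : W) :
  v \in gpart n -> w \in gpart m ->
  braid (tens v w : gtens V W) = q ^ (- chi n m) *: tens w v.
Proof.
move=> vn wm; rewrite /braid tliftE; last exact: braid_pair_bilin.
rewrite (@braid_pair_seq _ _ v w [:: n] [:: m]) //.
- by rewrite !big_seq1 (hcomp_homog n vn) (hcomp_homog m wm) !eqxx.
- by move=> k; rewrite (hcomp_homog k vn) inE; case: (k == n) => //; rewrite eqxx.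
- by move=> k; rewrite (hcomp_homog k wm) inE; case: (k == m) => //; rewrite eqxx.
Qed.

(* (A (x) A) (x) (A (x) A) with its middle factors exchanged by the braiding. *)
Definition mid_braid (A : grvect) (t : gtens (gtens A A) (gtens A A)) :
    gtens (gtens A A) (gtens A A) :=
  assoc_inv (gmap id (fun s : gtens A (gtens A A) =>
    assoc (gmap (@braid A A) id (assoc_inv s))) (assoc t)).

Section Hopf.
Variable A : grvect.
Variables (mul : gtens A A -> A) (unit : gunit -> A).
Variables (comul : A -> gtens A A) (counit : A -> gunit).

Definition is_monoid : Prop :=
  [/\ is_grmor mul, is_grmor unit,
      forall t, mul (gmap mul id t) = mul (gmap id mul (assoc t)),
      forall t, mul (gmap unit id t) = lunit t
    & forall t, mul (gmap id unit t) = runit t].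

Definition is_comonoid : Prop :=
  [/\ is_grmor comul, is_grmor counit,
      forall a, assoc (gmap comul id (comul a)) = gmap id comul (comul a),
      forall a, lunit (gmap counit id (comul a)) = a
    & forall a, runit (gmap id counit (comul a)) = a].

Definition mul2 (t : gtens (gtens A A) (gtens A A)) : gtens A A :=
  gmap mul mul (mid_braid t).
Definition unit2 (r : gunit) : gtens A A :=
  gmap unit unit (tens r (1 : R^o)).

Definition is_bialgebra : Prop :=
  [/\ is_monoid, is_comonoid,
      (forall t, comul (mul t) = mul2 (gmap comul comul t)) /\
      (forall r, comul (unit r) = unit2 r)
    & (forall t, counit (mul t) = lunit (gmap counit counit t)) /\
      (forall r, counit (unit r) = r)].

Definition is_antipode (S : A -> A) : Prop :=
  [/\ is_grmor S,
      forall a, mul (gmap S id (comul a)) = unit (counit a)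
    & forall a, mul (gmap id S (comul a)) = unit (counit a)].

Definition is_hopf : Prop := is_bialgebra /\ exists S, is_antipode S.

End Hopf.
End Braiding.

(* The free vector space on X, graded by deg : X -> K on the basis.           *)
Section Free.
Variables (X : choiceType) (deg : X -> K).

Definition free_part (n : K) : {pred {malg R[X]}} := fun h =>
  all (fun x => deg x == n) (msupp h).

Lemma free_partP n (h : {malg R[X]}) :
  reflect (forall x, deg x != n -> h@_x = 0) (h \in free_part n).
Proof.
apply: (iffP allP) => H x.
  by apply: contraNeq; rewrite mcoeff_neq0; exact: H.
by rewrite -mcoeff_neq0; apply: contraNT => /H ->.
Qed.

Lemma free_submod n : submod_closed (free_part n).
Proof.
split=> [|a u v /free_partP un /free_partP vn]; apply/free_partP => x xn.
  by rewrite mcoeff0.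
by rewrite mcoeffD mcoeffZ un // vn // mulr0 addr0.
Qed.

Lemma free_direct v : exists! f, homog_dec free_part v f.
Proof.
apply: part_direct => [|J J0 JD JH u|s f us fp fs f0 n].
- exact: free_submod.
- rewrite [u]monalgE; elim/big_ind: _ => // x _; apply: (JH (deg x)).
  apply/free_partP => y yx; rewrite mcoeffU.
  by case: eqP => [xy|]; rewrite ?mulr0n //; rewrite xy eqxx in yx.
apply/malgP => x; rewrite mcoeff0.
have [xn|] := eqVneq (deg x) n; last by move/(free_partP _ _ (fp n)).
have [->|fn] := eqVneq (f n) 0; first by rewrite mcoeff0.
have := congr1 (mcoeff x) f0; rewrite raddf_sum /= (bigD1_seq n) ?fs //=.
rewrite big1 ?addr0 ?mcoeff0 // => m mn; apply: (free_partP _ _ (fp m)).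
by rewrite xn eq_sym.
Qed.

Definition gfree : grvect := GrVect free_submod free_direct.

Definition free_lift (U : lmodType R) (b : X -> U) (h : gfree) : U :=
  \sum_(x <- msupp (h : {malg R[X]})) (h : {malg R[X]})@_x *: b x.

End Free.
End Graded.

Section Hall.
Local Open Scope classical_set_scope.
Variables (Q : quiver) (F : finFieldType) (R : realType).
Local Notation X := (isocls Q F).

Definition hall : grvect R (K0 Q F) := gfree R (@kcls Q F).

Definition hall_elt (x : X) : hall := << x >> : {malg R[X]}.

(* A sum \sum_(i \in A) is 0 by convention when its support is infinite; the   *)
(* supports of the sums over isomorphism classes below are finite.            *)
Definition hall_mul_coef (x y z : X) : R :=
  (hall_nb (rrepr x) (rrepr y) (rrepr z))%:R
    / ((aut (rrepr x))%:R * (aut (rrepr y))%:R).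

Definition hall_mul (t : gtens hall hall) : hall :=
  tlift (fun h k : hall => free_lift (fun x => free_lift (fun y =>
    \sum_(z \in [set: X]) hall_mul_coef x y z *: hall_elt z) k) h) t.

Definition hall_comul_coef (x y z : X) : R :=
  (hall_nb (rrepr x) (rrepr y) (rrepr z))%:R / (aut (rrepr z))%:R.

Definition hall_comul (h : hall) : gtens hall hall :=
  free_lift (fun z => \sum_(p \in [set: X * X])
    hall_comul_coef p.1 p.2 z *: (tens (hall_elt p.2) (hall_elt p.1)
                                  : gtens hall hall)) h.

Definition hall_unit (r : gunit R (K0 Q F)) : hall :=
  (r : R) *: hall_elt (cls (zero_rep Q F)).

Definition hall_counit (h : hall) : gunit R (K0 Q F) :=
  (h : {malg R[X]})@_(cls (zero_rep Q F)).

End Hall.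

(* Main.v *)
(* The structure constants of the Hall algebra count diagrams, and every
   identity between them is a double count, weighted by 1/|Aut|, of the finite
   set of diagrams of a given shape.  Associativity and coassociativity count
   flags L < E' < G, through E' or through G / L.  Compatibility of the product
   with the coproduct is Green's formula: a pair of short exact sequences
   N -> E -> M and Y -> E -> X (a cross) determines the corners D, C, B, A of a
   3 x 3 diagram up to unique isomorphism; conversely, with the outer frame
   fixed, the crosses filling it, weighted by 1/|Aut E|, number
   |prod_e Hom(A_(s e), D_(t e))| / |prod_v Hom(A_v, D_v)|, because the matrix of
   E in a splitting N (+) M is determined up to its free entry A -> D.  Since
   Ext^1 and Hom are the cokernel and kernel of
   prod_v Hom(A_v, D_v) -> prod_e Hom(A_(s e), D_(t e)), this number is
   q^(-<A,D>), which is the braiding.  The antipode is the geometric series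
   sum_k (-1)^k (id - eta eps)^{*k}, finite on each element because id - eta eps
   kills the class of 0 and dimensions add up in the coproduct. *)

Require Import Defs.
From HB Require Import structures.
From mathcomp Require Import all_boot all_order all_algebra.
From mathcomp Require Import finmap.
From mathcomp Require Import boolp.
From mathcomp Require Import fsbigop reals.
From mathcomp Require Import monalg ring.

Set Implicit Arguments.
Unset Strict Implicit.
Unset Printing Implicit Defensive.

Import Order.TTheory GRing.Theory Num.Theory.
Import Quotient.

Local Open Scope ring_scope.
Local Open Scope quotient_scope.

(** * Representations *)

(** Kernels, cokernels and coimages exist only up to isomorphism, whereas the structure constants
    refer to one chosen representative of each class. The weight 1/|Aut| absorbs this: the kernel
    embeddings of a given map from a given representative are either absent or a torsor under its
    automorphisms, so their weighted number over all classes is 1. A piece of a diagram that is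
    determined up to unique isomorphism therefore costs a factor 1, and every identity becomes two
    weighted counts of one relation. All sums are finite because total dimension is additive on
    short exact sequences and a finite field leaves finitely many classes below any bound. The
    coproduct puts the subobject on the left. This is what makes the braiding fit: in the product of
    two coproducts the adjacent middle factors are the quotient A of M and the subobject D of N, the
    corners between which the matrix of E has its free entry. The same block matrices on N (+) M
    compute Ext^1, a change of splitting altering the block by a coboundary. *)

Section LinearMaps.
Variables (F : fieldType) (U V : vectType F).

(** The pseudo-inverse [f^-1] is total and linear for every [f]. It supplies all vertexwise sections
    and retractions below; these need not commute with the arrows of a representation. *)
Lemma lfun_surj_invK (f : 'Hom(U, V)) : (forall z, exists y, z = f y) ->
  forall z, f ((f^-1)%VF z) = z.
Proof. by move=> fs z; have [y ->] := fs z; rewrite limg_lfunVK ?memv_img ?memvf. Qed.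

Lemma lfun_inj_invK (f : 'Hom(U, V)) : injective f -> forall x, (f^-1)%VF (f x) = x.
Proof. by move=> fi x; rewrite lker0_lfunK //; apply/lker0P. Qed.

Lemma lfun_img_invK (f : 'Hom(U, V)) z : (exists y, z = f y) -> f ((f^-1)%VF z) = z.
Proof. by case=> y ->; rewrite limg_lfunVK ?memv_img ?memvf. Qed.

Lemma lfun_inj (f : 'Hom(U, V)) : (forall x, f x = 0 -> x = 0) -> injective f.
Proof.
move=> f0 x y xy; apply/eqP; rewrite -subr_eq0; apply/eqP/f0.
by rewrite linearB /= xy subrr.
Qed.

End LinearMaps.

Section RepBasics.
Variables (Q : quiver) (F : finFieldType).
Implicit Types M N E G L W : rep Q F.

Definition rinj M N (f : rhom M N) : Prop := forall v, injective (f v).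
Definition rsurj M N (f : rhom M N) : Prop := forall v z, exists y, z = f v y.
Definition rexact N E M (f : rhom N E) (g : rhom E M) : Prop :=
  forall v y, g v y = 0 <-> exists x, y = f v x.
Definition is_ker N E M (f : rhom N E) (g : rhom E M) : Prop :=
  rinj f /\ rexact f g.
Definition is_coker N E M (f : rhom N E) (g : rhom E M) : Prop :=
  rsurj g /\ rexact f g.

Lemma short_exactE N E M (f : rhom N E) (g : rhom E M) :
  reflect [/\ rinj f, rexact f g & rsurj g] (short_exact f g).
Proof. exact: short_exactP. Qed.

Lemma rinj0 M N (f : rhom M N) v x : rinj f -> f v x = 0 -> x = 0.
Proof. by move=> fi fx; apply: (fi v); rewrite fx linear0. Qed.

Lemma rinjP M N (f : rhom M N) :
  (forall v x, f v x = 0 -> x = 0) -> rinj f.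
Proof. by move=> f0 v; apply: lfun_inj => x; exact: f0. Qed.

Lemma rexact0 N E M (f : rhom N E) (g : rhom E M) v x :
  rexact f g -> g v (f v x) = 0.
Proof. by move=> fg; apply/fg; exists x. Qed.

(** The vertexwise lift through [k^-1] is natural because naturality can be tested after the
    injective [k]. *)
Lemma rlift_inj E G W (k : rhom E G) (z : rhom W G) : rinj k ->
  (forall v x, exists y, z v x = k v y) ->
  exists t : rhom W E, forall v x, k v (t v x) = z v x.
Proof.
move=> ki zk.
have kE v x : k v (((k v)^-1)%VF (z v x)) = z v x.
  by rewrite lfun_img_invK.
have tn e x : (((k (tgt e))^-1)%VF \o z (tgt e))%VF (arr W e x) =
    arr E e ((((k (src e))^-1)%VF \o z (src e))%VF x).
  apply: (ki (tgt e)); by rewrite !comp_lfunE rhomE !kE rhomE.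
exists (mk_rhom (M := W) (N := E) (f := fun v => (((k v)^-1)%VF \o z v)%VF) tn).
by move=> v x; rewrite mk_rhomE comp_lfunE kE.
Qed.

(** Since [z] kills the kernel of [p], the composite of [z] with [p^-1] does not depend on the
    section chosen, and this makes it natural. *)
Lemma rfact_surj E G W (p : rhom G E) (z : rhom G W) : rsurj p ->
  (forall v x, p v x = 0 -> z v x = 0) ->
  exists t : rhom E W, forall v x, t v (p v x) = z v x.
Proof.
move=> ps pz.
have tE v x : z v (((p v)^-1)%VF (p v x)) = z v x.
  apply/eqP; rewrite -subr_eq0 -linearB; apply/eqP/pz.
  by rewrite linearB /= lfun_img_invK ?subrr //; exists x.
have tn e x : (z (tgt e) \o ((p (tgt e))^-1)%VF)%VF (arr E e x) =
    arr W e ((z (src e) \o ((p (src e))^-1)%VF)%VF x).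
  by have [y ->] := ps _ x; rewrite !comp_lfunE -(rhomE p) !tE rhomE.
exists (mk_rhom (M := E) (N := W) (f := fun v => (z v \o ((p v)^-1)%VF)%VF) tn).
by move=> v x; rewrite mk_rhomE comp_lfunE tE.
Qed.

Lemma is_isoP M N (f : rhom M N) :
  reflect (rinj f /\ rsurj f) (is_iso f).
Proof.
apply: (iffP existsP) => [[g /andP[/eqP gf /eqP fg]]|[fi fs]].
  split=> v; first by apply: (can_inj (g := g v)) => x; rewrite -rcompE gf ridE.
  by move=> z; exists (g v z); rewrite -rcompE fg ridE.
have [|g gE] := rlift_inj (z := rid N) fi.
  by move=> v x; have [y ->] := fs v x; exists y; rewrite ridE.
exists g; apply/andP; split; apply/eqP/rhomP => v x; rewrite rcompE !ridE.
  by apply: (fi v); rewrite gE ridE.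
by rewrite gE ridE.
Qed.

Lemma kernel_exists E M (h : rhom E M) :
  exists (K : rep Q F) (k : rhom K E), is_ker k h.
Proof.
pose K := @Rep Q F (fun v => subvs_of (lker (h v)))
  (fun e => linfun (vsproj (lker (h (tgt e)))) \o arr E e \o linfun vsval)%VF.
have kn e (x : obj K (src e)) :
    (linfun vsval : 'Hom(obj K _, obj E _)) (arr K e x) =
    arr E e ((linfun vsval : 'Hom(obj K _, obj E _)) x).
  rewrite !lfunE /= !comp_lfunE !lfunE /= vsprojK // memv_ker rhomE.
  by move: (subvsP x); rewrite memv_ker => /eqP ->; rewrite linear0.
exists K, (mk_rhom (M := K) (N := E) (f := fun v => linfun vsval) kn); split=> v.
  by move=> x y; rewrite !mk_rhomE !lfunE /= => /val_inj.
move=> y; split=> [hy|[x ->]].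
  by exists (vsproj (lker (h v)) y); rewrite mk_rhomE lfunE /= vsprojK // memv_ker hy.
by rewrite mk_rhomE lfunE /=; apply/eqP; rewrite -memv_ker subvsP.
Qed.

(** The quotient is realised on a complement of the image at each vertex, with the arrows of [E]
    followed by the projection along the image. *)
Lemma cokernel_exists N E (l : rhom N E) :
  exists (C : rep Q F) (p : rhom E C), is_coker l p.
Proof.
pose I v := limg (l v).
pose p v := daddv_pi (I v)^C (I v).
have dis v : ((I v)^C :&: I v = 0)%VS by rewrite capvC capv_compl.
have pI v y : p v y \in (I v)^C%VS by rewrite memv_pi.
have pid v y : y \in (I v)^C%VS -> p v y = y by apply: daddv_pi_id.
have dec v y : exists2 z, z \in I v & y = p v y + z.
  exists (daddv_pi (I v) (I v)^C y); first exact: memv_pi.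
  by rewrite (daddv_pi_add (dis v)) // addvC addv_complf memvf.
have p0 v y : p v y = 0 <-> exists x, y = l v x.
  split=> [py|[x ->]].
    by have [z /memv_imgP[x _ ->] ->] := dec v y; exists x; rewrite py add0r.
  have lI : l v x \in I v by rewrite memv_img ?memvf.
  have [z zI E1] := dec v (l v x); apply/eqP; rewrite -memv0 -(dis v) memv_cap pI /=.
  by rewrite -[p v _](addrK z) -E1 memvB.
pose C := @Rep Q F (fun v => subvs_of (I v)^C%VS)
  (fun e => linfun (vsproj (I (tgt e))^C%VS) \o p (tgt e) \o arr E e \o linfun vsval)%VF.
pose q v : 'Hom(obj E v, obj C v) := (linfun (vsproj (I v)^C%VS) \o p v)%VF.
have qE v y : vsval (q v y) = p v y by rewrite comp_lfunE lfunE /= vsprojK ?pI.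
have qn e x : q (tgt e) (arr E e x) = arr C e (q (src e) x).
  apply: val_inj; rewrite /= qE 3!comp_lfunE lfunE /= vsprojK ?pI // lfunE /= qE.
  have [z /memv_imgP[w _ ->] E1] := dec (src e) x.
  rewrite {1}E1 !linearD /= -(rhomE l); rewrite [X in _ + X](_ : _ = 0) ?addr0 //.
  by apply/p0; exists (arr N e w).
exists C, (mk_rhom (M := E) (N := C) (f := q) qn); split=> v.
  move=> z; exists (vsval z); rewrite mk_rhomE; apply: val_inj.
  by rewrite /= qE pid // subvsP.
move=> y; rewrite mk_rhomE -p0 -qE; split=> [->|H]; first by rewrite linear0.
by apply: val_inj; rewrite /= H.
Qed.

End RepBasics.

(** * Counting isomorphism classes *)

Section Counting.
Variables (Q : quiver) (F : finFieldType) (R : realType).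
Implicit Types M N E G L W : rep Q F.
Local Notation X := (isocls Q F).

Definition isoset M N := [set f : rhom M N | is_iso f].

Lemma aut_gt0 M : (0 < aut M)%N.
Proof.
apply/card_gt0P; exists (rid M); rewrite inE; apply/is_isoP; split=> v.
  by move=> x y; rewrite !ridE.
by move=> z; exists z; rewrite ridE.
Qed.

Lemma is_iso_rcomp M N E (g : rhom N E) (f : rhom M N) :
  is_iso g -> is_iso f -> is_iso (rcomp g f).
Proof.
move=> /is_isoP[gi gs] /is_isoP[fi fs]; apply/is_isoP; split=> v.
  by move=> x y; rewrite !rcompE => /gi/fi.
by move=> z; have [y ->] := gs v z; have [x ->] := fs v y; exists x; rewrite rcompE.
Qed.

(** Once one isomorphism f is fixed, h |-> f h identifies Aut M with the isomorphisms from M to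
    N. *)
Lemma card_isoset M N : #|isoset M N| = if isorep M N then aut M else 0%N.
Proof.
case: ifPn => [/existsP[f fI]|nMN]; last first.
  apply/eqP; rewrite cards_eq0; apply/eqP/setP => f; rewrite !inE.
  by apply: contraNF nMN => fI; apply/existsP; exists f.
have /is_isoP[fi fs] := fI.
rewrite /aut -(card_imset [set h | is_iso h] (f := rcomp f)); last first.
  move=> h h' /rhomP hh; apply/rhomP => v x; apply: (fi v).
  by rewrite -!rcompE.
apply: eq_card => g; rewrite inE; apply/idP/imsetP => [gI|[h]]; last first.
  by rewrite inE => hI ->; exact: is_iso_rcomp.
have /is_isoP[gi gs] := gI.
have [|h hE] := rlift_inj (z := g) fi; first by move=> v x; exact: fs.
exists h; last by apply/rhomP => v x; rewrite rcompE hE.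
rewrite inE; apply/is_isoP; split=> v; first by move=> x y /(congr1 (f v)); rewrite !hE => /gi.
move=> z; have [x xE] := gs v (f v z); exists x; apply: (fi v).
by rewrite hE.
Qed.

Lemma card_isosetr M N : #|isoset M N| = if isorep M N then aut N else 0%N.
Proof.
rewrite card_isoset; case: ifP => // /existsP[f fI].
have /is_isoP[fi fs] := fI.
transitivity #|isoset M N|; first by rewrite card_isoset ifT //; apply/existsP; exists f.
rewrite /aut -(card_imset [set h | is_iso h] (f := fun h => rcomp h f)); last first.
  move=> h h' /rhomP hh; apply/rhomP => v x; have [y ->] := fs v x.
  by rewrite -!rcompE.
apply: eq_card => g; rewrite inE; apply/idP/imsetP => [gI|[h]]; last first.
  by rewrite inE => hI ->; exact: is_iso_rcomp.
have /is_isoP[gi gs] := gI.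
have [|h hE] := rfact_surj (z := g) fs.
  by move=> v x /(rinj0 fi) ->; rewrite linear0.
exists h; last by apply/rhomP => v x; rewrite rcompE hE.
rewrite inE; apply/is_isoP; split=> v.
  move=> x y; have [x' ->] := fs v x; have [y' ->] := fs v y.
  by rewrite !hE => /gi ->.
by move=> z; have [x ->] := gs v z; exists (f v x); rewrite hE.
Qed.

Lemma card_isosetC M N : #|isoset M N| = #|isoset N M|.
Proof.
rewrite card_isoset card_isosetr; congr (if _ then _ else _).
by apply/idP/idP; exact: isorep_sym.
Qed.

Definition tdim M : nat := \sum_v \dim {:obj M v}.
Definition xdim (x : X) : nat := tdim (rrepr x).

Lemma isorep_dim M N v : isorep M N -> \dim {:obj M v} = \dim {:obj N v}.
Proof.
move=> /existsP[f /is_isoP[fi fs]].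
have <- : limg (f v) = fullv.
  apply/eqP; rewrite eqEsubv subvf /=; apply/subvP => z _.
  by have [y ->] := fs v z; rewrite memv_img ?memvf.
by apply/esym/limg_dim_eq; rewrite capfv; apply/eqP/lker0P.
Qed.

Lemma isorep_tdim M N : isorep M N -> tdim M = tdim N.
Proof. by move=> MN; apply: eq_bigr => v _; exact: isorep_dim. Qed.

Lemma xdim_cls M : xdim (cls M) = tdim M.
Proof. by apply: isorep_tdim; apply/cls_eqP; rewrite rreprK. Qed.

Lemma short_exact_dim N E M (f : rhom N E) (g : rhom E M) v :
  short_exact f g -> \dim {:obj E v} = (\dim {:obj N v} + \dim {:obj M v})%N.
Proof.
move=> /forallP/(_ v)/and3P[k /eqP i /eqP s].
rewrite -(limg_ker_dim (g v) fullv) capfv -i s.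
by rewrite (limg_dim_eq (f := f v) (U := fullv)) // capfv; apply/eqP.
Qed.

Lemma short_exact_tdim N E M (f : rhom N E) (g : rhom E M) :
  short_exact f g -> tdim E = (tdim N + tdim M)%N.
Proof.
by move=> fg; rewrite -big_split; apply: eq_bigr => v _; exact: short_exact_dim fg.
Qed.

Lemma tdim_ker N E M (f : rhom N E) (g : rhom E M) : is_ker f g ->
  (tdim N <= tdim E)%N.
Proof.
move=> [fi _]; apply: leq_sum => v _.
rewrite -(limg_dim_eq (f := f v) (U := fullv)) ?dimvS ?subvf // capfv.
by apply/eqP/lker0P.
Qed.

Lemma tdim_coker N E M (f : rhom N E) (g : rhom E M) : is_coker f g ->
  (tdim M <= tdim E)%N.
Proof.
move=> [gs _]; apply: leq_sum => v _.
have -> : {:obj M v}%VS = limg (g v).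
  apply/eqP; rewrite eqEsubv subvf andbT; apply/subvP => z _.
  by have [y ->] := gs v z; rewrite memv_img ?memvf.
by rewrite -(limg_ker_dim (g v) fullv) leq_addl.
Qed.

(** Over a finite field, matrix representations with all vertex dimensions at most [n] form a finite
    type. Its image contains every class of total dimension at most [n]. *)
Definition mxcls n (t : {d : {ffun vert Q -> 'I_n.+1}
    & {dffun forall e, 'M[F]_(d (src e), d (tgt e))}}) : X :=
  \pi_X (existT (fun d : vert Q -> nat => forall e, 'M[F]_(d (src e), d (tgt e)))
    (fun v => tag t v : nat) (fun e => tagged t e)).

(** Sums over all isomorphism classes are replaced by sums over such a list, for any [n] bounding
    the dimensions that can occur. *)
Definition Xle n : seq X := [seq x <- undup (codom (@mxcls n)) | (xdim x <= n)%N].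

Lemma Xle_uniq n : uniq (Xle n).
Proof. by rewrite filter_uniq ?undup_uniq. Qed.

Lemma mem_Xle n x : (x \in Xle n) = (xdim x <= n)%N.
Proof.
rewrite mem_filter mem_undup; case: leqP => //= xn.
have dn v : (tag (repr x) v <= n)%N.
  apply: leq_trans xn; rewrite /xdim /tdim (bigD1 v) //= dimvf /dim /= mul1n.
  exact: leq_addr.
rewrite -(reprK x); case: (repr x) dn => d A /= dn.
pose d' := [ffun v => inord (d v) : 'I_n.+1].
have dE : (fun v => nat_of_ord (d' v)) = d.
  by apply/funext => v; rewrite ffunE inordK // ltnS.
(* The dimension function is replaced by its bounded copy, and the matrices, whose type depends on
   it, are carried along. *)
case: _ / dE A => A; apply/codomP.
exists (Tagged (fun d : {ffun vert Q -> 'I_n.+1} =>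
  {dffun forall e, 'M[F]_(d (src e), d (tgt e))}) [ffun e => A e]).
rewrite /mxcls /=; congr (\pi_X (existT _ _ _)).
by apply: functional_extensionality_dep => e; rewrite ffunE.
Qed.

(** Only the class of [K] contributes, and it contributes |Aut| / |Aut|. Every later normalisation
    to 1 comes down to this one. *)
Lemma sum_isoset n K : (tdim K <= n)%N ->
  \sum_(x <- Xle n) #|isoset (rrepr x) K|%:R / (aut (rrepr x))%:R = 1 :> R.
Proof.
move=> Kn; rewrite (bigD1_seq (cls K)) ?Xle_uniq ?mem_Xle ?xdim_cls //= big1.
  rewrite addr0 card_isoset ifT ?divff ?pnatr_eq0 -?lt0n ?aut_gt0 //.
  by apply/cls_eqP; rewrite rreprK.
move=> x xK; rewrite card_isoset ifF ?mul0r //.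
by apply: contraNF xK => /cls_eqP; rewrite rreprK => ->.
Qed.

Definition ker_set E M K (h : rhom E M) := [set k : rhom K E | `[< is_ker k h >]].
Definition coker_set E M C (h : rhom M E) := [set p : rhom E C | `[< is_coker h p >]].

(** Composition with one kernel embedding [k] turns isomorphisms onto its source into kernel
    embeddings, and reaches all of them. *)
Lemma sum_ker n E M (h : rhom E M) : (tdim E <= n)%N ->
  \sum_(x <- Xle n) #|ker_set (rrepr x) h|%:R / (aut (rrepr x))%:R = 1 :> R.
Proof.
have [K [k [ki kh]]] := kernel_exists h => En.
rewrite -[RHS](sum_isoset (leq_trans (tdim_ker (conj ki kh)) En)).
apply: eq_bigr => x _; congr (_%:R / _).
rewrite -(card_imset [set h | is_iso h] (f := rcomp k)); last first.
  move=> f f' /rhomP ff; apply/rhomP => v y; apply: (ki v).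
  by rewrite -!rcompE.
apply: eq_card => f; rewrite inE; apply/asboolP/imsetP => [[fi fh]|[g]]; last first.
  rewrite inE => /is_isoP[gi gs] ->; split=> v y; first by move=> z; rewrite !rcompE => /ki/gi.
  rewrite kh; split=> -[z ->]; last by exists (g v z); rewrite rcompE.
  by have [w ->] := gs v z; exists w; rewrite rcompE.
have [|g gE] := rlift_inj (z := f) ki; first by move=> v y; apply/kh/fh; exists y.
exists g; last by apply/rhomP => v y; rewrite rcompE gE.
rewrite inE; apply/is_isoP; split=> v; first by move=> y z /(congr1 (k v)); rewrite !gE => /fi.
move=> z; have /fh[y yE] : h v (k v z) = 0 by apply/kh; exists z.
by exists y; apply: (ki v); rewrite gE.
Qed.

Lemma sum_coker n E M (h : rhom M E) : (tdim E <= n)%N ->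
  \sum_(x <- Xle n) #|coker_set (rrepr x) h|%:R / (aut (rrepr x))%:R = 1 :> R.
Proof.
have [C [p [ps ph]]] := cokernel_exists h => En.
rewrite -[RHS](sum_isoset (leq_trans (tdim_coker (conj ps ph)) En)).
apply: eq_bigr => x _; congr (_%:R / _).
rewrite card_isosetC.
rewrite -(card_imset [set h | is_iso h] (f := fun f => rcomp f p)); last first.
  move=> f f' /rhomP ff; apply/rhomP => v y; have [z ->] := ps v y.
  by rewrite -!rcompE.
apply: eq_card => f; rewrite inE; apply/asboolP/imsetP => [[fs fh]|[g]]; last first.
  rewrite inE => /is_isoP[gi gs] ->; split=> v y.
    by have [z ->] := gs v y; have [w ->] := ps v z; exists w; rewrite rcompE.
  rewrite -ph rcompE; split=> [|->]; last exact: linear0.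
  exact: rinj0 gi.
have [|g gE] := rfact_surj (z := f) ps; first by move=> v y /ph; rewrite -fh.
exists g; last by apply/rhomP => v y; rewrite rcompE gE.
rewrite inE; apply/is_isoP; split; last first.
  by move=> v z; have [y ->] := fs v z; exists (p v y); rewrite gE.
apply: rinjP => v z; have [y ->] := ps v z.
by rewrite gE => /fh/ph.
Qed.

(** Projections of [E] onto the quotient by ker h, described without a choice of kernel; they are
    the cokernels of any kernel embedding of [h]. *)
Definition coim_set E M C (h : rhom E M) :=
  [set p : rhom E C | `[< rsurj p /\ forall v y, p v y = 0 <-> h v y = 0 >]].

Lemma sum_coim n E M (h : rhom E M) : (tdim E <= n)%N ->
  \sum_(x <- Xle n) #|coim_set (rrepr x) h|%:R / (aut (rrepr x))%:R = 1 :> R.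
Proof.
have [K [k [ki kh]]] := kernel_exists h => En.
rewrite -[RHS](sum_coker k En); apply: eq_bigr => x _; congr (_%:R / _).
apply: eq_card => p; rewrite !inE; apply: asbool_equiv_eq.
by split=> -[ps ph]; split=> // v y; rewrite ph; have := kh v y; tauto.
Qed.

End Counting.

(** Both sides evaluate the sum over i, j of [wI i * wJ j] times the number of related pairs. The
    fibres over [I] are normalised to 1; the factor [k] is 1 for flags and the Euler weight for
    crosses. *)
Lemma double_count (R : comPzSemiRingType) (I J : eqType) (s : seq I) (t : seq J)
    (C : I -> finType) (D : J -> finType) (c : forall i, {set C i})
    (d : forall j, {set D j}) (wI : I -> R) (wJ : J -> R)
    (r : forall i j, C i -> D j -> bool) (k : J -> R) :
  {in s, forall i, forall x, x \in c i ->
    \sum_(j <- t) wJ j * #|[set y in d j | r i j x y]|%:R = 1} ->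
  {in t, forall j, forall y, y \in d j ->
    \sum_(i <- s) wI i * #|[set x in c i | r i j x y]|%:R = k j} ->
  \sum_(i <- s) wI i * #|c i|%:R = \sum_(j <- t) k j * wJ j * #|d j|%:R.
Proof.
have cardE (A : finType) (a : {set A}) (b : pred A) :
    #|[set x in a | b x]|%:R = \sum_(x in a) (b x)%:R :> R.
  rewrite -sum1_card natr_sum (eq_bigl (fun x => (x \in a) && b x)).
    by rewrite big_mkcondr; apply: eq_bigr => x _; case: (b x).
  by move=> x; rewrite inE.
move=> H1 H2; transitivity (\sum_(i <- s) \sum_(j <- t)
    \sum_(x in c i) \sum_(y in d j) wI i * wJ j * (r i j x y)%:R).
  rewrite [LHS]big_seq [RHS]big_seq; apply: eq_bigr => i si.
  rewrite exchange_big -sum1_card natr_sum mulr_sumr; apply: eq_bigr => x xc.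
  rewrite -[in LHS](H1 i si x xc) mulr_sumr; apply: eq_bigr => j _.
  by rewrite cardE !mulr_sumr; apply: eq_bigr => y _; rewrite mulrA.
rewrite exchange_big [LHS]big_seq [RHS]big_seq; apply: eq_bigr => j tj.
rewrite (eq_bigr (fun i => \sum_(y in d j) \sum_(x in c i)
    wI i * wJ j * (r i j x y)%:R)); last by move=> i _; exact: exchange_big.
rewrite exchange_big -sum1_card natr_sum mulr_sumr; apply: eq_bigr => y yd.
rewrite -(H2 j tj y yd) mulr1 mulr_suml; apply: eq_bigr => i _.
by rewrite cardE mulr_sumr mulr_suml; apply: eq_bigr => x _; rewrite mulrAC.
Qed.

(** * Associativity *)

Lemma card_in_bij (A B : finType) (a : {set A}) (b : {set B}) (f : A -> B) :
  {in a &, injective f} -> {in a, forall x, f x \in b} ->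
  {in b, forall y, exists2 x, x \in a & f x = y} -> #|a| = #|b|.
Proof.
move=> fi fab fs; rewrite -(card_in_imset fi); apply: eq_card => y.
apply/imsetP/idP => [[x xa ->]|/fs[x xa <-]]; first exact: fab.
by exists x.
Qed.

Section Associativity.
Variables (Q : quiver) (F : finFieldType) (R : realType).
Implicit Types M N E G L W : rep Q F.
Local Notation X := (isocls Q F).

Definition hall_set M N E :=
  [set p : rhom N E * rhom E M | short_exact p.1 p.2].

Lemma hall_nbE M N E : hall_nb M N E = #|hall_set M N E|.
Proof. by []. Qed.

Lemma rcomp_injl E G W (k : rhom E G) (f g : rhom W E) : rinj k ->
  rcomp k f = rcomp k g -> f = g.
Proof.
by move=> ki /rhomP kfg; apply/rhomP => v x; apply: (ki v); rewrite -!rcompE.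
Qed.

Lemma rcomp_injr E G W (k : rhom W E) (f g : rhom E G) : rsurj k ->
  rcomp f k = rcomp g k -> f = g.
Proof.
move=> ks /rhomP kfg; apply/rhomP => v x; have [y ->] := ks v x.
by rewrite -!rcompE.
Qed.

Section Flags.
Variables (M N L G : rep Q F).

(* Flags L < E' < G with quotients N and M, presented through E' on one side *)
(* and through E = G / L on the other.                                       *)
Definition flag_rel E E' (c : (rhom N E * rhom E M) * (rhom L G * rhom G E))
    (d : (rhom L E' * rhom E' N) * (rhom E' G * rhom G M)) : bool :=
  [&& rcomp d.2.1 d.1.1 == c.2.1, rcomp c.1.1 d.1.2 == rcomp c.2.2 d.2.1
    & d.2.2 == rcomp c.1.2 c.2.2].

(** With [E] = G / L given, [E'] must be the kernel of G -> E -> M. Its embedding in [G] forces the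
    maps L -> E', E' -> N and G -> M. *)
Lemma card_flag_ker E E' c : c \in setX (hall_set M N E) (hall_set E L G) ->
  #|[set d in setX (hall_set N L E') (hall_set M E' G) | flag_rel c d]| =
  #|ker_set E' (rcomp c.1.2 c.2.2)|.
Proof.
case: c => -[f g] [f' g']; rewrite !inE /= => /andP[].
move=> /short_exactE[fi fg gs] /short_exactE[fi' fg' gs'].
apply: (card_in_bij (f := fun d => d.2.1)).
- move=> [[l p] [k h]] [[l2 p2] [k2 h2]]; rewrite !inE /flag_rel /=.
  move=> /andP[/andP[_ /short_exactE[ki _ _]] /and3P[/eqP kl /eqP fp /eqP hE]].
  move=> /andP[_ /and3P[/eqP kl2 /eqP fp2 /eqP hE2]] /= kk; subst k2.
  rewrite hE hE2 (rcomp_injl ki (etrans kl (esym kl2))).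
  by rewrite (rcomp_injl fi (etrans fp (esym fp2))).
- move=> [[l p] [k h]]; rewrite !inE /flag_rel /=.
  move=> /andP[/andP[_ /short_exactE[ki kh _]] /and3P[_ _ /eqP hE]].
  by apply/asboolP; rewrite -hE.
move=> k; rewrite inE => /asboolP[ki kgg].
have [|l lE] := rlift_inj (z := f') ki.
  by move=> v x; apply/kgg; rewrite rcompE (rexact0 _ fg') linear0.
have [|p pE] := rlift_inj (z := rcomp g' k) fi.
  by move=> v x; apply/fg; rewrite rcompE -rcompE; apply/kgg; exists x.
exists ((l, p), (k, rcomp g g')) => //; rewrite !inE /flag_rel /= -andbA; apply/and3P; split.
- apply/short_exactE; split.
  + by apply: rinjP => v x /(congr1 (k v)); rewrite lE linear0 => /(rinj0 fi').
  + move=> v y; transitivity (g' v (k v y) = 0).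
      rewrite -rcompE -pE; split=> [->|]; first by rewrite linear0.
      exact: rinj0.
    rewrite fg'; split=> -[x xE]; exists x; last by rewrite xE lE.
    by apply: (ki v); rewrite lE.
  + move=> v z; have [w wE] := gs' v (f v z).
    have /kgg[y yE] : rcomp g g' v w = 0 by rewrite rcompE -wE (rexact0 _ fg).
    by exists y; apply: (fi v); rewrite pE rcompE -yE.
- apply/short_exactE; split=> // v z; have [y ->] := gs v z.
  by have [w ->] := gs' v y; exists w; rewrite rcompE.
- by apply/and3P; split; apply/eqP => //; apply/rhomP => v x; rewrite !rcompE ?lE ?pE ?rcompE.
Qed.

(** Dually, [E] must be the cokernel of L -> E' -> G, and the projection G -> E forces the other
    maps. *)
Lemma card_flag_coker E E' d : d \in setX (hall_set N L E') (hall_set M E' G) ->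
  #|[set c in setX (hall_set M N E) (hall_set E L G) | flag_rel c d]| =
  #|coker_set E (rcomp d.2.1 d.1.1)|.
Proof.
case: d => -[l p] [k h]; rewrite !inE /= => /andP[].
move=> /short_exactE[li lp ps] /short_exactE[ki kh hs].
apply: (card_in_bij (f := fun c => c.2.2)).
- move=> [[f g] [f' g']] [[f2 g2] [f'2 g'2]]; rewrite !inE /flag_rel /=.
  move=> /andP[/andP[_ /short_exactE[_ _ gs']] /and3P[/eqP kl /eqP fp /eqP hE]].
  move=> /andP[_ /and3P[/eqP kl2 /eqP fp2 /eqP hE2]] /= kk; subst g'2.
  rewrite -kl -kl2 (rcomp_injr ps (etrans fp (esym fp2))).
  by rewrite (rcomp_injr gs' (etrans (esym hE) hE2)).
- move=> [[f g] [f' g']]; rewrite !inE /flag_rel /=.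
  move=> /andP[/andP[_ /short_exactE[_ fg' gs']] /and3P[/eqP kl _ _]].
  by apply/asboolP; rewrite kl.
move=> g'; rewrite inE => /asboolP[gs' klg].
have [|f fE] := rfact_surj (z := rcomp g' k) ps.
  by move=> v x /lp[y ->]; rewrite rcompE; apply/klg; exists y; rewrite rcompE.
have [|g gE] := rfact_surj (z := h) gs'.
  by move=> v x /klg[y ->]; rewrite rcompE; apply/kh; exists (l v y).
exists ((f, g), (rcomp k l, g')) => //; rewrite !inE /flag_rel /= -andbA; apply/and3P; split.
- apply/short_exactE; split.
  + apply: rinjP => v x; have [y ->] := ps v x.
    rewrite fE rcompE => /klg[z]; rewrite rcompE => /ki ->.
    by apply/lp; exists z.
  + move=> v y; have [w ->] := gs' v y; rewrite gE kh; split=> -[x xE].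
      by exists (p v x); rewrite xE fE rcompE.
    have [z zE] := ps v x; move: xE; rewrite zE fE rcompE => /eqP.
    rewrite -subr_eq0 -linearB => /eqP/klg[u]; rewrite rcompE => uE.
    by exists (z + l v u); rewrite linearD /= -uE addrC subrK.
  + by move=> v z; have [w ->] := hs v z; exists (g' v w); rewrite gE.
- apply/short_exactE; split=> //.
  by move=> v x y; rewrite !rcompE => /ki/li.
- by apply/and3P; split; apply/eqP => //; apply/rhomP => v x; rewrite !rcompE ?gE ?fE ?rcompE.
Qed.

(** Associativity and coassociativity are both this identity; they differ only in which automorphism
    groups of the outer objects are divided out. *)
Lemma hall_flag_count n : (tdim G <= n)%N ->
  \sum_(x <- Xle Q F n) (hall_nb M N (rrepr x) * hall_nb (rrepr x) L G)%:R
    / (aut (rrepr x))%:R =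
  \sum_(x <- Xle Q F n) (hall_nb N L (rrepr x) * hall_nb M (rrepr x) G)%:R
    / (aut (rrepr x))%:R :> R.
Proof.
move=> Gn; have := @double_count R X X (Xle Q F n) (Xle Q F n) _ _
  (fun x => setX (hall_set M N (rrepr x)) (hall_set (rrepr x) L G))
  (fun x => setX (hall_set N L (rrepr x)) (hall_set M (rrepr x) G))
  (fun x => (aut (rrepr x))%:R^-1) (fun x => (aut (rrepr x))%:R^-1)
  (fun x y => @flag_rel (rrepr x) (rrepr y)) (fun=> 1).
move=> H; transitivity (\sum_(x <- Xle Q F n) (aut (rrepr x))%:R^-1 *
    #|setX (hall_set M N (rrepr x)) (hall_set (rrepr x) L G)|%:R : R).
  by apply: eq_bigr => x _; rewrite cardsX mulrC.
rewrite H => [|x _ c cx|y _ d dy].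
- by apply: eq_bigr => x _; rewrite cardsX mul1r mulrC.
- rewrite -[RHS](sum_ker R (rcomp c.1.2 c.2.2) Gn); apply: eq_bigr => y _.
  by rewrite card_flag_ker // mulrC.
- rewrite -[RHS](sum_coker R (rcomp d.2.1 d.1.1) Gn); apply: eq_bigr => x _.
  by rewrite card_flag_coker // mulrC.
Qed.

End Flags.
End Associativity.

(** * Counting linear maps *)

Lemma card_rel_bij (A B : finType) (a : {set A}) (b : {set B}) (r : A -> B -> Prop) :
  {in a, forall x, exists2 y, y \in b & r x y} ->
  {in b, forall y, exists2 x, x \in a & r x y} ->
  (forall x y y', r x y -> r x y' -> y = y') ->
  {in a & a, forall x x', forall y, y \in b -> r x y -> r x' y -> x = x'} -> #|a| = #|b|.
Proof.
move=> ab ba ru lu.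
(* An element of [B] is needed as default value of the chosen function outside [a]; hence the
   separate empty case. *)
have [a0|[x0 /ab[y0 _ _]]] := set_0Vmem a.
  have [->|[y /ba[x]]] := set_0Vmem b; first by rewrite a0 !cards0.
  by rewrite a0 inE.
have [f fP] : exists f : A -> B, forall x, x \in a -> f x \in b /\ r x (f x).
  have H x : exists y, x \in a -> y \in b /\ r x y.
    by have [/ab[y yb xy]|xa] := boolP (x \in a); [exists y|exists y0].
  by have [f fP] := choice H; exists f.
apply: (card_in_bij (f := f)) => [x x' xa xa' E|x /fP[]//|y yb].
  have [xb xr] := fP x xa; have [_ xr'] := fP x' xa'.
  by apply: (lu x x' xa xa' (f x)) => //; rewrite E.
by have [x xa xy] := ba y yb; exists x => //; apply: (ru x) => //; case: (fP x xa).
Qed.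

Section HomFamilies.
Variables (F : finFieldType).

Definition hpair (W U V : vectType F) (h : 'Hom(W, U)) (k : 'Hom(W, V)) :
    'Hom(W, (U * V)%type) :=
  (linfun (lfun_pair h k) \o linfun (@dup F W))%VF.
Definition hcop (W U V : vectType F) (h : 'Hom(U, W)) (k : 'Hom(V, W)) :
    'Hom((U * V)%type, W) :=
  (linfun (@fold F W) \o linfun (lfun_pair h k))%VF.

Lemma hpairE (W U V : vectType F) (h : 'Hom(W, U)) (k : 'Hom(W, V)) x :
  hpair h k x = (h x, k x).
Proof. by rewrite comp_lfunE !lfunE. Qed.

Lemma hcopE (W U V : vectType F) (h : 'Hom(U, W)) (k : 'Hom(V, W)) p :
  hcop h k p = h p.1 + k p.2.
Proof. by rewrite comp_lfunE !lfunE. Qed.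

Lemma card_hom (U V : vectType F) :
  #|{: 'Hom(U, V)}| = (#|F| ^ (\dim {:U} * \dim {:V}))%N.
Proof.
have v2r_bij : bijective (@VectorInternalTheory.v2r F 'Hom(U, V)).
  exists (@VectorInternalTheory.r2v F 'Hom(U, V)).
    exact: VectorInternalTheory.v2rK.
  exact: VectorInternalTheory.r2vK.
by rewrite (bij_eq_card v2r_bij) card_mx mul1n !dimvf.
Qed.

(** The condition on [t] says that t - t0 kills ker al and takes values in im ka, so it factors
    uniquely as ka h al: the set is a coset of the product of the Hom(A_i, D_i). Gluings and
    splittings are both counted this way. *)
Lemma card_hom_torsor (I : finType) (U V A D : I -> vectType F)
    (al : forall i, 'Hom(U i, A i)) (ka : forall i, 'Hom(D i, V i))
    (t0 : forall i, 'Hom(U i, V i)) (S : {set {dffun forall i, 'Hom(U i, V i)}}) :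
  (forall i z, exists y, z = al i y) -> (forall i, injective (ka i)) ->
  (forall t : {dffun forall i, 'Hom(U i, V i)}, t \in S <-> forall i,
     (forall u, al i u = 0 -> t i u = t0 i u) /\
     forall u, exists w, t i u - t0 i u = ka i w) ->
  #|S| = #|{: {dffun forall i, 'Hom(A i, D i)}}|.
Proof.
move=> als kai SP; apply/esym; rewrite -cardsT.
have alK i x : al i (((al i)^-1)%VF (al i x) - x) = 0.
  by rewrite linearB /= lfun_img_invK ?subrr //; exists x.
apply: (card_in_bij (f := fun h : {dffun forall i, 'Hom(A i, D i)} =>
  [ffun i => t0 i + (ka i \o h i \o al i)%VF] : {dffun forall i, 'Hom(U i, V i)})).
- move=> h h' _ _ /ffunP hh; apply/ffunP => i; apply/lfunP => x.
  have [y ->] := als i x; apply: (kai i).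
  by have := hh i; rewrite !ffunE => /addrI/lfunP/(_ y); rewrite !comp_lfunE.
- move=> h _; apply/SP => i; rewrite ffunE; split=> u.
    by move=> ua; rewrite add_lfunE !comp_lfunE ua !linear0 addr0.
  by exists (h i (al i u)); rewrite add_lfunE !comp_lfunE addrC addrA addNr add0r.
move=> t /SP tP.
exists ([ffun i => (((ka i)^-1)%VF \o (t i - t0 i) \o ((al i)^-1)%VF)%VF]) => //.
apply/ffunP => i; apply/lfunP => x; rewrite !ffunE add_lfunE !comp_lfunE.
have [tz tk] := tP i; rewrite lfun_img_invK; last first.
  by have [w wE] := tk (((al i)^-1)%VF (al i x)); exists w; rewrite -wE add_lfunE opp_lfunE.
rewrite add_lfunE opp_lfunE; set y := (_^-1)%VF _.
have := tz _ (alK i x); rewrite !linearB /= -/y => /eqP; rewrite subr_eq => /eqP ->.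
by rewrite addrAC (addrAC (t0 i y)) subrr add0r addrA subrr add0r.
Qed.

Lemma card_hom_family (I : finType) (U V : I -> vectType F) :
  #|{: {dffun forall i, 'Hom(U i, V i)}}| =
  (#|F| ^ (\sum_i \dim {:U i} * \dim {:V i}))%N.
Proof.
rewrite card_dep_ffun foldrE big_map big_enum /= expn_sum.
by apply: eq_bigr => i _; rewrite card_hom.
Qed.

End HomFamilies.

(** * Green's formula *)

Section Green.
Variables (Q : quiver) (F : finFieldType).
Implicit Types A B C D E : rep Q F.

Section Cross.
Variables M N X Y : rep Q F.

(** The outer sequences of the 3 x 3 diagram with rows D -> Y -> B, N -> E -> M, C -> X -> A and
    columns D -> N -> C, Y -> E -> X, B -> M -> A; the two outer columns come first, then the two
    outer rows. *)
Definition frame_type A B C D : finType :=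
  (((rhom B M * rhom M A) * (rhom D N * rhom N C)) *
   ((rhom C X * rhom X A) * (rhom D Y * rhom Y B)))%type.
Definition frame_set A B C D : {set frame_type A B C D} :=
  setX (setX (hall_set A B M) (hall_set C D N))
       (setX (hall_set A C X) (hall_set B D Y)).

Definition cross_type E : finType :=
  ((rhom N E * rhom E M) * (rhom Y E * rhom E X))%type.
Definition cross_set E : {set cross_type E} :=
  setX (hall_set M N E) (hall_set X Y E).

(* The four corner squares of the 3 x 3 diagram with middle row N -> E -> M, *)
(* middle column Y -> E -> X and corners D, C, B, A.                         *)
Definition cross_rel E A B C D (c : cross_type E) (d : frame_type A B C D) : bool :=
  [&& rcomp c.1.1 d.1.2.1 == rcomp c.2.1 d.2.2.1,
      rcomp c.2.2 c.1.1 == rcomp d.2.1.1 d.1.2.2,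
      rcomp c.1.2 c.2.1 == rcomp d.1.1.1 d.2.2.2
    & rcomp d.1.1.2 c.1.2 == rcomp d.2.1.2 c.2.2].

(** The corners are forced: D and C are kernel and coimage of N -> X, B and A are coimage and
    cokernel of Y -> M. The four maps D -> N, N -> C, Y -> B, M -> A determine the other four
    through the squares. *)
Lemma card_cross_frames E A B C D (c : cross_type E) : c \in cross_set E ->
  #|[set d in frame_set A B C D | cross_rel c d]| =
  (#|ker_set D (rcomp c.2.2 c.1.1)| * #|coim_set C (rcomp c.2.2 c.1.1)| *
   (#|coim_set B (rcomp c.1.2 c.2.1)| * #|coker_set A (rcomp c.1.2 c.2.1)|))%N.
Proof.
case: c => -[f g] [f' g']; rewrite !inE /= => /andP[].
move=> /short_exactE[fi fg gs] /short_exactE[fi' fg' gs'].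
rewrite -!cardsX.
apply: (card_in_bij (f := fun d : frame_type A B C D =>
   ((d.1.2.1, d.1.2.2), (d.2.2.2, d.1.1.2)))).
- move=> [[[j a] [d1 p]] [[i a'] [d2 p']]] [[[j2 a2] [e1 p2]] [[i2 a'2] [e2 p'2]]].
  rewrite !inE /cross_rel /=.
  move=> /andP[/andP[/andP[_ /short_exactE[_ _ ps]] /andP[_ /short_exactE[_ _ ps']]]].
  move=> /and4P[/eqP s1 /eqP s2 /eqP s3 /eqP s4].
  move=> /andP[_ /and4P[/eqP t1 /eqP t2 /eqP t3 /eqP t4]] [? ? ? ?]; subst e1 p2 p'2 a2.
  rewrite (rcomp_injl fi' (etrans (esym s1) t1)).
  rewrite (rcomp_injr ps (etrans (esym s2) t2)).
  rewrite (rcomp_injr ps' (etrans (esym s3) t3)).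
  by rewrite (rcomp_injr gs' (etrans (esym s4) t4)).
- move=> [[[j a] [d1 p]] [[i a'] [d2 p']]]; rewrite inE !in_setX /cross_rel /= !inE.
  move=> /andP[/andP[/andP[/short_exactE[ji ja as_] /short_exactE[d1i dp ps]]
    /andP[/short_exactE[ii ia as_'] /short_exactE[d2i dp' ps']]]].
  move=> /and4P[_ /eqP -> /eqP -> _].
  have ipE v y : rcomp i p v y = 0 <-> p v y = 0.
    by rewrite rcompE; split=> [/(rinj0 ii)//|->]; rewrite linear0.
  have jpE v y : rcomp j p' v y = 0 <-> p' v y = 0.
    by rewrite rcompE; split=> [/(rinj0 ji)//|->]; rewrite linear0.
  apply/andP; split; apply/andP; split; apply/asboolP; split=> //.
  + by move=> v y; rewrite ipE; exact: dp.
  + by move=> v y; rewrite ipE.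
  + by move=> v y; rewrite jpE.
  + move=> v y; rewrite ja; split=> -[x ->]; last by exists (p' v x); rewrite rcompE.
    by have [z ->] := ps' v x; exists z; rewrite rcompE.
move=> [[d1 p] [p' a]]; rewrite !in_setX /= !inE.
move=> /andP[/andP[/asboolP[d1i dh] /asboolP[ps ph]] /andP[/asboolP[ps' ph'] /asboolP[as_ ah]]].
have [|i iE] := rfact_surj (z := rcomp g' f) ps; first by move=> v x /ph.
have [|j jE] := rfact_surj (z := rcomp g f') ps'; first by move=> v x /ph'.
have [|d2 d2E] := rlift_inj (z := rcomp f d1) fi'.
  by move=> v x; apply/fg'; rewrite rcompE -rcompE; apply/dh; exists x.
have [|a' aE] := rfact_surj (z := rcomp a g) gs'.
  by move=> v x /fg'[y ->]; rewrite rcompE; apply/ah; exists y; rewrite rcompE.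
exists (((j, a), (d1, p)), ((i, a'), (d2, p'))) => //.
rewrite !inE /cross_rel /= -3!andbA; apply/and5P; split.
- apply/short_exactE; split=> //.
    by apply: rinjP => v x; have [y ->] := ps' v x; rewrite jE => /ph'.
  move=> v y; rewrite ah; split=> -[x ->]; first by exists (p' v x); rewrite jE.
  by have [z ->] := ps' v x; exists z; rewrite jE.
- apply/short_exactE; split=> // v y.
  by rewrite ph; exact: dh.
- apply/short_exactE; split.
  + by apply: rinjP => v x; have [y ->] := ps v x; rewrite iE => /ph.
  (* Exactness at [X]: a lift [e] of an element of [X] dies in [A] iff its image in [M] comes from
     [Y], that is, iff [e] is a sum of elements from [Y] and from [N]. *)
  + move=> v x; have [e ->] := gs' v x; rewrite aE rcompE; split=> [/ah[y]|[z]].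
      rewrite rcompE => /eqP; rewrite -subr_eq0 -linearB => /eqP/fg[n nE].
      exists (p v n); rewrite iE rcompE -nE linearB /= (rexact0 _ fg').
      by rewrite subr0.
    have [n ->] := ps v z; rewrite iE rcompE => /eqP.
    rewrite -subr_eq0 -linearB => /eqP/fg'[y yE].
    apply/ah; exists y; rewrite rcompE -yE linearB /= (rexact0 _ fg).
    by rewrite subr0.
  + by move=> v z; have [m ->] := as_ v z; have [e ->] := gs v m;
      exists (g' v e); rewrite aE rcompE.
- apply/short_exactE; split=> //.
    by apply: rinjP => v x /(congr1 (f' v)); rewrite d2E linear0 rcompE => /(rinj0 fi)/(rinj0 d1i).
  move=> v y; rewrite ph' rcompE fg; split=> -[n nE].
    have /dh[d dE] : rcomp g' f v n = 0 by rewrite rcompE -nE (rexact0 _ fg').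
    by exists d; apply: (fi' v); rewrite d2E rcompE -dE.
  by exists (d1 v n); rewrite nE d2E rcompE.
- by apply/and4P; split; apply/eqP/rhomP => v x; rewrite !rcompE ?iE ?jE ?d2E ?aE rcompE.
Qed.

End Cross.
End Green.

(** * Crosses filling a fixed 3 x 3 frame *)

Section Fillings.
Variables (Q : quiver) (F : finFieldType) (R : realType).
Variables M N X Y A B C D : rep Q F.
Variables (j : rhom B M) (a : rhom M A) (d1 : rhom D N) (p : rhom N C).
Variables (i : rhom C X) (a' : rhom X A) (d2 : rhom D Y) (p' : rhom Y B).
Hypotheses (ji : rinj j) (ja : rexact j a) (a_s : rsurj a).
Hypotheses (d1i : rinj d1) (dp : rexact d1 p) (ps : rsurj p).
Hypotheses (ii : rinj i) (ia : rexact i a') (as' : rsurj a').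
Hypotheses (d2i : rinj d2) (dp' : rexact d2 p') (ps' : rsurj p').

Let fr : frame_type M N X Y A B C D := (((j, a), (d1, p)), ((i, a'), (d2, p'))).
(** Vertexwise, [rr] retracts D -> Y and [ss] below splits X -> A. Their failure to commute with the
    arrows is what the block of a gluing has to compensate. *)
Let rr v : 'Hom(obj Y v, obj D v) := ((d2 v)^-1)%VF.
Let ss v : 'Hom(obj A v, obj X v) := ((a' v)^-1)%VF.

Let rrK v x : rr v (d2 v x) = x.
Proof. exact: lfun_inj_invK. Qed.
Let ssK v x : a' v (ss v x) = x.
Proof. exact: lfun_surj_invK. Qed.

Definition gluing_type : finType :=
  {dffun forall e, 'Hom(obj M (src e), obj N (tgt e))}.

(* c is the off-diagonal block of the arrows of E = N (+) M; the two conditions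
   say that y |-> (d1 (rr y), j (p' y)) and (n, m) |-> i (p n) + ss (a m) are
   morphisms Y -> E and E -> X. *)
Definition is_gluing (c : forall e, 'Hom(obj M (src e), obj N (tgt e))) : Prop :=
  forall e,
  (forall y, c e (j _ (p' _ y)) =
     d1 _ (rr _ (arr Y e y)) - arr N e (d1 _ (rr _ y))) /\
  (forall m, i _ (p _ (c e m)) = arr X e (ss _ (a _ m)) - ss _ (a _ (arr M e m))).

(** The defect [t] of [rr] vanishes on D, so it descends to B; the defect [u] of [ss] is killed by
    [a'], so it lifts to N. The resulting two terms do not interfere: the first is killed by [p],
    the second vanishes on the image of [j]. *)
Lemma gluing_exists : exists c, is_gluing c.
Proof.
pose t e : 'Hom(obj Y (src e), obj D (tgt e)) :=
  ((rr (tgt e) \o arr Y e) - (arr D e \o rr (src e)))%VF.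
pose u e : 'Hom(obj A (src e), obj X (tgt e)) :=
  ((arr X e \o ss (src e)) - (ss (tgt e) \o arr A e))%VF.
exists (fun e => (d1 (tgt e) \o t e \o ((p' (src e))^-1) \o ((j (src e))^-1))%VF +
  (((p (tgt e))^-1) \o ((i (tgt e))^-1) \o u e \o a (src e))%VF) => e; split=> x.
- rewrite add_lfunE !comp_lfunE (rexact0 _ ja) !linear0 addr0 lfun_inj_invK //.
  rewrite /t !add_lfunE !opp_lfunE !comp_lfunE.
  set y := ((p' _)^-1)%VF _.
  have [d dE] : exists d, y - x = d2 _ d.
    by apply/dp'; rewrite linearB /= lfun_img_invK ?subrr //; exists x.
  have -> : y = x + d2 _ d by rewrite -dE addrC subrK.
  rewrite !linearD /= -(rhomE d2) !rrK !linearN /= addrACA subrr addr0.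
  by rewrite rhomE.
- rewrite add_lfunE !comp_lfunE linearD /= (rexact0 _ dp) add0r.
  rewrite (lfun_surj_invK (ps (v := _))) lfun_img_invK; last first.
    apply/ia; rewrite /u add_lfunE opp_lfunE linearB /= !comp_lfunE.
    by rewrite (rhomE a') !ssK subrr.
  by rewrite /u add_lfunE opp_lfunE !comp_lfunE -(rhomE a).
Qed.

Section Glue.
Variables (c : forall e, 'Hom(obj M (src e), obj N (tgt e))) (cP : is_gluing c).

(** The extension of M by N with block [c]. Up to equivalence every extension has this form, which
    is used again to compute Ext^1. *)
Definition glued : rep Q F :=
  @Rep Q F (fun v => (obj N v * obj M v)%type)
    (fun e => hpair (hcop (arr N e) (c e)) (hcop 0 (arr M e))).

Lemma glue_arrE e n m : arr glued e (n, m) = (arr N e n + c e m, arr M e m).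
Proof. by rewrite hpairE !hcopE zero_lfunE add0r. Qed.

Let glue_inn e n :
  hpair \1%VF 0 (arr N e n) = arr glued e (hpair \1%VF 0 n).
Proof. by rewrite (hpairE _ _ n) glue_arrE hpairE !id_lfunE !zero_lfunE !linear0 addr0. Qed.
Definition glue_in : rhom N glued :=
  mk_rhom (M := N) (N := glued) (f := fun v => hpair \1%VF 0) glue_inn.

Let glue_outn e x : hcop 0 \1%VF (arr glued e x) = arr M e (hcop 0 \1%VF x).
Proof. by case: x => n m; rewrite glue_arrE !hcopE !zero_lfunE !id_lfunE !add0r. Qed.
Definition glue_out : rhom glued M :=
  mk_rhom (M := glued) (N := M) (f := fun v => hcop 0 \1%VF) glue_outn.

Let glue_in'n e y :
  hpair (d1 _ \o rr _)%VF (j _ \o p' _)%VF (arr Y e y) =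
  arr glued e (hpair (d1 _ \o rr _)%VF (j _ \o p' _)%VF y).
Proof.
rewrite (hpairE _ _ y) glue_arrE hpairE !comp_lfunE; congr (_, _); last by rewrite !rhomE.
by have [-> _] := cP e; rewrite addrC subrK.
Qed.
Definition glue_in' : rhom Y glued :=
  mk_rhom (M := Y) (N := glued)
    (f := fun v => hpair (d1 v \o rr v)%VF (j v \o p' v)%VF) glue_in'n.

Let glue_out'n e x :
  hcop (i _ \o p _)%VF (ss _ \o a _)%VF (arr glued e x) =
  arr X e (hcop (i _ \o p _)%VF (ss _ \o a _)%VF x).
Proof.
case: x => n m; rewrite glue_arrE !hcopE !comp_lfunE /= !linearD /= !rhomE.
have [_ ->] := cP e; rewrite (rhomE a) -addrA; congr (_ + _).
by rewrite subrK.
Qed.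
Definition glue_out' : rhom glued X :=
  mk_rhom (M := glued) (N := X)
    (f := fun v => hcop (i v \o p v)%VF (ss v \o a v)%VF) glue_out'n.

Lemma glue_inE v n : glue_in v n = (n, 0).
Proof. by rewrite mk_rhomE hpairE id_lfunE zero_lfunE. Qed.
Lemma glue_outE v n m : glue_out v (n, m) = m.
Proof. by rewrite mk_rhomE hcopE id_lfunE zero_lfunE add0r. Qed.
Lemma glue_in'E v y : glue_in' v y = (d1 v (rr v y), j v (p' v y)).
Proof. by rewrite mk_rhomE hpairE !comp_lfunE. Qed.
Lemma glue_out'E v n m : glue_out' v (n, m) = i v (p v n) + ss v (a v m).
Proof. by rewrite mk_rhomE hcopE !comp_lfunE. Qed.

Lemma glue_exact : short_exact glue_in glue_out.
Proof.
apply/short_exactE; split.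
- by move=> v x y; rewrite !glue_inE => -[].
- move=> v [n m]; rewrite glue_outE; split=> [->|[x]]; first by exists n; rewrite glue_inE.
  by rewrite glue_inE => -[].
- by move=> v m; exists (0, m); rewrite glue_outE.
Qed.

Lemma glue_exact' : short_exact glue_in' glue_out'.
Proof.
apply/short_exactE; split.
- apply: rinjP => v y; rewrite glue_in'E => -[/(rinj0 d1i) ry /(rinj0 ji)/dp'[d dE]].
  by move: ry; rewrite dE rrK => ->; rewrite linear0.
- move=> v [n m]; rewrite glue_out'E; split=> [H|[y]]; last first.
    rewrite glue_in'E => -[-> ->]; rewrite (rexact0 _ dp) (rexact0 _ ja).
    by rewrite !linear0 addr0.
  have am : a v m = 0.
    by have := congr1 (a' v) H; rewrite linearD linear0 /= (rexact0 _ ia) ssK add0r.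
  have /ja[b mE] := am; have [y bE] := ps' b.
  move: H; rewrite am linear0 addr0 => /(rinj0 ii)/dp[d nE].
  (* The lift [y] already has the right component in M. Adding [d2 w] changes only the component in
     N, from d1 (rr y) to d1 d. *)
  have [w wE] : exists w, w = d - rr v y by exists (d - rr v y).
  exists (y + d2 v w); rewrite glue_in'E linearD /= rrK wE addrC subrK -nE.
  by rewrite linearD /= (rexact0 _ dp') addr0 -bE -mE.
- move=> v x; have [m mE] := a_s (a' v x).
  have /ia[z zE] : a' v (x - ss v (a v m)) = 0 by rewrite linearB /= ssK mE subrr.
  have [n nE] := ps z; exists (n, m).
  by rewrite glue_out'E -nE -zE subrK.
Qed.

End Glue.

Definition gluing_set : {set gluing_type} := [set t : gluing_type | `[< is_gluing t >]].

(** Two gluings agree on the image of B and after projection to C, so their difference is a map from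
    A to D along each edge. *)
Lemma card_gluing_set :
  #|gluing_set| = #|{: {dffun forall e, 'Hom(obj A (src e), obj D (tgt e))}}|.
Proof.
have [c0 c0P] := gluing_exists.
apply: (card_hom_torsor (al := fun e => a (src e)) (ka := fun e => d1 (tgt e))
  (t0 := c0)) => [e z|e|t].
- exact: a_s.
- exact: d1i.
rewrite inE; split=> [/asboolP tP e|tP].
  have [t1 t2] := tP e; have [c1 c2] := c0P e; split=> u.
    by move=> /ja[b ->]; have [y ->] := ps' b; rewrite t1 c1.
  by apply/dp/(rinj0 ii); rewrite !linearB /= t2 c2 subrr.
apply/asboolP => e; have [t1 t2] := tP e; have [c1 c2] := c0P e; split=> [y|m].
  by rewrite t1 ?c1 ?(rexact0 _ ja).
have [w wE] := t2 m; rewrite -c2; apply/eqP; rewrite -subr_eq0 -!linearB wE /=.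
by rewrite (rexact0 _ dp) linear0.
Qed.

Section Splittings.
Variable E : rep Q F.
Implicit Type c : cross_type M N X Y E.

Definition split_type : finType := {dffun forall v, 'Hom(obj M v, obj E v)}.

(* Linear sections l of E -> M for which (n, m) |-> f n + l m turns these two
   maps into Y -> E and E -> X. *)
Definition is_split c (l : split_type) : Prop := forall v,
  [/\ forall m, c.1.2 v (l v m) = m,
      forall y, l v (j v (p' v y)) + c.1.1 v (d1 v (rr v y)) = c.2.1 v y
    & forall m, c.2.2 v (l v m) = ss v (a v m)].

(** Two admissible sections agree on the image of B and differ by values in D, hence by a map from A
    to D at each vertex. The work lies in producing one. *)
Lemma card_split_set c : c \in cross_set M N X Y E -> cross_rel c fr ->
  #|[set l : split_type | `[< is_split c l >]]| =
  #|{: {dffun forall v, 'Hom(obj A v, obj D v)}}|.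
Proof.
case: c => -[f g] [f' g']; rewrite in_setX !inE /cross_rel /= => /andP[].
move=> /short_exactE[fi fg gs] /short_exactE[fi' fg' gs'].
move=> /and4P[/eqP/rhomP s1 /eqP/rhomP s2 /eqP/rhomP s3 /eqP/rhomP s4].
have {}s1 v x : f v (d1 v x) = f' v (d2 v x) by rewrite -!rcompE s1.
have {}s2 v x : g' v (f v x) = i v (p v x) by rewrite -!rcompE s2.
have {}s3 v x : g v (f' v x) = j v (p' v x) by rewrite -!rcompE s3.
have {}s4 v x : a v (g v x) = a' v (g' v x) by rewrite -!rcompE s4.
have [l0 l0P] : exists l, is_split ((f, g), (f', g')) l.
  pose sg v : 'Hom(obj M v, obj E v) := ((g v)^-1)%VF.
  have sgK v m : g v (sg v m) = m by exact: lfun_surj_invK.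
  pose df v : 'Hom(obj M v, obj X v) := ((g' v \o sg v) - (ss v \o a v))%VF.
  have dfE v m : df v m = g' v (sg v m) - ss v (a v m).
    by rewrite add_lfunE opp_lfunE !comp_lfunE.
  (* The error [df] is killed by [a'], so it comes from C and lifts to N. Subtracting the lift
     corrects the map to X and leaves a section of [g]. *)
  pose la v : 'Hom(obj M v, obj E v) :=
    (sg v - (f v \o ((p v)^-1) \o ((i v)^-1) \o df v)%VF).
  have laE v m : exists2 n, la v m = sg v m - f v n & i v (p v n) = df v m.
    exists (((p v)^-1)%VF (((i v)^-1)%VF (df v m))).
      by rewrite add_lfunE opp_lfunE !comp_lfunE.
    rewrite (lfun_surj_invK (ps (v := _))) lfun_img_invK //; apply/ia.
    by rewrite dfE linearB /= -s4 sgK ssK subrr.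
  have gla v m : g v (la v m) = m.
    by have [n -> _] := laE v m; rewrite linearB /= sgK (rexact0 _ fg) subr0.
  have g'la v m : g' v (la v m) = ss v (a v m).
    have [n -> nE] := laE v m; rewrite linearB /= s2 nE dfE.
    by rewrite opprB addrC subrK.
  (* The error on Y. It vanishes on D, so it descends to B and extends to M; being killed by [g] and
     [g'], it can be added without spoiling the other two conditions. *)
  pose be v : 'Hom(obj Y v, obj E v) :=
    (f' v - (f v \o d1 v \o rr v)%VF - (la v \o j v \o p' v)%VF).
  have beE v y : be v y = f' v y - f v (d1 v (rr v y)) - la v (j v (p' v y)).
    by rewrite 2!add_lfunE 2!opp_lfunE !comp_lfunE.
  have be0 v y : p' v y = 0 -> be v y = 0.
    move=> p'y; have [d ->] := (dp' y).1 p'y.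
    by rewrite beE rrK s1 subrr (rexact0 _ dp') !linear0 addr0.
  have gbe v y : g v (be v y) = 0.
    by rewrite beE !linearB /= s3 (rexact0 _ fg) gla subr0 subrr.
  have g'be v y : g' v (be v y) = 0.
    rewrite beE !linearB /= (rexact0 _ fg') s2 g'la (rexact0 _ dp) (rexact0 _ ja).
    by rewrite !linear0 !addr0.
  exists [ffun v => la v + (be v \o ((p' v)^-1) \o ((j v)^-1))%VF] => v.
  split=> [m|y|m] /=; rewrite ffunE add_lfunE !comp_lfunE ?linearD /=.
  - by rewrite gla gbe addr0.
  - rewrite lfun_inj_invK //; set y' := ((p' v)^-1)%VF _.
    have -> : be v y' = be v y.
      apply/eqP; rewrite -subr_eq0 -linearB; apply/eqP/be0.
      by rewrite linearB /= lfun_img_invK ?subrr //; exists y.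
    by rewrite beE (addrC (la _ _)) !subrK.
  - by rewrite g'la g'be addr0.
apply: (card_hom_torsor (al := fun v => a v) (ka := fun v => (f v \o d1 v)%VF)
  (t0 := fun v => l0 v)) => [v z|v x y|l].
- exact: a_s.
- by rewrite !comp_lfunE => /fi/d1i.
rewrite inE; split=> [/asboolP lP v|lP].
  have [/= l1 l2 l3] := lP v; have [/= k1 k2 k3] := l0P v; split=> u.
    move=> /ja[b ->]; have [y ->] := ps' b.
    by apply: (addIr (f v (d1 v (rr v y)))); rewrite l2 k2.
  have /fg[n nE] : g v (l v u - l0 v u) = 0 by rewrite linearB /= l1 k1 subrr.
  have /dp[d dE] : p v n = 0.
    by apply: (rinj0 ii); rewrite -s2 -nE linearB /= l3 k3 subrr.
  by exists d; rewrite comp_lfunE -dE.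
apply/asboolP => v; have [/= k1 k2 k3] := l0P v; have [l1 l2] := lP v.
have lE u : exists d, l v u = l0 v u + f v (d1 v d).
  by have [d dE] := l2 u; exists d; rewrite -[f v _]comp_lfunE -dE addrC subrK.
split=> [m|y|m] /=.
- by have [d ->] := lE m; rewrite linearD /= k1 (rexact0 _ fg) addr0.
- by rewrite l1 ?(rexact0 _ ja).
- have [d ->] := lE m; rewrite linearD /= k3 s2 (rexact0 _ dp).
  by rewrite linear0 addr0.
Qed.

(** Crosses with a splitting mediate between crosses and gluings: the number of splittings is the
    same for all crosses of the frame, and a splitting turns the arrows of E into a single block. *)
Definition framed_type : finType := (cross_type M N X Y E * split_type)%type.
Definition framed_set : {set framed_type} :=
  [set z : framed_type | (z.1 \in cross_set M N X Y E) && cross_rel z.1 fr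
                         && `[< is_split z.1 z.2 >]].
Definition framed_rel (z : framed_type) (t : gluing_type) : bool :=
  `[< forall e m, z.1.1.1 _ (t e m) = arr E e (z.2 _ m) - z.2 _ (arr M e m) >].

(** The block is the failure of the section [l] to commute with the arrows. It takes values in ker g
    = im f, and [f] is injective. *)
Lemma card_framed_gluing z : z \in framed_set ->
  #|[set t in gluing_set | framed_rel z t]| = 1%N.
Proof.
case: z => [[[f g] [f' g']] l]; rewrite inE in_setX !inE /cross_rel /= => /andP[].
move=> /andP[/andP[/short_exactE[fi fg gs] /short_exactE[fi' fg' gs']]].
move=> /and4P[/eqP/rhomP s1 /eqP/rhomP s2 /eqP/rhomP s3 /eqP/rhomP s4].
have {}s1 v x : f v (d1 v x) = f' v (d2 v x) by rewrite -!rcompE s1.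
have {}s2 v x : g' v (f v x) = i v (p v x) by rewrite -!rcompE s2.
have {}s3 v x : g v (f' v x) = j v (p' v x) by rewrite -!rcompE s3.
have {}s4 v x : a v (g v x) = a' v (g' v x) by rewrite -!rcompE s4.
move=> /asboolP lP.
pose t : gluing_type := [ffun e => (((f (tgt e))^-1) \o
  ((arr E e \o l (src e))%VF - (l (tgt e) \o arr M e)%VF))%VF].
have tE e m : f _ (t e m) = arr E e (l _ m) - l _ (arr M e m).
  rewrite ffunE comp_lfunE add_lfunE opp_lfunE !comp_lfunE lfun_img_invK //.
  have [/= l1 _ _] := lP (src e); have [/= l1' _ _] := lP (tgt e).
  by apply/fg; rewrite linearB /= l1' (rhomE g) l1 subrr.
apply/eqP/cards1P; exists t; apply/setP => t'; rewrite !inE /framed_rel /=.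
apply/andP/eqP => [[_ /asboolP t'E]|->].
  apply/ffunP => e; apply/lfunP => m; apply: (fi (tgt e)).
  by rewrite t'E tE.
split; apply/asboolP => // e.
have [/= l1 l2 l3] := lP (src e); have [/= k1 k2 k3] := lP (tgt e).
split=> [y|m].
  apply: (fi (tgt e)); rewrite tE linearB /= (rhomE f).
  have -> : l _ (j _ (p' _ y)) = f' _ y - f _ (d1 _ (rr _ y)).
    by rewrite -l2 addrK.
  have -> : l _ (arr M e (j _ (p' _ y))) =
      f' _ (arr Y e y) - f _ (d1 _ (rr _ (arr Y e y))).
    by rewrite -k2 addrK !rhomE.
  by rewrite linearB /= !rhomE opprB addrC addrA subrK.
by rewrite -s2 tE linearB /= (rhomE g') l3 k3.
Qed.

(** A framed cross on E with block [t] amounts to an isomorphism (n, m) |-> f n + l m from the glued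
    representation, along which the standard cross and splitting are transported. *)
Lemma card_framed_iso t : t \in gluing_set ->
  #|[set z in framed_set | framed_rel z t]| = #|isoset (glued t) E|.
Proof.
rewrite inE => /asboolP tP.
apply: (card_rel_bij (A := framed_type) (B := rhom (glued t) E)
  (r := fun (z : framed_type) (phi : rhom (glued t) E) =>
  forall v n m, phi v (n, m) = z.1.1.1 v n + z.2 v m)).
- case=> [[[f g] [f' g']] l]; rewrite inE inE in_setX !inE /cross_rel /=.
  move=> /andP[/andP[/andP[/andP[/short_exactE[fi fg gs] _] _] /asboolP lP] /asboolP /= tE].
  pose h v : 'Hom(obj (glued t) v, obj E v) := hcop (f v) (l v).
  have hE v n m : h v (n, m) = f v n + l v m by rewrite /h hcopE.
  have hn e x : h (tgt e) (arr (glued t) e x) = arr E e (h (src e) x).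
    case: x => n m; rewrite glue_arrE !hE !linearD /= rhomE tE.
    by rewrite -addrA subrK.
  exists (mk_rhom (M := glued t) (N := E) hn).
    rewrite inE; apply/is_isoP; split.
      apply: rinjP => v [n m]; rewrite mk_rhomE hE => H.
      have [/= l1 _ _] := lP v.
      have m0 : m = 0.
        by have := congr1 (g v) H; rewrite linearD /= l1 (rexact0 _ fg) add0r linear0.
      by move: H; rewrite m0 linear0 addr0 => /(rinj0 fi) ->.
    move=> v x; have [/= l1 _ _] := lP v.
    have /fg[n nE] : g v (x - l v (g v x)) = 0 by rewrite linearB /= l1 subrr.
    by exists (n, g v x); rewrite ffunE hE -nE subrK.
  by move=> v n m; rewrite /= ffunE hE.
- move=> phi; rewrite inE => /is_isoP[phii phis].
  have /short_exactE[ui uv vs] := glue_exact t.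
  have /short_exactE[ui' uv' vs'] := glue_exact' tP.
  have [|g gE] := rfact_surj (z := glue_out t) phis.
    by move=> v x /(rinj0 phii) ->; rewrite linear0.
  have [|g' g'E] := rfact_surj (z := glue_out' tP) phis.
    by move=> v x /(rinj0 phii) ->; rewrite linear0.
  have [f fC] : exists f : rhom N E, forall v n, f v n = phi v (glue_in t v n).
    by exists (rcomp phi (glue_in t)) => v n; rewrite rcompE.
  have [f' f'C] : exists f : rhom Y E, forall v y, f v y = phi v (glue_in' tP v y).
    by exists (rcomp phi (glue_in' tP)) => v n; rewrite rcompE.
  pose l : split_type := [ffun v => (phi v \o hpair 0 \1%VF)%VF].
  have fE v n : f v n = phi v (n, 0) by rewrite fC glue_inE.
  have f'E v y : f' v y = phi v (d1 v (rr v y), j v (p' v y)).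
    by rewrite f'C glue_in'E.
  have lE v m : l v m = phi v (0, m).
    by rewrite ffunE comp_lfunE hpairE zero_lfunE id_lfunE.
  have phiD v n n' m m' : phi v (n, m) + phi v (n', m') = phi v (n + n', m + m').
    by rewrite -linearD.
  exists (((f, g), (f', g')), l); last first.
    by move=> v n m; rewrite /= fE lE phiD addr0 add0r.
  rewrite inE inE in_setX !inE /cross_rel /=.
  apply/andP; split; last first.
    apply/asboolP => e m /=; rewrite fE !lE -(rhomE phi) -linearB glue_arrE.
    by congr (phi _ (_, _)); rewrite ?linear0 ?add0r ?subr0 ?subrr.
  apply/andP; split; last first.
    apply/asboolP => v; split=> [m|y|m] /=; rewrite ?lE ?fE ?f'E.
    + by rewrite gE glue_outE.
    + by rewrite phiD addr0 add0r.
    + by rewrite g'E glue_out'E !linear0 add0r.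
  apply/andP; split; last first.
    apply/and4P; split; apply/eqP/rhomP => v x; rewrite !rcompE.
    + by rewrite fE f'E rrK (rexact0 _ dp') linear0.
    + by rewrite fE g'E glue_out'E !linear0 addr0.
    + by rewrite f'E gE glue_outE.
    + have [[n m] ->] := phis v x; rewrite gE g'E glue_outE glue_out'E.
      by rewrite linearD /= (rexact0 _ ia) ssK add0r.
  apply/andP; split; apply/short_exactE; split.
  + by move=> v x y; rewrite !fC => /phii/ui.
  + move=> v x; have [w ->] := phis v x; rewrite gE uv; split=> -[n E1].
      by exists n; rewrite fC -E1.
    by exists n; apply: (phii v); rewrite E1 fC.
  + by move=> v z; have [w ->] := vs v z; exists (phi v w); rewrite gE.
  + by move=> v x y; rewrite !f'C => /phii/ui'.
  + move=> v x; have [w ->] := phis v x; rewrite g'E uv'; split=> -[n E1].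
      by exists n; rewrite f'C -E1.
    by exists n; apply: (phii v); rewrite E1 f'C.
  + by move=> v z; have [w ->] := vs' v z; exists (phi v w); rewrite g'E.
- move=> z phi phi' zp zp'; apply/rhomP => v [n m].
  by rewrite zp zp'.
case=> [[[f g] [f' g']] l] [[[f2 g2] [f2' g2']] l2].
move=> zZ zZ2.
have lP : is_split ((f, g), (f', g')) l.
  by move: zZ; rewrite inE => /andP[+ _]; rewrite inE => /andP[_ /asboolP].
have lP2 : is_split ((f2, g2), (f2', g2')) l2.
  by move: zZ2; rewrite inE => /andP[+ _]; rewrite inE => /andP[_ /asboolP].
move=> phi; rewrite inE => /is_isoP[phii phis] /= zp zp2.
(* [f] and [l] are read off [phi]; then [f'] follows from the splitting, and [g], [g'] from their
   values on the elements f n + l m, which exhaust E. *)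
have fE v n : f v n = f2 v n.
  by have := zp v n 0; rewrite zp2 !linear0 !addr0.
have lE v m : l v m = l2 v m.
  by have := zp v 0 m; rewrite zp2 !linear0 !add0r.
have f_eq : f = f2 by apply/rhomP.
have l_eq : l = l2 by apply/ffunP => v; apply/lfunP.
subst f2 l2.
have phiE v x : exists n m, x = f v n + l v m.
  by have [[n m] ->] := phis v x; exists n, m; rewrite zp.
have f'_eq : f' = f2'.
  apply/rhomP => v y; have [_ /(_ y) /= k _] := lP v; have [_ /(_ y) /= k2 _] := lP2 v.
  by rewrite -k -k2.
have cross_exact c : (c, l) \in [set z in framed_set | framed_rel z t] ->
    [/\ rexact c.1.1 c.1.2, forall v n, c.2.2 v (c.1.1 v n) = i v (p v n)
      & is_split c l].
  case: c => -[u u'] [w w']; rewrite inE => /andP[+ _]; rewrite inE in_setX !inE /=.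
  move=> /andP[/andP[/andP[/short_exactE[_ ? _] _] /and4P[_ /eqP/rhomP s2 _ _]] /asboolP ?].
  by split=> // v n; rewrite -!rcompE s2.
have [/= e1 e2 e3] := cross_exact ((f, g), (f', g')) zZ.
have [/= e1' e2' e3'] := cross_exact ((f, g2), (f2', g2')) zZ2.
have -> : g = g2.
  apply/rhomP => v x; have [n [m ->]] := phiE v x.
  have [/= k _ _] := e3 v; have [/= k' _ _] := e3' v.
  by rewrite !linearD /= (rexact0 _ e1) (rexact0 _ e1') k k'.
have -> : g' = g2'.
  apply/rhomP => v x; have [n [m ->]] := phiE v x.
  have [/= _ _ k] := e3 v; have [/= _ _ k'] := e3' v.
  by rewrite !linearD /= e2 e2' k k'.
by rewrite f'_eq.
Qed.

End Splittings.

(** The framed crosses are counted twice: [H0] for each cross, and total weight 1 for each gluing,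
    since a gluing determines the class of E. *)
Lemma sum_crosses n : (tdim N + tdim M <= n)%N ->
  \sum_(x <- Xle Q F n)
    #|[set c in cross_set M N X Y (rrepr x) | cross_rel c fr]|%:R
      / (aut (rrepr x))%:R =
  (#|F| ^ (\sum_e \dim {:obj A (src e)} * \dim {:obj D (tgt e)}))%:R /
  (#|F| ^ (\sum_v \dim {:obj A v} * \dim {:obj D v}))%:R :> R.
Proof.
move=> NMn; rewrite -!card_hom_family -card_gluing_set.
pose H0 := #|{: {dffun forall v, 'Hom(obj A v, obj D v)}}|; rewrite -/H0.
have H0_neq0 : (H0%:R : R) != 0.
  by rewrite pnatr_eq0 -lt0n; apply/card_gt0P; exists [ffun=> 0].
have framedE E : #|framed_set E| =
    (#|[set c in cross_set M N X Y E | cross_rel c fr]| * H0)%N.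
  rewrite -sum_nat_const -sum1_card.
  rewrite (eq_bigl (fun z : framed_type E =>
    (z.1 \in [set c in cross_set M N X Y E | cross_rel c fr]) &&
    (z.2 \in [set l : split_type E | `[< is_split z.1 l >]]))); last first.
    by move=> z; rewrite !inE.
  rewrite -(pair_big_dep (mem [set c in cross_set M N X Y E | cross_rel c fr])
    (fun c l => l \in [set l : split_type E | `[< is_split c l >]])
    (fun _ _ => 1%N)).
  apply: eq_bigr => c cS.
  have /andP[cc cf] : (c \in cross_set M N X Y E) && cross_rel c fr.
    by move: cS; rewrite !inE.
  by rewrite sum1_card card_split_set.
transitivity (\sum_(x <- Xle Q F n) (aut (rrepr x))%:R^-1 *
    #|framed_set (rrepr x)|%:R / H0%:R : R).
  by apply: eq_bigr => x _; rewrite framedE natrM mulrA mulfK // mulrC.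
rewrite -mulr_suml; congr (_ / _).
(* One index suffices on the side of the gluings, which do not depend on E. *)
rewrite (@double_count R (isocls Q F) unit (Xle Q F n) [:: tt] _ (fun=> gluing_type)
  (fun x => framed_set (rrepr x)) (fun=> gluing_set)
  (fun x => (aut (rrepr x))%:R^-1) (fun=> 1)
  (fun x _ => @framed_rel (rrepr x)) (fun=> 1)).
- by rewrite big_seq1 !mul1r.
- by move=> x _ z zZ; rewrite big_seq1 mul1r card_framed_gluing.
move=> _ _ t tP; rewrite -[RHS](@sum_isoset Q F R n (glued t)); last first.
  by rewrite (short_exact_tdim (glue_exact t)).
by apply: eq_bigr => x _; rewrite card_framed_iso // mulrC card_isosetC.
Qed.
End Fillings.

(** * Assembly of Green's formula *)

Section GreenFormula.
Variables (Q : quiver) (F : finFieldType) (R : realType).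
Implicit Types A B C D E : rep Q F.
Local Notation X := (isocls Q F).

(** This is q^(-<A, D>), expressed through vertex dimensions. *)
Definition euler_weight A D : R :=
  (#|F| ^ (\sum_e \dim {:obj A (src e)} * \dim {:obj D (tgt e)}))%:R /
  (#|F| ^ (\sum_v \dim {:obj A v} * \dim {:obj D v}))%:R.

Lemma green_formula n (M N P S : rep Q F) : (tdim N + tdim M <= n)%N ->
  \sum_(x <- Xle Q F n) (hall_nb M N (rrepr x) * hall_nb P S (rrepr x))%:R
    / (aut (rrepr x))%:R =
  \sum_(a <- Xle Q F n) \sum_(b <- Xle Q F n)
  \sum_(c <- Xle Q F n) \sum_(d <- Xle Q F n)
    euler_weight (rrepr a) (rrepr d) *
    ((hall_nb (rrepr a) (rrepr b) M)%:R * (hall_nb (rrepr c) (rrepr d) N)%:R *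
     ((hall_nb (rrepr a) (rrepr c) P)%:R * (hall_nb (rrepr b) (rrepr d) S)%:R)) /
    ((aut (rrepr a))%:R * (aut (rrepr b))%:R *
     ((aut (rrepr c))%:R * (aut (rrepr d))%:R)) :> R.
Proof.
move=> NMn; pose s := Xle Q F n.
pose s2 := [seq (x, y) | x <- s, y <- s]; pose s4 := [seq (x, y) | x <- s2, y <- s2].
pose J : eqType := ((X * X) * (X * X))%type.
have big_s4 (f : J -> R) : \sum_(t <- s4) f t =
    \sum_(a <- s) \sum_(b <- s) \sum_(c <- s) \sum_(d <- s) f ((a, b), (c, d)).
  rewrite big_allpairs big_allpairs; apply: eq_bigr => a _; apply: eq_bigr => b _.
  by rewrite big_allpairs.
pose w (x : X) : R := (aut (rrepr x))%:R^-1.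
have := @double_count R X J s s4 (fun x => cross_type M N P S (rrepr x))
  (fun t => frame_type M N P S (rrepr t.1.1) (rrepr t.1.2) (rrepr t.2.1) (rrepr t.2.2))
  (fun x => cross_set M N P S (rrepr x))
  (fun t => frame_set M N P S (rrepr t.1.1) (rrepr t.1.2) (rrepr t.2.1) (rrepr t.2.2))
  w (fun t => w t.1.1 * w t.1.2 * (w t.2.1 * w t.2.2))
  (fun x t => @cross_rel Q F M N P S (rrepr x) _ _ _ _)
  (fun t => euler_weight (rrepr t.1.1) (rrepr t.2.2)).
move=> H; transitivity (\sum_(x <- s) w x * #|cross_set M N P S (rrepr x)|%:R).
  by apply: eq_bigr => x _; rewrite cardsX mulrC.
rewrite {}H.
- rewrite big_s4; do 4!(apply: eq_bigr => ? _).
  by rewrite !cardsX !natrM !invfM -!hall_nbE /w /=; ring.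
- move=> x; rewrite mem_Xle => xn c cc.
  have [Nn Mn Sn] : [/\ (tdim N <= n)%N, (tdim M <= n)%N & (tdim S <= n)%N].
    move: cc; case: (c) => -[? ?] [? ?]; rewrite in_setX !inE.
    move=> /andP[/short_exact_tdim E1 /short_exact_tdim E2].
    split; first exact: leq_trans (leq_addr _ _) NMn.
      exact: leq_trans (leq_addl _ _) NMn.
    by apply: leq_trans xn; rewrite /xdim E2 leq_addr.
  (* The four corners of a cross are chosen independently, so the sum over quadruples factors into
     four sums, each equal to 1. *)
  transitivity ((\sum_(a <- s) w a * #|coker_set (rrepr a) (rcomp c.1.2 c.2.1)|%:R) *
      (\sum_(b <- s) w b * #|coim_set (rrepr b) (rcomp c.1.2 c.2.1)|%:R) *
      ((\sum_(e <- s) w e * #|coim_set (rrepr e) (rcomp c.2.2 c.1.1)|%:R) *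
       (\sum_(d <- s) w d * #|ker_set (rrepr d) (rcomp c.2.2 c.1.1)|%:R))).
    rewrite big_s4 2!big_distrlr /= mulr_suml; apply: eq_bigr => a _.
    rewrite mulr_suml; apply: eq_bigr => b _.
    rewrite mulr_sumr; apply: eq_bigr => e _.
    rewrite mulr_sumr; apply: eq_bigr => d _ /=.
    rewrite card_cross_frames // !natrM; set k1 := #|_|%:R; set k2 := #|_|%:R.
    set k3 := #|_|%:R; set k4 := #|_|%:R.
    by rewrite [RHS]mulrC; ring.
  under eq_bigr do rewrite mulrC; rewrite (sum_coker R _ Mn) mul1r.
  under eq_bigr do rewrite mulrC; rewrite (sum_coim R _ Sn) mul1r.
  under eq_bigr do rewrite mulrC; rewrite (sum_coim R _ Nn) mul1r.
  by under eq_bigr do rewrite mulrC; rewrite (sum_ker R _ Nn).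
move=> t _ [[[j a] [d1 p]] [[i a'] [d2 p']]]; rewrite !in_setX !inE /=.
move=> /andP[/andP[/short_exactE[ji ja sa] /short_exactE[d1i dp sp]]].
move=> /andP[/short_exactE[ii ia sa'] /short_exactE[d2i dp' sp']].
under eq_bigr do rewrite mulrC.
exact: sum_crosses.
Qed.
End GreenFormula.

(** * Graded vector spaces and antipodes *)

Lemma exchange_big22 (I : Type) (V : nmodType) (s : seq I) (f : I -> I -> I -> I -> V) :
  \sum_(k <- s) \sum_(m <- s) \sum_(l <- s) \sum_(x <- s) f k m l x =
  \sum_(x <- s) \sum_(l <- s) \sum_(k <- s) \sum_(m <- s) f k m l x.
Proof.
transitivity (\sum_(k <- s) \sum_(l <- s) \sum_(x <- s) \sum_(m <- s) f k m l x).
  apply: eq_bigr => k _; rewrite exchange_big; apply: eq_bigr => l _.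
  exact: exchange_big.
rewrite exchange_big [RHS]exchange_big; apply: eq_bigr => l _.
exact: exchange_big.
Qed.

Lemma exchange_scaler_suml2 (R : pzRingType) (V : lmodType R) (I : Type) (s : seq I)
    (f : I -> I -> I -> R) (t : I -> I -> V) :
  \sum_(u <- s) \sum_(v <- s) (\sum_(a <- s) f a u v) *: t u v =
  \sum_(a <- s) \sum_(u <- s) \sum_(v <- s) f a u v *: t u v.
Proof.
rewrite [RHS]exchange_big; apply: eq_bigr => u _.
rewrite [RHS]exchange_big; apply: eq_bigr => v _; exact: scaler_suml.
Qed.

Lemma exchange_scaler_suml24 (R : pzRingType) (V : lmodType R) (I : Type) (s : seq I)
    (f : I -> I -> I -> I -> I -> I -> R) (t : I -> I -> V) :
  \sum_(u <- s) \sum_(v <- s)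
    (\sum_(a <- s) \sum_(b <- s) \sum_(c <- s) \sum_(d <- s) f a b c d u v) *: t u v =
  \sum_(a <- s) \sum_(b <- s) \sum_(c <- s) \sum_(d <- s)
    \sum_(u <- s) \sum_(v <- s) f a b c d u v *: t u v.
Proof.
rewrite exchange_scaler_suml2; apply: eq_bigr => a _.
rewrite exchange_scaler_suml2; apply: eq_bigr => b _.
rewrite exchange_scaler_suml2; apply: eq_bigr => c _.
exact: exchange_scaler_suml2.
Qed.

Section TensorMaps.
Variables (R : fieldType) (K : zmodType).
Implicit Types U V W T A : grvect R K.

Lemma linear_id (V : lmodType R) : linear (@id V). Proof. by []. Qed.

Lemma linear_comp (U V W : lmodType R) (g : V -> W) (f : U -> V) :
  linear g -> linear f -> linear (g \o f).
Proof. by move=> gl fl a u v /=; rewrite fl gl. Qed.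

Lemma gmap_linear (V V' W W' : grvect R K) (f : V -> V') (g : W -> W') :
  linear f -> linear g -> linear (gmap f g).
Proof. exact: tmap_linear. Qed.

Lemma gmapE (V V' W W' : grvect R K) (f : V -> V') (g : W -> W') :
  linear f -> linear g ->
  forall v w, gmap f g (tens v w) = tens (f v) (g w).
Proof. exact: tmapE. Qed.

Lemma assoc_bilin U V W : bilin (fun (s : tensor U V) (w : W) =>
  tlift (fun u v => tens u (tens v w) : gtens U (gtens V W)) s).
Proof.
have inner w : bilin (fun (u : U) (v : V) => tens u (tens v w) : gtens U (gtens V W)).
  by split=> x a y z /=; rewrite ?tensDl ?tensZl // tensDr tensZr.
split=> [w|s]; first exact: tlift_linear.
have [T [TE Tl Tt]] : exists T : W -> tensor U V -> gtens U (gtens V W),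
    [/\ (forall w, tlift (fun u v => tens u (tens v w) : gtens U (gtens V W)) = T w),
        (forall w, linear (T w)) & forall u v w, T w (tens u v) = tens u (tens v w)].
  exists (fun w => tlift (fun u v => tens u (tens v w) : gtens U (gtens V W))).
  by split=> // [w|u v w]; [exact: tlift_linear|exact: tliftE].
move=> a w w'; suff: T (a *: w + w') s = a *: T w s + T w' s by rewrite -!TE.
elim/tensor_ind: s => [|u v|s t Hs Ht].
- by rewrite !(lin0 (Tl _)) scaler0 addr0.
- by rewrite !Tt !tensDr !tensZr.
- by rewrite !(linD (Tl _)) Hs Ht scalerDr addrACA.
Qed.

Lemma assoc_linear U V W : linear (@assoc R K U V W).
Proof. exact: tlift_linear (assoc_bilin U V W). Qed.

Lemma assocE U V W (u : U) (v : V) (w : W) :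
  assoc (tens (tens u v : gtens U V) w) = tens u (tens v w : gtens V W).
Proof.
rewrite /assoc (tliftE (assoc_bilin U V W)) tliftE //.
by split=> x a y z /=; rewrite ?tensDl ?tensZl // tensDr tensZr.
Qed.

Lemma assoc_inv_bilin U V W : bilin (fun (u : U) (s : tensor V W) =>
  tlift (fun v w => tens (tens u v) w : gtens (gtens U V) W) s).
Proof.
have inner u : bilin (fun (v : V) (w : W) => tens (tens u v) w : gtens (gtens U V) W).
  by split=> x a y z /=; [rewrite tensDr tensZr tensDl tensZl|rewrite tensDr tensZr].
split=> [s|u]; last exact: tlift_linear.
have [T [TE Tl Tt]] : exists T : U -> tensor V W -> gtens (gtens U V) W,
    [/\ (forall u, tlift (fun v w => tens (tens u v) w : gtens (gtens U V) W) = T u),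
        (forall u, linear (T u)) & forall u v w, T u (tens v w) = tens (tens u v) w].
  exists (fun u => tlift (fun v w => tens (tens u v) w : gtens (gtens U V) W)).
  by split=> // [u|u v w]; [exact: tlift_linear|exact: tliftE].
move=> a u u'; suff: T (a *: u + u') s = a *: T u s + T u' s by rewrite -!TE.
elim/tensor_ind: s => [|v w|s t Hs Ht].
- by rewrite !(lin0 (Tl _)) scaler0 addr0.
- by rewrite !Tt !(tensDl, tensZl).
- by rewrite !(linD (Tl _)) Hs Ht scalerDr addrACA.
Qed.

Lemma assoc_inv_linear U V W : linear (@assoc_inv R K U V W).
Proof. exact: tlift_linear (assoc_inv_bilin U V W). Qed.

Lemma assoc_invE U V W (u : U) (v : V) (w : W) :
  assoc_inv (tens u (tens v w : gtens V W)) = tens (tens u v : gtens U V) w.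
Proof.
rewrite /assoc_inv (tliftE (assoc_inv_bilin U V W)) tliftE //.
by split=> x a y z /=; [rewrite tensDr tensZr tensDl tensZl|rewrite tensDr tensZr].
Qed.

Lemma lunit_bilin V : bilin (fun (r : R^o) (v : V) => r *: v).
Proof.
by split=> x a y z /=; [rewrite scalerDl scalerA|rewrite scalerDr !scalerA mulrC].
Qed.

Lemma lunit_linear V : linear (@lunit R K V).
Proof. exact: tlift_linear (lunit_bilin V). Qed.

Lemma lunitE V (r : R^o) (v : V) : lunit (tens (r : gunit R K) v) = r *: v.
Proof. exact: tliftE (lunit_bilin V) _ _. Qed.

Lemma runit_bilin V : bilin (fun (v : V) (r : R^o) => r *: v).
Proof. by have [? ?] := lunit_bilin V; split. Qed.

Lemma runit_linear V : linear (@runit R K V).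
Proof. exact: tlift_linear (runit_bilin V). Qed.

Lemma runitE V (r : R^o) (v : V) : runit (tens v (r : gunit R K)) = r *: v.
Proof. exact: tliftE (runit_bilin V) _ _. Qed.

Lemma braid_linear (q : R) (chi : K -> K -> int) V W : linear (@braid R K q chi V W).
Proof. exact: tlift_linear (braid_pair_bilin q chi V W). Qed.

Lemma tens_linearl V W (w : W) : linear (fun v : V => tens v w : gtens V W).
Proof. by move=> a x y; rewrite tensDl tensZl. Qed.

Lemma tens_linearr V W (v : V) : linear (fun w : W => tens v w : gtens V W).
Proof. by move=> a x y; rewrite tensDr tensZr. Qed.

Lemma linear_tens3_ext U V W (T : lmodType R) (f g : gtens (gtens U V) W -> T) :
  linear f -> linear g ->
  (forall u v w, f (tens (tens u v : gtens U V) w) = g (tens (tens u v : gtens U V) w)) ->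
  f =1 g.
Proof.
move=> fl gl fg; apply: linear_tens_ext => // s w.
have sl : linear (fun s : gtens U V => tens s w : gtens (gtens U V) W).
  by move=> a x y; rewrite tensDl tensZl.
apply: (linear_tens_ext (f := fun s => f (tens s w)) (g := fun s => g (tens s w))).
- by move=> a x y; rewrite sl fl.
- by move=> a x y; rewrite sl gl.
- by move=> u v; exact: fg.
Qed.

Lemma gmap_comp (V V' V'' W W' W'' : grvect R K) (f : V -> V') (f' : V' -> V'')
    (g : W -> W') (g' : W' -> W'') :
  linear f -> linear f' -> linear g -> linear g' ->
  forall t, gmap f' g' (gmap f g t) = gmap (f' \o f) (g' \o g) t.
Proof.
move=> fl fl' gl gl'; have fl2 := linear_comp fl' fl; have gl2 := linear_comp gl' gl.
apply: linear_tens_ext => [||v w].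
- exact: (linear_comp (gmap_linear fl' gl') (gmap_linear fl gl)).
- exact: gmap_linear fl2 gl2.
- by rewrite (gmapE fl gl) (gmapE fl' gl') (gmapE fl2 gl2).
Qed.

Lemma assoc_gmap (U U' V V' W W' : grvect R K) (f : U -> U') (g : V -> V')
    (h : W -> W') : linear f -> linear g -> linear h ->
  forall t, assoc (gmap (gmap f g) h t) = gmap f (gmap g h) (assoc t).
Proof.
move=> fl gl hl; have fgl := gmap_linear fl gl; have ghl := gmap_linear gl hl.
apply: linear_tens3_ext => [||u v w].
- exact: (linear_comp (@assoc_linear _ _ _) (gmap_linear fgl hl)).
- exact: (linear_comp (gmap_linear fl ghl) (@assoc_linear _ _ _)).
- by rewrite (gmapE fgl hl) (gmapE fl gl) !assocE (gmapE fl ghl) (gmapE gl hl).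
Qed.

Lemma grmor_id V : is_grmor (@id V).
Proof. by split. Qed.

Lemma grmor_comp U V W (g : V -> W) (f : U -> V) :
  is_grmor g -> is_grmor f -> is_grmor (g \o f).
Proof.
move=> [gl gg] [fl fg]; split; first exact: linear_comp.
by move=> n v /fg/gg.
Qed.

Lemma gpart_sum V n I (r : seq I) (P : pred I) (f : I -> V) :
  (forall i, P i -> f i \in gpart n) -> \sum_(i <- r | P i) f i \in gpart n.
Proof.
move=> fn; apply: (big_ind (fun v => v \in gpart n)) => // [|u v un vn].
  exact: (gpart_submod V n).1.
by rewrite -[u]scale1r; exact: (gpart_submod V n).2.
Qed.

Lemma gpartZ V n a (v : V) : v \in gpart n -> a *: v \in gpart n.
Proof.
move=> vn; rewrite -[_ *: _]addr0; apply: (gpart_submod V n).2 => //.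
exact: (gpart_submod V n).1.
Qed.

Lemma grmor_comb V W a (f g : V -> W) : is_grmor f -> is_grmor g ->
  is_grmor (fun v => a *: f v + g v).
Proof.
move=> [fl fg] [gl gg]; split=> [b u v|n v vn].
  by rewrite fl gl !scalerDr !scalerA mulrC addrACA.
by apply: (gpart_submod W n).2; [exact: fg|exact: gg].
Qed.

Lemma grmor_tens V W T (f : gtens V W -> T) : linear f ->
  (forall n m v w, v \in gpart n -> w \in gpart m -> f (tens v w) \in gpart (n + m)) ->
  is_grmor f.
Proof.
move=> fl fp; split=> // d t /asboolP[s [-> sd]]; rewrite (lin_sum fl).
rewrite big_seq; apply: gpart_sum => x /sd[n [m [<- x1 x2]]]; exact: fp.
Qed.

Lemma grmor_gmap (V V' W W' : grvect R K) (f : V -> V') (g : W -> W') :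
  is_grmor f -> is_grmor g -> is_grmor (gmap f g).
Proof.
move=> [fl fg] [gl gg]; apply: grmor_tens; first exact: gmap_linear.
move=> n m v w vn wm; rewrite (gmapE fl gl); apply: gtens_part_tens; [exact: fg|exact: gg].
Qed.

(** * Antipode of a locally nilpotent bialgebra structure *)

Section Antipode.
Variables (A : grvect R K) (mul : gtens A A -> A) (unit : gunit R K -> A).
Variables (comul : A -> gtens A A) (counit : A -> gunit R K).
Hypotheses (mon : is_monoid mul unit) (comon : is_comonoid comul counit).

(** The convolution product. Linear endomorphisms form a monoid under it, with unit [eta_eps] below,
    and an antipode is a two-sided inverse of [id]. *)
Definition conv (f g : A -> A) (a : A) : A := mul (gmap f g (comul a)).

Let mulG : is_grmor mul. Proof. by case: mon. Qed.
Let unitG : is_grmor unit. Proof. by case: mon. Qed.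
Let comulG : is_grmor comul. Proof. by case: comon. Qed.
Let counitG : is_grmor counit. Proof. by case: comon. Qed.

Lemma conv_grmor f g : is_grmor f -> is_grmor g -> is_grmor (conv f g).
Proof.
move=> fG gG; apply: (grmor_comp mulG); apply: grmor_comp comulG.
exact: grmor_gmap.
Qed.

Lemma convA f g h : linear f -> linear g -> linear h ->
  conv (conv f g) h =1 conv f (conv g h).
Proof.
move=> fl gl hl a.
have [_ _ mA _ _] := mon; have [_ _ cA _ _] := comon.
have [ml _] := mulG; have [cl _] := comulG.
have idl := @linear_id A.
have fgl := gmap_linear fl gl; have ghl := gmap_linear gl hl.
have -> : conv (conv f g) h a =
    mul (gmap mul id (gmap (gmap f g) h (gmap comul id (comul a)))).
  by rewrite (gmap_comp cl fgl idl hl) (gmap_comp (linear_comp fgl cl) ml (linear_comp hl idl) idl).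
have -> : conv f (conv g h) a =
    mul (gmap id mul (gmap f (gmap g h) (gmap id comul (comul a)))).
  by rewrite (gmap_comp idl fl cl ghl) (gmap_comp (linear_comp fl idl) idl (linear_comp ghl cl) ml).
by rewrite mA (assoc_gmap fl gl hl) cA.
Qed.

Let eta_eps (a : A) : A := unit (counit a).

Let eta_epsG : is_grmor eta_eps.
Proof. exact: grmor_comp unitG counitG. Qed.

Lemma conv_unitl f : linear f -> conv eta_eps f =1 f.
Proof.
move=> fl a; have [_ _ _ mU _] := mon; have [_ _ _ cU _] := comon.
have [ul _] := unitG; have [el _] := counitG; have idl := @linear_id A.
have idl' := @linear_id (gunit R K).
have -> : conv eta_eps f a = mul (gmap unit id (gmap id f (gmap counit id (comul a)))).
  rewrite (gmap_comp el idl' idl fl).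
  by rewrite (gmap_comp (linear_comp idl' el) ul (linear_comp fl idl) idl).
rewrite mU -[in RHS](cU a).
apply: (linear_tens_ext (f := fun t => lunit (gmap id f t)) (g := fun t => f (lunit t))).
- exact: (linear_comp (@lunit_linear _) (gmap_linear idl' fl)).
- exact: (linear_comp fl (@lunit_linear _)).
- by move=> r v; rewrite (gmapE idl' fl) !lunitE (linZ fl).
Qed.

Lemma conv_unitr f : linear f -> conv f eta_eps =1 f.
Proof.
move=> fl a; have [_ _ _ _ mU] := mon; have [_ _ _ _ cU] := comon.
have [ul _] := unitG; have [el _] := counitG; have idl := @linear_id A.
have idl' := @linear_id (gunit R K).
have -> : conv f eta_eps a = mul (gmap id unit (gmap f id (gmap id counit (comul a)))).
  rewrite (gmap_comp idl fl el idl').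
  by rewrite (gmap_comp (linear_comp fl idl) idl (linear_comp idl' el) ul).
rewrite mU -[in RHS](cU a).
apply: (linear_tens_ext (f := fun t => runit (gmap f id t)) (g := fun t => f (runit t))).
- exact: (linear_comp (@runit_linear _) (gmap_linear fl idl')).
- exact: (linear_comp fl (@runit_linear _)).
- by move=> r v; rewrite (gmapE fl idl') !runitE (linZ fl).
Qed.

Definition aug (a : A) : A := a - unit (counit a).
Fixpoint aug_pow (k : nat) : A -> A :=
  if k is k'.+1 then conv aug (aug_pow k') else eta_eps.

Lemma augG : is_grmor aug.
Proof.
have -> : aug = (fun a => -1 *: eta_eps a + id a).
  by apply/funext => a; rewrite /aug scaleN1r addrC.
exact: grmor_comb eta_epsG (grmor_id A).
Qed.

Lemma aug_powG k : is_grmor (aug_pow k).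
Proof. by elim: k => [|k IH] //=; apply: conv_grmor => //; exact: augG. Qed.

(** The recursion multiplies by [aug] on the left; the identity with the antipode as left factor
    produces it on the right. *)
Lemma aug_powSr k : aug_pow k.+1 =1 conv (aug_pow k) aug.
Proof.
have al := augG.1; elim: k => [|k IH] a.
  by rewrite /= (conv_unitr al) (conv_unitl al).
have IH' : aug_pow k.+1 = conv (aug_pow k) aug by apply/funext.
change (conv aug (aug_pow k.+1) a = conv (conv aug (aug_pow k)) aug a).
by rewrite (convA al (aug_powG k).1 al) IH'.
Qed.

Hypothesis aug_nil : forall a, exists n, forall k, (n <= k)%N -> aug_pow k a = 0.

Definition geom n (a : A) : A := \sum_(k < n) (-1) ^+ k *: aug_pow k a.

Let nil_rank a : nat := projT1 (cid (aug_nil a)).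
Let nil_rankP a k : (nil_rank a <= k)%N -> aug_pow k a = 0.
Proof. exact: (projT2 (cid (aug_nil a))). Qed.

(** The cut-off depends on [a], so linearity is not immediate; it comes from a common cut-off for
    the elements involved. *)
Definition antipode (a : A) : A := geom (nil_rank a) a.

Lemma geom_stable n a : (nil_rank a <= n)%N -> geom n a = antipode a.
Proof.
move=> /subnKC <-; rewrite /geom big_split_ord /= [X in _ + X]big1 ?addr0 //.
by move=> k _; rewrite nil_rankP ?leq_addr ?scaler0.
Qed.

Lemma geom_linear n : linear (geom n).
Proof.
move=> a u v; rewrite /geom scaler_sumr -big_split; apply: eq_bigr => k _.
by rewrite (aug_powG k).1 scalerDr !scalerA mulrC.
Qed.

Lemma antipode_grmor : is_grmor antipode.
Proof.
split=> [a u v|n v vn]; last by apply: gpart_sum => k _; apply/gpartZ/(aug_powG k).2.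
pose n := maxn (nil_rank (a *: u + v)) (maxn (nil_rank u) (nil_rank v)).
rewrite -!(@geom_stable n) ?leq_max ?leqnn ?orbT //.
exact: geom_linear.
Qed.

Lemma geom_telescope n a :
  \sum_(k < n) (-1) ^+ k *: (aug_pow k a + aug_pow k.+1 a) =
  eta_eps a - (-1) ^+ n *: aug_pow n a.
Proof.
elim: n => [|n IH]; first by rewrite big_ord0 expr0 scale1r subrr.
rewrite big_ord_recr IH /= scalerDr addrA subrK exprS mulN1r scaleNr opprK.
by [].
Qed.

(* Near a given element the antipode is a partial geometric series, since its *)
(* comultiplication is a finite sum.                                          *)
Lemma comul_rank a : exists (s : seq (A * A)) (n : nat),
  [/\ comul a = \sum_(x <- s) tens x.1 x.2, (nil_rank a <= n)%N
    & forall x, x \in s -> (nil_rank x.1 <= n)%N /\ (nil_rank x.2 <= n)%N].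
Proof.
have [s sE] := tensor_gen_sum (comul a).
exists s, (maxn (nil_rank a) (\max_(x <- s) maxn (nil_rank x.1) (nil_rank x.2))).
split; rewrite ?leq_maxl // => x xs; have := @leq_bigmax_seq _ s xpredT
  (fun x => maxn (nil_rank x.1) (nil_rank x.2)) x xs isT.
by rewrite geq_max => /andP[x1 x2]; rewrite !leq_max x1 x2 !orbT.
Qed.

Lemma conv_seq f g a (s : seq (A * A)) : linear f -> linear g ->
  comul a = \sum_(x <- s) tens x.1 x.2 ->
  conv f g a = \sum_(x <- s) mul (tens (f x.1) (g x.2)).
Proof.
move=> fl gl sE; rewrite /conv sE (lin_sum (gmap_linear fl gl)) (lin_sum mulG.1).
by apply: eq_bigr => x _; rewrite (gmapE fl gl).
Qed.

Lemma conv_geoml n g a : linear g ->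
  conv (geom n) g a = \sum_(k < n) (-1) ^+ k *: conv (aug_pow k) g a.
Proof.
move=> gl; have [s sE] := tensor_gen_sum (comul a).
rewrite (conv_seq (geom_linear n) gl sE).
rewrite (eq_bigr (fun x => \sum_(k < n) (-1) ^+ k *: mul (tens (aug_pow k x.1) (g x.2)))).
  rewrite exchange_big; apply: eq_bigr => k _.
  by rewrite (conv_seq (aug_powG k).1 gl sE) scaler_sumr.
move=> x _; rewrite /geom tens_suml (lin_sum mulG.1); apply: eq_bigr => k _.
by rewrite tensZl (linZ mulG.1).
Qed.

Lemma conv_geomr n f a : linear f ->
  conv f (geom n) a = \sum_(k < n) (-1) ^+ k *: conv f (aug_pow k) a.
Proof.
move=> fl; have [s sE] := tensor_gen_sum (comul a).
rewrite (conv_seq fl (geom_linear n) sE).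
rewrite (eq_bigr (fun x => \sum_(k < n) (-1) ^+ k *: mul (tens (f x.1) (aug_pow k x.2)))).
  rewrite exchange_big; apply: eq_bigr => k _.
  by rewrite (conv_seq fl (aug_powG k).1 sE) scaler_sumr.
move=> x _; rewrite /geom tens_sumr (lin_sum mulG.1); apply: eq_bigr => k _.
by rewrite tensZr (linZ mulG.1).
Qed.

(** [id] is the convolution unit plus [aug]. *)
Lemma conv_idr f a : linear f -> conv f id a = f a + conv f aug a.
Proof.
move=> fl; rewrite -{1}(conv_unitr fl); have [s sE] := tensor_gen_sum (comul a).
rewrite (conv_seq fl (@linear_id _) sE) (conv_seq fl augG.1 sE) (conv_seq fl eta_epsG.1 sE).
rewrite -big_split; apply: eq_bigr => x _ /=.
by rewrite -(linD mulG.1) -tensDr /aug /eta_eps addrC subrK.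
Qed.

Lemma conv_idl f a : linear f -> conv id f a = f a + conv aug f a.
Proof.
move=> fl; rewrite -{1}(conv_unitl fl); have [s sE] := tensor_gen_sum (comul a).
rewrite (conv_seq (@linear_id _) fl sE) (conv_seq augG.1 fl sE) (conv_seq eta_epsG.1 fl sE).
rewrite -big_split; apply: eq_bigr => x _ /=.
by rewrite -(linD mulG.1) -tensDl /aug /eta_eps addrC subrK.
Qed.

Lemma antipodeP : is_antipode mul unit comul counit antipode.
Proof.
have Sl := antipode_grmor.1; have idl := @linear_id A.
split=> [|a|a]; first exact: antipode_grmor.
- have [s [n [sE an sn]]] := comul_rank a.
  transitivity (conv (geom n) id a).
    rewrite (conv_seq (geom_linear n) idl sE) -[LHS]/(conv antipode id a).
    rewrite (conv_seq Sl idl sE) big_seq [RHS]big_seq; apply: eq_bigr => x xs.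
    by rewrite (geom_stable (sn x xs).1).
  (* Convolving the k-th power with [id] gives the sum of the powers k and k + 1, so the alternating
     sum telescopes; its last term vanishes because [n] is at least the rank of [a]. *)
  rewrite conv_geoml //; transitivity (eta_eps a - (-1) ^+ n *: aug_pow n a).
    rewrite -geom_telescope; apply: eq_bigr => k _.
    by rewrite (conv_idr _ (aug_powG k).1) (aug_powSr k).
  by rewrite nil_rankP // scaler0 subr0.
- have [s [n [sE an sn]]] := comul_rank a.
  transitivity (conv id (geom n) a).
    rewrite (conv_seq idl (geom_linear n) sE) -[LHS]/(conv id antipode a).
    rewrite (conv_seq idl Sl sE) big_seq [RHS]big_seq; apply: eq_bigr => x xs.
    by rewrite (geom_stable (sn x xs).2).
  rewrite conv_geomr //; transitivity (eta_eps a - (-1) ^+ n *: aug_pow n a).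
    rewrite -geom_telescope; apply: eq_bigr => k _.
    by rewrite (conv_idl _ (aug_powG k).1).
  by rewrite nil_rankP // scaler0 subr0.
Qed.

End Antipode.
End TensorMaps.

From mathcomp Require Import classical_sets functions.

(** * The Hall algebra *)

Lemma malgU_scale (R : nzRingType) (X : choiceType) (c : R) (x : X) :
  << c *g x >> = c *: << x >> :> {malg R[X]}.
Proof. by apply/malgP => y; rewrite mcoeffZ !mcoeffU mulrnAr mulr1. Qed.

Section HallBasis.
Local Open Scope classical_set_scope.
Variables (Q : quiver) (F : finFieldType) (R : realType).
Local Notation X := (isocls Q F).
Local Notation H := (hall Q F R).
Local Notation e := (@hall_elt Q F R).
Local Notation K := (K0 Q F).

Lemma free_lift_linear (U : lmodType R) (b : X -> U) :
  linear (free_lift b : H -> U).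
Proof.
have liftE (d : {fset X}) (h : {malg R[X]}) : (msupp h `<=` d)%fset ->
    free_lift (b : X -> U) (h : H) = \sum_(x <- d) h@_x *: b x.
  move=> /fsubsetP hd; rewrite /free_lift.
  apply: big_fset_incl => [|x xd]; first exact/fsubsetP.
  by move/mcoeff_outdom => ->; rewrite scale0r.
move=> a u v; pose w : {malg R[X]} := a *: (u : {malg R[X]}) + (v : {malg R[X]}).
pose d := (msupp (u : {malg R[X]}) `|` (msupp (v : {malg R[X]}) `|` msupp w))%fset.
rewrite (liftE d u) ?(liftE d v) ?(liftE d w).
- rewrite scaler_sumr -big_split; apply: eq_bigr => x _ /=.
  by rewrite mcoeffD mcoeffZ scalerDl scalerA.
- by apply/fsubsetP => p; rewrite !in_fsetU => ->; rewrite !orbT.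
- by apply/fsubsetP => p; rewrite !in_fsetU => ->; rewrite orbT.
- by apply/fsubsetP => p; rewrite !in_fsetU => ->.
Qed.

Lemma free_lift_elt (U : lmodType R) (b : X -> U) x : free_lift b (e x : H) = b x.
Proof.
rewrite /free_lift /hall_elt msuppU oner_eq0 big_seq_fset1 mcoeffUU.
by rewrite scale1r.
Qed.

Lemma hallE (h : H) : h = \sum_(x <- msupp (h : {malg R[X]})) (h : {malg R[X]})@_x *: e x.
Proof.
by rewrite {1}[h](monalgE (h : {malg R[X]})); apply: eq_bigr => x _; exact: malgU_scale.
Qed.

Lemma hall_ext (U : lmodType R) (f g : H -> U) : linear f -> linear g ->
  (forall x, f (e x) = g (e x)) -> f =1 g.
Proof.
move=> fl gl fg h; rewrite [h]hallE (lin_sum fl) (lin_sum gl).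
by apply: eq_bigr => x _; rewrite (linZ fl) (linZ gl) fg.
Qed.

Lemma hall_ext2 (U : lmodType R) (f g : gtens H H -> U) : linear f -> linear g ->
  (forall x y, f (tens (e x) (e y)) = g (tens (e x) (e y))) -> f =1 g.
Proof.
move=> fl gl fg; apply: linear_tens_ext => // u v.
have tl w : linear (fun u : H => tens u w : gtens H H).
  by move=> a x y; rewrite tensDl tensZl.
have tr w : linear (fun u : H => tens w u : gtens H H).
  by move=> a x y; rewrite tensDr tensZr.
apply: (hall_ext (f := fun u => f (tens u v)) (g := fun u => g (tens u v))).
- exact: (linear_comp fl (tl v)).
- exact: (linear_comp gl (tl v)).
move=> x; apply: (hall_ext (f := fun v => f (tens _ v)) (g := fun v => g (tens _ v))).
- exact: (linear_comp fl (tr _)).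
- exact: (linear_comp gl (tr _)).
- by move=> y; exact: fg.
Qed.

Lemma hall_ext3 (U : lmodType R) (f g : gtens (gtens H H) H -> U) :
  linear f -> linear g ->
  (forall x y z, f (tens (tens (e x) (e y) : gtens H H) (e z)) =
                 g (tens (tens (e x) (e y) : gtens H H) (e z))) -> f =1 g.
Proof.
move=> fl gl fg; apply: linear_tens_ext => // s w.
have tl w' : linear (fun s : gtens H H => tens s w' : gtens (gtens H H) H).
  by move=> a x y; rewrite tensDl tensZl.
have tr s' : linear (fun u : H => tens s' u : gtens (gtens H H) H).
  by move=> a x y; rewrite tensDr tensZr.
apply: (hall_ext2 (f := fun s => f (tens s w)) (g := fun s => g (tens s w))).
- exact: (linear_comp fl (tl w)).
- exact: (linear_comp gl (tl w)).
move=> x y; apply: (hall_ext (f := fun v => f (tens _ v)) (g := fun v => g (tens _ v))).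
- exact: (linear_comp fl (tr _)).
- exact: (linear_comp gl (tr _)).
- by move=> z; exact: fg.
Qed.

Lemma hall_elt_part x : e x \in @gpart R K H (kcls x).
Proof.
apply/free_partP => y yx; rewrite mcoeffU.
by case: eqP => [xy|]; rewrite ?mulr0n //; rewrite xy eqxx in yx.
Qed.

Lemma grmor_hall (W : grvect R K) (f : H -> W) : linear f ->
  (forall x, f (e x) \in gpart (kcls x)) -> is_grmor f.
Proof.
move=> fl fp; split=> // n v /free_partP vn; rewrite [v]hallE (lin_sum fl).
apply: gpart_sum => x _; rewrite (linZ fl).
have [<-|xn] := eqVneq (kcls x) n; first exact/gpartZ/fp.
by rewrite vn // scale0r; exact: (gpart_submod W n).1.
Qed.

Lemma kcls_exact (N E M : rep Q F) (f : rhom N E) (g : rhom E M) :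
  short_exact f g -> kcls (cls E) = kcls (cls N) + kcls (cls M).
Proof.
move=> fg; have -> : kcls (cls N) + kcls (cls M) = kpi (<< cls N >> + << cls M >>).
  exact/esym/pi_add.
apply/eqP; rewrite /kcls /kpi -idealrBE; apply/asboolP => J _ JE.
exact: JE fg.
Qed.

Lemma hall_nb_exact (M N E : rep Q F) : hall_nb M N E != 0%N ->
  exists (f : rhom N E) (g : rhom E M), short_exact f g.
Proof.
by rewrite -lt0n => /card_gt0P[[f g]]; rewrite inE => fg; exists f, g.
Qed.

Lemma hall_nb_kcls (x y z : X) : hall_nb (rrepr x) (rrepr y) (rrepr z) != 0%N ->
  kcls z = kcls x + kcls y :> K.
Proof.
move=> /hall_nb_exact[f [g /kcls_exact E]]; rewrite !rreprK in E.
by rewrite E [RHS]addrC.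
Qed.

Lemma hall_nb_dim (x y z : X) : hall_nb (rrepr x) (rrepr y) (rrepr z) != 0%N ->
  xdim z = (xdim x + xdim y)%N.
Proof. by move=> /hall_nb_exact[f [g /short_exact_tdim]]; rewrite addnC. Qed.

Lemma hall_mul_coef0 (x y z : X) :
  hall_nb (rrepr x) (rrepr y) (rrepr z) = 0%N -> hall_mul_coef R x y z = 0.
Proof. by rewrite /hall_mul_coef => ->; rewrite mul0r. Qed.

Lemma hall_comul_coef0 (x y z : X) :
  hall_nb (rrepr x) (rrepr y) (rrepr z) = 0%N -> hall_comul_coef R x y z = 0.
Proof. by rewrite /hall_comul_coef => ->; rewrite mul0r. Qed.

Lemma hall_mul_bilin : bilin (fun h k : H => free_lift (fun x => free_lift (fun y =>
    \sum_(z \in [set: X]) hall_mul_coef R x y z *: e z) k) h : H).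
Proof.
split=> [k|h]; first exact: free_lift_linear.
move=> a k k'; rewrite /= {1 3 5}/free_lift scaler_sumr -big_split; apply: eq_bigr => x _ /=.
by rewrite free_lift_linear scalerDr !scalerA mulrC.
Qed.

Lemma hall_mul_linear : linear (@hall_mul Q F R).
Proof. exact: tlift_linear hall_mul_bilin. Qed.

(** A nonzero coefficient forces xdim z = xdim x + xdim y, so the support of the sum over all
    classes lies in [Xle n]. The freedom in [n] lets several products share one range. *)
Lemma hall_mulE n x y : (xdim x + xdim y <= n)%N ->
  hall_mul (tens (e x) (e y) : gtens H H) =
  \sum_(z <- Xle Q F n) hall_mul_coef R x y z *: e z.
Proof.
move=> xyn; rewrite /hall_mul (tliftE hall_mul_bilin) free_lift_elt free_lift_elt.
rewrite (fsum_seq (Xle_uniq Q F n)) // => z; apply: contraNT; rewrite mem_Xle => zn.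
rewrite hall_mul_coef0 ?scale0r //; apply/eqP/negPn/negP => /hall_nb_dim zE.
by rewrite zE xyn in zn.
Qed.

Lemma hall_comul_linear : linear (@hall_comul Q F R).
Proof. exact: free_lift_linear. Qed.

Lemma hall_comulE n z : (xdim z <= n)%N ->
  hall_comul (e z : H) = \sum_(x <- Xle Q F n) \sum_(y <- Xle Q F n)
    hall_comul_coef R x y z *: (tens (e y) (e x) : gtens H H).
Proof.
move=> zn; rewrite /hall_comul free_lift_elt.
rewrite (fsum_seq (s := [seq (x, y) | x <- Xle Q F n, y <- Xle Q F n])).
- by rewrite big_allpairs.
- by apply: allpairs_uniq; rewrite ?Xle_uniq // => -[? ?] [? ?] _ _ [-> ->].
move=> [x y]; apply: contraNT => /= xy; rewrite hall_comul_coef0 ?scale0r //.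
apply/eqP/negPn/negP => /hall_nb_dim zE; case/negP: xy.
apply: allpairs_f; rewrite mem_Xle; apply: leq_trans zn; rewrite zE.
  exact: leq_addr.
exact: leq_addl.
Qed.

Lemma hall_unit_linear : linear (@hall_unit Q F R).
Proof. by move=> a u v; rewrite /hall_unit scalerDl scalerA. Qed.

Lemma hall_counit_linear : linear (@hall_counit Q F R).
Proof. by move=> a u v; rewrite /hall_counit mcoeffD mcoeffZ. Qed.

Lemma hall_counitE x : hall_counit (e x : H) = (x == cls (zero_rep Q F))%:R.
Proof. by rewrite /hall_counit mcoeffU; case: eqP. Qed.

End HallBasis.

(** * The zero class and the unit coefficients *)

Section HallZero.
Variables (Q : quiver) (F : finFieldType) (R : realType).
Local Notation X := (isocls Q F).
Local Notation o := (cls (zero_rep Q F)).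
Implicit Types M N E Z : rep Q F.

Let rzero_subproof M N e (x : obj M (src e)) :
  (0 : 'Hom(obj M (tgt e), obj N (tgt e))) (arr M e x) =
  arr N e ((0 : 'Hom(obj M (src e), obj N (src e))) x).
Proof. by rewrite !zero_lfunE linear0. Qed.
Definition rzero M N : rhom M N := mk_rhom (f := fun=> 0) (@rzero_subproof M N).

Lemma tdim0 Z v (x : obj Z v) : tdim Z = 0%N -> x = 0.
Proof.
move=> /eqP; rewrite /tdim sum_nat_eq0 => /forallP/(_ v); rewrite implyTb dimv_eq0.
by move=> /eqP Z0; have := memvf x; rewrite Z0 memv0 => /eqP.
Qed.

(** Stated for any [Z] of dimension zero because the chosen representative of the zero class is only
    isomorphic to [zero_rep]. *)
Lemma hall_nb0l Z N E : tdim Z = 0%N -> hall_nb Z N E = #|isoset N E|.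
Proof.
move=> Z0; apply: (card_in_bij (f := fun fg => fg.1)).
- move=> [f g] [f' g'] _ _ /= ->; congr (_, _); apply/rhomP => v x.
  by rewrite [LHS](tdim0 _ Z0) [RHS](tdim0 _ Z0).
- move=> [f g]; rewrite !inE => /short_exactE[fi fg gs] /=.
  by apply/is_isoP; split=> // v x; apply/fg/tdim0.
move=> f; rewrite inE => /is_isoP[fi fs]; exists (f, rzero E Z) => //.
rewrite inE; apply/short_exactE; split=> // v x.
  by split=> _; [exact: fs|exact: tdim0].
by exists 0; rewrite linear0; exact: tdim0.
Qed.

Lemma hall_nb0r Z M E : tdim Z = 0%N -> hall_nb M Z E = #|isoset E M|.
Proof.
move=> Z0; apply: (card_in_bij (f := fun fg => fg.2)).
- move=> [f g] [f' g'] _ _ /= ->; congr (_, _); apply/rhomP => v x.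
  by rewrite (tdim0 x Z0) !linear0.
- move=> [f g]; rewrite !inE => /short_exactE[fi fg gs] /=.
  apply/is_isoP; split=> //; apply: rinjP => v x /fg[y ->].
  by rewrite (tdim0 y Z0) linear0.
move=> g; rewrite inE => /is_isoP[gi gs]; exists (rzero Z E, g) => //.
rewrite inE; apply/short_exactE; split=> // v x.
  by move=> y _; rewrite (tdim0 x Z0) (tdim0 y Z0).
split=> [/(rinj0 gi) ->|[y ->]]; last by rewrite (tdim0 y Z0) !linear0.
by exists 0; rewrite linear0.
Qed.

Lemma aut0 Z : tdim Z = 0%N -> aut Z = 1%N.
Proof.
move=> Z0; apply/eqP; rewrite /aut; apply/cards1P; exists (rid Z).
apply/setP => f; rewrite !inE; apply/idP/eqP => [_|->].
  by apply/rhomP => v x; rewrite [LHS](tdim0 _ Z0) [RHS](tdim0 _ Z0).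
by apply/is_isoP; split=> v x; [move=> y; rewrite !ridE|exists x; rewrite ridE].
Qed.

Lemma xdim_zero : xdim o = 0%N.
Proof.
rewrite xdim_cls /tdim big1 // => v _; rewrite dimvf /dim /=.
by rewrite mul1n.
Qed.

Lemma xdim_eq0 (x : X) : (xdim x == 0%N) = (x == o).
Proof.
apply/eqP/eqP => [x0|->]; last exact: xdim_zero.
rewrite -(rreprK x); apply/cls_eqP/existsP; exists (rzero _ _); apply/is_isoP; split=> v.
  by move=> y z _; rewrite (tdim0 y x0) (tdim0 z x0).
move=> z; exists 0; rewrite linear0; apply: tdim0.
by have := xdim_zero; rewrite xdim_cls.
Qed.

Lemma card_isoset_cls (x y : X) :
  #|isoset (rrepr x) (rrepr y)| = ((x == y) * aut (rrepr x))%N.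
Proof.
rewrite card_isoset; have -> : isorep (rrepr x) (rrepr y) = (x == y).
  by apply/cls_eqP/eqP; rewrite !rreprK.
by case: eqP; rewrite ?mul1n.
Qed.

Let aut_neq0 (x : X) : (aut (rrepr x))%:R != 0 :> R.
Proof. by rewrite pnatr_eq0 -lt0n aut_gt0. Qed.

Lemma hall_mul_coef0l (y z : X) : hall_mul_coef R o y z = (z == y)%:R.
Proof.
rewrite /hall_mul_coef (hall_nb0l _ _ xdim_zero) (aut0 xdim_zero) mul1r card_isoset_cls.
by rewrite natrM mulfK // eq_sym.
Qed.

Lemma hall_mul_coef0r (x z : X) : hall_mul_coef R x o z = (z == x)%:R.
Proof.
rewrite /hall_mul_coef (hall_nb0r _ _ xdim_zero) (aut0 xdim_zero) mulr1.
by rewrite card_isosetC card_isoset_cls natrM mulfK // eq_sym.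
Qed.

Lemma hall_comul_coef0l (y z : X) : hall_comul_coef R o y z = (y == z)%:R.
Proof.
rewrite /hall_comul_coef (hall_nb0l _ _ xdim_zero) card_isosetC card_isoset_cls.
by rewrite natrM mulfK // eq_sym.
Qed.

Lemma hall_comul_coef0r (x z : X) : hall_comul_coef R x o z = (x == z)%:R.
Proof.
rewrite /hall_comul_coef (hall_nb0r _ _ xdim_zero) card_isoset_cls.
by rewrite natrM mulfK // eq_sym.
Qed.

Lemma sum_Xle_delta n (V : lmodType R) (f : X -> V) x : (xdim x <= n)%N ->
  \sum_(z <- Xle Q F n) (z == x)%:R *: f z = f x.
Proof.
move=> xn; rewrite (bigD1_seq x) ?Xle_uniq ?mem_Xle //= eqxx scale1r.
by rewrite big1 ?addr0 // => z /negPf ->; rewrite scale0r.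
Qed.

(** The sequence 0 -> 0 -> 0 -> 0 -> 0 is exact, whence [0] = [0] + [0]. *)
Lemma kcls0 : kcls o = 0 :> K0 Q F.
Proof.
have : hall_nb (rrepr o) (rrepr o) (rrepr o) != 0%N.
  by rewrite (hall_nb0l _ _ xdim_zero) card_isoset_cls eqxx mul1n -lt0n aut_gt0.
move=> /hall_nb_kcls E; apply: (addIr (kcls o : K0 Q F)).
by rewrite -E add0r.
Qed.

End HallZero.

(** * Monoid and comonoid structure *)

Section HallHopf.
Variables (Q : quiver) (F : finFieldType) (R : realType).
Local Notation X := (isocls Q F).
Local Notation H := (hall Q F R).
Local Notation e := (@hall_elt Q F R).
Local Notation K := (K0 Q F).
Local Notation o := (cls (zero_rep Q F)).
Local Notation cm := (@hall_mul_coef Q F R).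
Local Notation cd := (@hall_comul_coef Q F R).
Local Notation mul := (@hall_mul Q F R).
Local Notation comul := (@hall_comul Q F R).
Local Notation unit := (@hall_unit Q F R).
Local Notation counit := (@hall_counit Q F R).

Let ml : linear mul := @hall_mul_linear Q F R.
Let cl : linear comul := @hall_comul_linear Q F R.
Let ul : linear unit := @hall_unit_linear Q F R.
Let el : linear counit := @hall_counit_linear Q F R.
Let idl : linear (@id H) := @linear_id _ H.

Lemma scale_eql (V : lmodType R) (a b : R) (v : V) : a = b -> a *: v = b *: v.
Proof. by move=> ->. Qed.

Lemma scale_eqr (V : lmodType R) (a : R) (u v : V) : u = v -> a *: u = a *: v.
Proof. by move=> ->. Qed.

(** Two vectors need be compared only where the coefficient is nonzero; there the dimension of [z]
    is known and bounds the next product. *)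
Lemma mul_coef_scale (V : lmodType R) x y z (u v : V) :
  (xdim z = (xdim x + xdim y)%N -> u = v) -> cm x y z *: u = cm x y z *: v.
Proof.
move=> uv; have [c0|/hall_nb_dim/uv -> //] :=
  eqVneq (hall_nb (rrepr x) (rrepr y) (rrepr z)) 0%N.
by rewrite hall_mul_coef0 // !scale0r.
Qed.

Lemma hall_mulG : is_grmor mul.
Proof.
split=> // n t; move: t; suff fp : forall (d : K) (x y : X), kcls x + kcls y = d ->
    mul (tens (e x) (e y)) \in @gpart R K H d.
  move=> t /asboolP[s [-> sd]]; rewrite (lin_sum ml) big_seq; apply: gpart_sum.
  move=> [u v] /sd[n1 [n2 [<- /= /free_partP un /free_partP vn]]].
  rewrite [u]hallE tens_suml (lin_sum ml); apply: (@gpart_sum _ _ H) => x _.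
  rewrite tensZl (linZ ml); have [xn|xn] := eqVneq (kcls x) n1; last first.
    by rewrite un // scale0r; exact: (gpart_submod H _).1.
  apply: (@gpartZ _ _ H); rewrite [v]hallE tens_sumr (lin_sum ml); apply: (@gpart_sum _ _ H) => y _.
  rewrite tensZr (linZ ml); have [yn|yn] := eqVneq (kcls y) n2; last first.
    by rewrite vn // scale0r; exact: (gpart_submod H _).1.
  by apply: (@gpartZ _ _ H); apply: fp; rewrite xn yn.
move=> d x y <-; rewrite (hall_mulE R (leqnn _)); apply: gpart_sum => z _.
have [c0|/hall_nb_kcls <-] := eqVneq (hall_nb (rrepr x) (rrepr y) (rrepr z)) 0%N.
  by rewrite hall_mul_coef0 // scale0r; exact: (gpart_submod H _).1.
by apply: gpartZ; exact: hall_elt_part.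
Qed.

Lemma hall_comulG : is_grmor comul.
Proof.
apply: grmor_hall => // z; rewrite (hall_comulE R (leqnn _)).
apply: gpart_sum => x _; apply: gpart_sum => y _.
have [c0|/hall_nb_kcls ->] := eqVneq (hall_nb (rrepr x) (rrepr y) (rrepr z)) 0%N.
  by rewrite hall_comul_coef0 // scale0r; exact: (gpart_submod (gtens H H) _).1.
apply: gpartZ; rewrite [kcls x + _]addrC.
by apply: gtens_part_tens; exact: hall_elt_part.
Qed.

Lemma hall_unitG : is_grmor unit.
Proof.
split=> // n r rn; rewrite /hall_unit; have /orP[/eqP ->|/eqP ->] : (n == 0) || (r == 0).
- exact: rn.
- by apply: gpartZ; rewrite -(kcls0 Q F); exact: hall_elt_part.
- by rewrite scale0r; exact: (gpart_submod H _).1.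
Qed.

Lemma hall_counitG : is_grmor counit.
Proof.
apply: grmor_hall => // x; rewrite hall_counitE.
change ((kcls x == 0) || ((x == o)%:R == 0 :> R)).
by case: (x =P o) => [->|_]; rewrite ?kcls0 eqxx ?orbT.
Qed.

Lemma mul_suml I (s : seq I) (c : I -> R) (f : I -> H) (k : H) :
  mul (tens (\sum_(i <- s) c i *: f i) k) = \sum_(i <- s) c i *: mul (tens (f i) k).
Proof.
by rewrite tens_suml (lin_sum ml); apply: eq_bigr => i _; rewrite tensZl (linZ ml).
Qed.

Lemma mul_sumr I (s : seq I) (c : I -> R) (f : I -> H) (k : H) :
  mul (tens k (\sum_(i <- s) c i *: f i)) = \sum_(i <- s) c i *: mul (tens k (f i)).
Proof.
by rewrite tens_sumr (lin_sum ml); apply: eq_bigr => i _; rewrite tensZr (linZ ml).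
Qed.

Lemma hall_mul_assoc (t : gtens (gtens H H) H) :
  mul (gmap mul id t) = mul (gmap id mul (assoc t)).
Proof.
move: t; apply: hall_ext3.
- exact: (linear_comp ml (gmap_linear ml idl)).
- exact: (linear_comp ml (linear_comp (gmap_linear idl ml) (@assoc_linear _ _ _ _ _))).
move=> x y z; rewrite assocE (gmapE ml idl) (gmapE idl ml).
pose n := (xdim x + xdim y + xdim z)%N.
have xyn : (xdim x + xdim y <= n)%N by rewrite leq_addr.
have yzn : (xdim y + xdim z <= n)%N by rewrite /n -addnA leq_addl.
transitivity (\sum_(w <- Xle Q F n) \sum_(v <- Xle Q F n) (cm x y w * cm w z v) *: e v : H).
  rewrite [X in mul (tens X _)](hall_mulE R xyn) mul_suml; apply: eq_bigr => w _.
  under [RHS]eq_bigr do rewrite -scalerA.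
  rewrite -scaler_sumr; apply: mul_coef_scale => wE.
  by rewrite (hall_mulE R (n := n)) // wE.
transitivity (\sum_(w <- Xle Q F n) \sum_(v <- Xle Q F n)
    (cm y z w * cm x w v) *: e v : H); last first.
  rewrite [X in mul (tens _ X)](hall_mulE R yzn) mul_sumr; apply: eq_bigr => w _.
  under [LHS]eq_bigr do rewrite -scalerA.
  rewrite -scaler_sumr; apply: mul_coef_scale => wE.
  by rewrite (hall_mulE R (n := n)) // wE addnA.
rewrite [LHS]exchange_big [RHS]exchange_big.
apply: eq_big_seq => v; rewrite mem_Xle => vn /=.
rewrite -[LHS]scaler_suml -[RHS]scaler_suml.
apply: scale_eql.
(* The intermediate class [w] contributes 1/aut(w) exactly once; the automorphisms of x, y, z form a
   constant factor, leaving the count of flags. *)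
transitivity ((\sum_(w <- Xle Q F n) (hall_nb (rrepr x) (rrepr y) (rrepr w) *
    hall_nb (rrepr w) (rrepr z) (rrepr v))%:R / (aut (rrepr w))%:R) /
    ((aut (rrepr x))%:R * (aut (rrepr y))%:R * (aut (rrepr z))%:R : R)).
  by rewrite mulr_suml; apply: eq_bigr => w _; rewrite /hall_mul_coef natrM !invfM; ring.
rewrite hall_flag_count // mulr_suml; apply: eq_bigr => w _.
by rewrite /hall_mul_coef natrM !invfM; ring.
Qed.

Lemma hall_mul_unitl (t : gtens (gunit R K) H) : mul (gmap unit id t) = lunit t.
Proof.
move: t; apply: linear_tens_ext.
- exact: (linear_comp ml (gmap_linear ul idl)).
- exact: lunit_linear.
move=> r; apply: (hall_ext (f := fun h => mul (gmap unit id (tens r h)))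
  (g := fun h => lunit (tens (r : gunit R K) h))).
- have fl : linear (fun t => mul (gmap unit id t)) := linear_comp ml (gmap_linear ul idl).
  exact: (linear_comp fl (@tens_linearr _ _ (gunit R K) H r)).
- exact: (linear_comp (@lunit_linear _ _ _) (@tens_linearr _ _ (gunit R K) H r)).
move=> x; rewrite (gmapE ul idl) lunitE /hall_unit tensZl (linZ ml); apply: scale_eqr.
rewrite (hall_mulE R (n := xdim x)) ?xdim_zero //.
under eq_bigr do rewrite hall_mul_coef0l.
exact: sum_Xle_delta.
Qed.

Lemma hall_mul_unitr (t : gtens H (gunit R K)) : mul (gmap id unit t) = runit t.
Proof.
move: t; apply: linear_tens_ext.
- exact: (linear_comp ml (gmap_linear idl ul)).
- exact: runit_linear.
move=> h r; move: h; apply: (hall_ext (f := fun h => mul (gmap id unit (tens h r)))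
  (g := fun h => runit (tens h (r : gunit R K)))).
- have fl : linear (fun t => mul (gmap id unit t)) := linear_comp ml (gmap_linear idl ul).
  exact: (linear_comp fl (@tens_linearl _ _ H (gunit R K) r)).
- exact: (linear_comp (@runit_linear _ _ _) (@tens_linearl _ _ H (gunit R K) r)).
move=> x; rewrite (gmapE idl ul) runitE /hall_unit tensZr (linZ ml); apply: scale_eqr.
rewrite (hall_mulE R (n := xdim x)) ?xdim_zero ?addn0 //.
under eq_bigr do rewrite hall_mul_coef0r.
exact: sum_Xle_delta.
Qed.

Lemma hall_monoid : is_monoid mul unit.
Proof.
split; [exact: hall_mulG|exact: hall_unitG|exact: hall_mul_assoc|
  exact: hall_mul_unitl|exact: hall_mul_unitr].
Qed.

Lemma hall_comul_coassoc (a : H) :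
  assoc (gmap comul id (comul a)) = gmap id comul (comul a).
Proof.
move: a; apply: hall_ext.
- exact: (linear_comp (@assoc_linear _ _ _ _ _) (linear_comp (gmap_linear cl idl) cl)).
- exact: (linear_comp (gmap_linear idl cl) cl).
move=> z; pose n := xdim z; pose s := Xle Q F n.
have sn w : w \in s -> (xdim w <= n)%N by rewrite mem_Xle.
rewrite (hall_comulE R (leqnn (xdim z))) -/n -/s.
pose ta (t : gtens H H) := assoc (gmap comul id t).
pose tb (t : gtens H H) := gmap id comul t.
have tal : linear ta.
  exact: (linear_comp (@assoc_linear _ _ _ _ _) (gmap_linear cl idl)).
have tbl : linear tb by exact: gmap_linear.
rewrite -/(ta _) -/(tb _) !(lin_sum tal, lin_sum tbl).
pose t3 l m k : gtens H (gtens H H) := tens (e l) (tens (e m) (e k) : gtens H H).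
transitivity (\sum_(k <- s) \sum_(y <- s) \sum_(m <- s) \sum_(l <- s)
    (cd k y z * cd m l y) *: t3 l m k).
  rewrite big_seq [RHS]big_seq; apply: eq_bigr => k ks.
  rewrite (lin_sum tal) big_seq [RHS]big_seq; apply: eq_bigr => y ys.
  rewrite (linZ tal) /ta (gmapE cl idl) (hall_comulE R (sn y ys)) -/s.
  rewrite tens_suml (lin_sum (@assoc_linear _ _ _ _ _)) scaler_sumr.
  apply: eq_bigr => m _; rewrite tens_suml (lin_sum (@assoc_linear _ _ _ _ _)).
  rewrite scaler_sumr; apply: eq_bigr => l _.
  by rewrite tensZl (linZ (@assoc_linear _ _ _ _ _)) scalerA assocE.
transitivity (\sum_(x <- s) \sum_(l <- s) \sum_(k <- s) \sum_(m <- s)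
    (cd x l z * cd k m x) *: t3 l m k); last first.
  rewrite big_seq [RHS]big_seq; apply: eq_bigr => x xs.
  rewrite (lin_sum tbl); apply: eq_bigr => l _.
  rewrite (linZ tbl) /tb (gmapE idl cl) (hall_comulE R (sn x xs)) -/s.
  rewrite tens_sumr scaler_sumr; apply: eq_bigr => k _.
  rewrite tens_sumr scaler_sumr; apply: eq_bigr => m _.
  by rewrite tensZr scalerA.
transitivity (\sum_(k <- s) \sum_(m <- s) \sum_(l <- s)
    (\sum_(y <- s) cd k y z * cd m l y) *: t3 l m k).
  apply: eq_bigr => k _; rewrite exchange_big; apply: eq_bigr => m _.
  rewrite exchange_big; apply: eq_bigr => l _.
  by rewrite scaler_suml.
transitivity (\sum_(k <- s) \sum_(m <- s) \sum_(l <- s)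
    (\sum_(x <- s) cd x l z * cd k m x) *: t3 l m k); last first.
  rewrite -exchange_big22; apply: eq_bigr => k _; apply: eq_bigr => m _.
  by apply: eq_bigr => l _; rewrite scaler_suml.
apply: eq_bigr => k _; apply: eq_bigr => m _; apply: eq_bigr => l _.
apply: scale_eql.
(* The same flag count as for associativity, with 1/aut(z) as the constant factor and read in the
   opposite direction. *)
transitivity ((\sum_(y <- s) (hall_nb (rrepr m) (rrepr l) (rrepr y) *
    hall_nb (rrepr k) (rrepr y) (rrepr z))%:R / (aut (rrepr y))%:R) /
    (aut (rrepr z))%:R : R).
  by rewrite mulr_suml; apply: eq_bigr => w _; rewrite /hall_comul_coef natrM; ring.
rewrite -hall_flag_count // mulr_suml; apply: eq_bigr => w _.
by rewrite /hall_comul_coef natrM; ring.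
Qed.

Lemma hall_comul_unitl (a : H) : lunit (gmap counit id (comul a)) = a.
Proof.
have ll : linear (fun t : gtens H H => lunit (gmap counit id t)).
  exact: (linear_comp (@lunit_linear _ _ _) (gmap_linear el idl)).
move: a; apply: hall_ext => [||z]; first exact: (linear_comp ll cl).
  exact: idl.
rewrite (hall_comulE R (leqnn _)) (lin_sum ll).
under eq_bigr do rewrite (lin_sum ll).
rewrite -[RHS](sum_Xle_delta (V := H) (fun x => e x) (leqnn (xdim z))).
(* The Kronecker delta is turned back into the coefficient [cd x o z], and this into a sum over [y]
   that the counit concentrates at [o]. *)
apply: eq_bigr => x _; rewrite -(hall_comul_coef0r R x z).
rewrite -[RHS](sum_Xle_delta (V := H) (n := xdim z) (x := o)
  (fun y => cd x y z *: e x)) ?xdim_zero //.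
apply: eq_bigr => y _; rewrite (linZ ll) (gmapE el idl) lunitE hall_counitE.
by rewrite !scalerA mulrC.
Qed.

Lemma hall_comul_unitr (a : H) : runit (gmap id counit (comul a)) = a.
Proof.
have ll : linear (fun t : gtens H H => runit (gmap id counit t)).
  exact: (linear_comp (@runit_linear _ _ _) (gmap_linear idl el)).
move: a; apply: hall_ext => [||z]; first exact: (linear_comp ll cl).
  exact: idl.
rewrite (hall_comulE R (leqnn _)) exchange_big (lin_sum ll).
under eq_bigr do rewrite (lin_sum ll).
rewrite -[RHS](sum_Xle_delta (V := H) (fun x => e x) (leqnn (xdim z))).
apply: eq_bigr => x _; rewrite -(hall_comul_coef0l R x z).
rewrite -[RHS](sum_Xle_delta (V := H) (n := xdim z) (x := o)
  (fun y => cd y x z *: e x)) ?xdim_zero //.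
apply: eq_bigr => y _; rewrite (linZ ll) (gmapE idl el) runitE hall_counitE.
by rewrite !scalerA mulrC.
Qed.

Lemma hall_comonoid : is_comonoid comul counit.
Proof.
split; [exact: hall_comulG|exact: hall_counitG|exact: hall_comul_coassoc|
  exact: hall_comul_unitl|exact: hall_comul_unitr].
Qed.

End HallHopf.

(** * Compatibility of product and coproduct, and the antipode *)

Section HallBialgebra.
Variables (Q : quiver) (F : finFieldType) (R : realType).
Local Notation X := (isocls Q F).
Local Notation H := (hall Q F R).
Local Notation e := (@hall_elt Q F R).
Local Notation K := (K0 Q F).
Local Notation o := (cls (zero_rep Q F)).
Local Notation cm := (@hall_mul_coef Q F R).
Local Notation cd := (@hall_comul_coef Q F R).
Local Notation mul := (@hall_mul Q F R).
Local Notation comul := (@hall_comul Q F R).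
Local Notation unit := (@hall_unit Q F R).
Local Notation counit := (@hall_counit Q F R).
Variable chi : K -> K -> int.
Hypothesis chiE : forall x y : X, chi (kcls x) (kcls y) =
  (\sum_v \dim {:obj (rrepr x) v} * \dim {:obj (rrepr y) v})%N%:Z -
  (\sum_e \dim {:obj (rrepr x) (src e)} * \dim {:obj (rrepr y) (tgt e)})%N%:Z.
Local Notation q := (#|F|%:R : R).
Local Notation mul2 := (@mul2 R K q chi H mul).

Let ml : linear mul := @hall_mul_linear Q F R.
Let cl : linear comul := @hall_comul_linear Q F R.
Let ul : linear unit := @hall_unit_linear Q F R.
Let el : linear counit := @hall_counit_linear Q F R.
Let idl : linear (@id H) := @linear_id _ H.

(** The negated exponent puts the sum over the edges in the numerator and the sum over the vertices
    in the denominator. *)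
Lemma euler_weightE (x y : X) :
  q ^ (- chi (kcls x) (kcls y)) = euler_weight R (rrepr x) (rrepr y).
Proof.
have q0 : q != 0 by rewrite pnatr_eq0 -lt0n; apply/card_gt0P; exists 0.
by rewrite chiE opprB expfzDr // -exprnN -exprnP /euler_weight !natrX.
Qed.

Definition mid_step (s : gtens H (gtens H H)) : gtens H (gtens H H) :=
  assoc (gmap (@braid R K q chi H H) id (assoc_inv s)).

Lemma mid_step_linear : linear mid_step.
Proof.
have bl := @braid_linear R K q chi H H.
exact: (linear_comp (@assoc_linear _ _ _ _ _)
  (linear_comp (gmap_linear bl idl) (@assoc_inv_linear _ _ _ _ _))).
Qed.

Lemma mid_braid_linear : linear (@mid_braid R K q chi H).
Proof.
exact: (linear_comp (@assoc_inv_linear _ _ _ _ _)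
  (linear_comp (gmap_linear idl mid_step_linear) (@assoc_linear _ _ _ _ _))).
Qed.

Lemma mid_braidE (a b c d : H) n m : b \in @gpart R K H n -> c \in @gpart R K H m ->
  @mid_braid R K q chi H (tens (tens a b : gtens H H) (tens c d : gtens H H)) =
  q ^ (- chi n m) *: tens (tens a c : gtens H H) (tens b d : gtens H H).
Proof.
move=> bn cn; rewrite /mid_braid assocE (gmapE idl mid_step_linear).
have -> : mid_step (tens b (tens c d : gtens H H)) =
    q ^ (- chi n m) *: tens c (tens b d : gtens H H).
  rewrite /mid_step assoc_invE (gmapE (@braid_linear R K q chi H H) idl).
  by rewrite (braidE q chi bn cn) tensZl (linZ (@assoc_linear _ _ _ _ _)) assocE.
by rewrite tensZr (linZ (@assoc_inv_linear _ _ _ _ _)) assoc_invE.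
Qed.

Lemma mul2_linear : linear mul2.
Proof. exact: (linear_comp (gmap_linear ml ml) mid_braid_linear). Qed.

Lemma mul2E (a b c d : X) :
  mul2 (tens (tens (e a) (e b) : gtens H H) (tens (e c) (e d) : gtens H H)) =
  euler_weight R (rrepr b) (rrepr c) *:
    (tens (mul (tens (e a) (e c))) (mul (tens (e b) (e d))) : gtens H H).
Proof.
rewrite /Defs.mul2 (mid_braidE _ _ (hall_elt_part R b) (hall_elt_part R c)).
by rewrite (linZ (gmap_linear ml ml)) (gmapE ml ml) euler_weightE.
Qed.

(** Green's formula divided by aut(x) aut(y). The automorphism factors of the four corners are
    exactly the denominators of the two multiplication coefficients on the right. *)
Lemma hall_green n (x y u v : X) : (xdim x + xdim y <= n)%N ->
  \sum_(z <- Xle Q F n) cm x y z * cd u v z =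
  \sum_(a <- Xle Q F n) \sum_(b <- Xle Q F n)
  \sum_(c <- Xle Q F n) \sum_(d <- Xle Q F n)
    cd a b x * cd c d y * euler_weight R (rrepr a) (rrepr d) *
    (cm b d v * cm a c u).
Proof.
move=> xyn; transitivity ((\sum_(z <- Xle Q F n) (hall_nb (rrepr x) (rrepr y) (rrepr z) *
    hall_nb (rrepr u) (rrepr v) (rrepr z))%:R / (aut (rrepr z))%:R) /
    ((aut (rrepr x))%:R * (aut (rrepr y))%:R) : R).
  rewrite mulr_suml; apply: eq_bigr => z _.
  by rewrite /hall_mul_coef /hall_comul_coef natrM invfM; ring.
rewrite green_formula; last by rewrite addnC.
do 4!(rewrite mulr_suml; apply: eq_bigr => ? _).
by rewrite /hall_mul_coef /hall_comul_coef !invfM; ring.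
Qed.

Lemma hall_comul_mul (t : gtens H H) : comul (mul t) = mul2 (gmap comul comul t).
Proof.
move: t; apply: hall_ext2; first exact: (linear_comp cl ml).
  exact: (linear_comp mul2_linear (gmap_linear cl cl)).
move=> x y; pose n := (xdim x + xdim y)%N; pose s := Xle Q F n.
have sn w : w \in s -> (xdim w <= n)%N by rewrite mem_Xle.
pose t2 v u : gtens H H := tens (e v) (e u).
transitivity (\sum_(u <- s) \sum_(v <- s) (\sum_(z <- s) cm x y z * cd u v z) *: t2 v u).
  rewrite (hall_mulE R (leqnn (xdim x + xdim y))) (lin_sum cl).
  transitivity (\sum_(z <- s) \sum_(u <- s) \sum_(v <- s) (cm x y z * cd u v z) *: t2 v u).
    apply: eq_big_seq => z zs; rewrite (linZ cl) (hall_comulE R (sn z zs)) scaler_sumr.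
    apply: eq_bigr => u _; rewrite scaler_sumr; apply: eq_bigr => v _.
    by rewrite scalerA.
  rewrite exchange_big; apply: eq_bigr => u _; rewrite exchange_big.
  by apply: eq_bigr => v _; rewrite scaler_suml.
rewrite (gmapE cl cl).
have xn : (xdim x <= n)%N by exact: leq_addr.
have yn : (xdim y <= n)%N by exact: leq_addl.
rewrite [X in mul2 (tens X _)](hall_comulE R xn) [X in mul2 (tens _ X)](hall_comulE R yn).
(* The factors stand in the order b, a, d, c, so the braiding acts on the quotient [a] of [x] and
   the subobject [d] of [y]. *)
transitivity (\sum_(a <- s) \sum_(b <- s) \sum_(c <- s) \sum_(d <- s)
   (cd a b x * cd c d y) *:
    mul2 (tens (tens (e b) (e a) : gtens H H) (tens (e d) (e c) : gtens H H))); last first.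
  rewrite tens_suml (lin_sum mul2_linear); apply: eq_bigr => a _.
  rewrite tens_suml (lin_sum mul2_linear); apply: eq_bigr => b _.
  rewrite tens_sumr (lin_sum mul2_linear); apply: eq_bigr => c _.
  rewrite tens_sumr (lin_sum mul2_linear); apply: eq_bigr => d _.
  by rewrite tensZl tensZr !(linZ mul2_linear) scalerA.
transitivity (\sum_(a <- s) \sum_(b <- s) \sum_(c <- s) \sum_(d <- s)
   \sum_(u <- s) \sum_(v <- s) (cd a b x * cd c d y *
     euler_weight R (rrepr a) (rrepr d) * (cm b d v * cm a c u)) *: t2 v u); last first.
  apply: eq_bigr => a _; apply: eq_bigr => b _; apply: eq_bigr => c _.
  apply: eq_bigr => d _; rewrite mul2E scalerA.
  set C := _ * euler_weight _ _ _.
  (* The range [s] is large enough for the products of the corners only if a, b make up [x] and c, d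
     make up [y]; in all other cases [C] is zero. *)
  have zero : C = 0 -> \sum_(u <- s) \sum_(v <- s) (C * (cm b d v * cm a c u)) *: t2 v u =
      C *: (tens (mul (tens (e b) (e d))) (mul (tens (e a) (e c))) : gtens H H).
    move=> ->; rewrite scale0r big1 // => u _; rewrite big1 // => v _.
    by rewrite mul0r scale0r.
  have [c0|/hall_nb_dim xE] := eqVneq (hall_nb (rrepr a) (rrepr b) (rrepr x)) 0%N.
    by apply: zero; rewrite /C hall_comul_coef0 // !mul0r.
  have [c0|/hall_nb_dim yE] := eqVneq (hall_nb (rrepr c) (rrepr d) (rrepr y)) 0%N.
    by apply: zero; rewrite /C (hall_comul_coef0 R c0) mulr0 mul0r.
  have bdn : (xdim b + xdim d <= n)%N by rewrite /n xE yE leq_add ?leq_addl.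
  have acn : (xdim a + xdim c <= n)%N by rewrite /n xE yE leq_add ?leq_addr.
  rewrite [X in _ *: tens X _](hall_mulE R bdn) [X in _ *: tens _ X](hall_mulE R acn).
  rewrite tens_sumr scaler_sumr; apply: eq_bigr => u _.
  rewrite tens_suml scaler_sumr; apply: eq_bigr => v _.
  by rewrite tensZl tensZr !scalerA mulrA.
transitivity (\sum_(u <- s) \sum_(v <- s) (\sum_(a <- s) \sum_(b <- s)
   \sum_(c <- s) \sum_(d <- s) cd a b x * cd c d y *
     euler_weight R (rrepr a) (rrepr d) * (cm b d v * cm a c u)) *: t2 v u).
  apply: eq_bigr => u _; apply: eq_bigr => v _.
  by rewrite (hall_green u v (leqnn (xdim x + xdim y))).
exact: (exchange_scaler_suml24 s (fun a b c d u v => cd a b x * cd c d y *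
  euler_weight R (rrepr a) (rrepr d) * (cm b d v * cm a c u)) (fun u v => t2 v u)).
Qed.

Lemma hall_comul_unit r : comul (unit r) = unit2 unit r.
Proof.
rewrite /hall_unit (linZ cl) (hall_comulE R (n := 0)) ?xdim_zero //.
rewrite /unit2 (gmapE ul ul) /hall_unit scale1r tensZl; apply: scale_eqr.
have o0 : (xdim o <= 0)%N by rewrite xdim_zero.
rewrite -[RHS](sum_Xle_delta (V := gtens H H) (fun x => tens (e o) (e x)) o0).
apply: eq_bigr => x _; rewrite -(hall_comul_coef0r R x o).
rewrite -[RHS](sum_Xle_delta (V := gtens H H)
  (fun y => cd x y o *: (tens (e y) (e x) : gtens H H)) o0).
apply: eq_big_seq => y; rewrite mem_Xle leqn0 xdim_eq0 => /eqP ->.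
by rewrite eqxx scale1r.
Qed.

(** An extension is zero only if both outer terms are, since dimensions add up. *)
Lemma hall_counit_mul (t : gtens H H) :
  counit (mul t) = lunit (gmap counit counit t).
Proof.
move: t; apply: hall_ext2; first exact: (linear_comp el ml).
  exact: (linear_comp (@lunit_linear _ _ _) (gmap_linear el el)).
move=> x y; transitivity ((x == o)%:R *: (y == o)%:R : R^o); last first.
  by rewrite (gmapE el el) -(hall_counitE R x) -(hall_counitE R y) (lunitE (V := gunit R K)).
rewrite (hall_mulE R (leqnn (xdim x + xdim y))) (lin_sum el).
have o0 : (xdim o <= xdim x + xdim y)%N by rewrite xdim_zero.
transitivity (cm x y o).
  rewrite -[RHS](sum_Xle_delta (V := R^o) (fun z => cm x y z) o0).
  apply: eq_bigr => z _; rewrite (linZ el) hall_counitE.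
  exact: mulrC.
have [c0|/hall_nb_dim] := eqVneq (hall_nb (rrepr x) (rrepr y) (rrepr o)) 0%N.
  rewrite hall_mul_coef0 //; have [x0|] := eqVneq x o; last by rewrite scale0r.
  have [y0|] := eqVneq y o; last by rewrite scaler0.
  (* For x = y = o the unit law gives the coefficient 1, so a vanishing count would identify 1 with
     0. *)
  have := hall_mul_coef0l R y o; rewrite -{1}x0 hall_mul_coef0 // y0 eqxx.
  by move=> <-; rewrite scaler0.
rewrite xdim_zero => /esym/eqP; rewrite addn_eq0 !xdim_eq0 => /andP[/eqP -> /eqP ->].
by rewrite hall_mul_coef0l eqxx scale1r.
Qed.

Lemma hall_counit_unit r : counit (unit r) = r.
Proof. by rewrite /hall_unit (linZ el) hall_counitE eqxx; exact: mulr1. Qed.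

Lemma hall_bialgebra : is_bialgebra q chi mul unit comul counit.
Proof.
split; [exact: hall_monoid|exact: hall_comonoid|split|split].
- exact: hall_comul_mul.
- exact: hall_comul_unit.
- exact: hall_counit_mul.
- exact: hall_counit_unit.
Qed.

Local Notation augp := (aug_pow mul unit comul counit).

Lemma hall_aug_elt x : aug unit counit (e x) = (x != o)%:R *: e x.
Proof.
rewrite /aug hall_counitE /hall_unit; case: eqP => [->|_].
  by rewrite scale1r scale0r subrr.
by rewrite scale0r subr0 scale1r.
Qed.

Lemma hall_aug_pow_elt k (z : X) : (xdim z < k)%N -> augp k (e z) = 0.
Proof.
have al := (augG (hall_monoid Q F R) (hall_comonoid Q F R)).1.
elim: k z => [//|k IH] z zk; rewrite /= /conv.
have pl := (aug_powG (hall_monoid Q F R) (hall_comonoid Q F R) k).1.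
have gl := gmap_linear al pl.
rewrite (hall_comulE R (leqnn (xdim z))) (lin_sum gl) (lin_sum ml) big1 // => x _.
rewrite (lin_sum gl) (lin_sum ml) big1 // => y _; rewrite (linZ gl) (linZ ml) (gmapE al pl).
have [c0|/hall_nb_dim zE] := eqVneq (hall_nb (rrepr x) (rrepr y) (rrepr z)) 0%N.
  by rewrite hall_comul_coef0 // scale0r.
rewrite hall_aug_elt; have [->|yo] := eqVneq y o; first by rewrite scale0r tens0l (lin0 ml) scaler0.
(* The factor [y] is nonzero and takes at least one dimension, so the other factor [x] has dimension
   below [k]. *)
rewrite IH ?tens0r ?(lin0 ml) ?scaler0 // -(ltn_add2r (xdim y)) -zE.
apply: leq_trans zk _; rewrite -addn1 leq_add2l lt0n.
by rewrite xdim_eq0.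
Qed.

Lemma hall_aug_nil (h : H) : exists n, forall k, (n <= k)%N -> augp k h = 0.
Proof.
exists (\max_(x <- msupp (h : {malg R[X]})) xdim x).+1 => k nk.
have pl := (aug_powG (hall_monoid Q F R) (hall_comonoid Q F R) k).1.
rewrite [h]hallE (lin_sum pl) big_seq big1 // => x xh.
rewrite (linZ pl) hall_aug_pow_elt ?scaler0 //; apply: leq_trans nk.
exact: (@leq_bigmax_seq _ _ xpredT (@xdim Q F) x xh isT).
Qed.

Lemma hall_hopf : is_hopf q chi mul unit comul counit.
Proof.
split; first exact: hall_bialgebra.
exists (antipode hall_aug_nil); exact: antipodeP (hall_monoid Q F R) (hall_comonoid Q F R) _.
Qed.

End HallBialgebra.

(** * The Euler form *)

Import VectorInternalTheory.

Section FamilySpace.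
Variables (F : fieldType) (I : finType) (U : I -> vectType F).

(* Coordinates turn the product of the U i into a vectType. *)
Definition family_space : vectType F := {ffun {i : I & 'I_(dim (U i))} -> F^o}.

Definition family_get (g : family_space) i : U i :=
  r2v (\row_j g (Tagged (fun i => 'I_(dim (U i))) j)).
Definition family_mk (f : forall i, U i) : family_space :=
  [ffun t => v2r (f (tag t)) 0 (tagged t)].

Lemma family_mkK f i : family_get (family_mk f) i = f i.
Proof.
rewrite /family_get; apply: (canLR v2rK); apply/rowP => j.
by rewrite mxE ffunE.
Qed.

Lemma family_getK g : family_mk (family_get g) = g.
Proof.
apply/ffunP => -[i j]; rewrite ffunE /= /family_get r2vK mxE.
by [].
Qed.

Lemma family_get_linear i : linear (family_get^~ i).
Proof.
move=> a g h /=; rewrite /family_get.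
by rewrite -linearP; congr r2v; apply/rowP => j; rewrite !mxE !ffunE.
Qed.

Lemma family_mk_linear a f g :
  family_mk (fun i => a *: f i + g i) = a *: family_mk f + family_mk g.
Proof. by apply/ffunP => t; rewrite !ffunE linearP !mxE. Qed.

Lemma dim_family_space : dim family_space = (\sum_i dim (U i))%N.
Proof.
rewrite -[LHS]/(#|{: {i : I & 'I_(dim (U i))}}| * 1)%N muln1 card_tagged sumnE big_map.
by rewrite big_enum; apply: eq_bigr => i _; rewrite card_ord.
Qed.

End FamilySpace.

Lemma linear_lfun (F : fieldType) (U V : vectType F) (f : U -> V) : linear f ->
  exists h : 'Hom(U, V), forall x, h x = f x.
Proof.
move=> fl; pose g : {linear U -> V} := HB.pack f (GRing.isLinear.Build F U V _ f fl).
by exists (linfun g) => x; rewrite lfunE.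
Qed.

Lemma rhom_exists (Q : quiver) (F : finFieldType) (M N : rep Q F)
    (f : forall v, 'Hom(obj M v, obj N v)) :
  (forall e x, f (tgt e) (arr M e x) = arr N e (f (src e) x)) ->
  exists g : rhom M N, forall v x, g v x = f v x.
Proof. by move=> fn; exists (mk_rhom fn) => v x; rewrite mk_rhomE. Qed.

Lemma rscaleE (Q : quiver) (F : finFieldType) a (M : rep Q F) v x :
  rscale a M v x = a *: x.
Proof. by rewrite mk_rhomE scale_lfunE id_lfunE. Qed.

Lemma rdiagE (Q : quiver) (F : finFieldType) (M : rep Q F) v x :
  rdiag M v x = (x, x).
Proof. by rewrite mk_rhomE lfunE. Qed.

Lemma rfoldE (Q : quiver) (F : finFieldType) (M : rep Q F) v p :
  rfold M v p = p.1 + p.2.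
Proof. by rewrite mk_rhomE lfunE. Qed.

(** * Hom and Ext^1 as kernel and cokernel *)

Section ExtGroup.
Variables (Q : quiver) (F : finFieldType).
Variables M N : rep Q F.

Let U0 v : vectType F := 'Hom(obj M v, obj N v).
Let U1 e : vectType F := 'Hom(obj M (src e), obj N (tgt e)).
Let H0 := family_space U0.
Let H1 := family_space U1.

(** The differential of the standard two-term complex: it vanishes exactly when [g] is a morphism,
    and it is the change in the block of an extension when the splitting is moved by [g]. *)
Definition ringel_coboundary (g : H0) e : 'Hom(obj M (src e), obj N (tgt e)) :=
  (family_get g (tgt e) \o arr M e)%VF - (arr N e \o family_get g (src e))%VF.

Lemma ringel_coboundary_linear a g h e :
  ringel_coboundary (a *: g + h) e = a *: ringel_coboundary g e + ringel_coboundary h e.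
Proof.
apply/lfunP => x; rewrite /ringel_coboundary !(add_lfunE, scale_lfunE, opp_lfunE, comp_lfunE).
rewrite !family_get_linear !(add_lfunE, scale_lfunE) linearP.
by rewrite scalerBr opprD addrACA.
Qed.

Lemma ringel_map_exists : exists D : 'Hom(H0, H1),
  forall g e, family_get (D g) e = ringel_coboundary g e.
Proof.
have Dl : linear (fun g : H0 => family_mk (ringel_coboundary g) : H1).
  move=> a g h; rewrite -family_mk_linear; congr family_mk.
  apply: functional_extensionality_dep => e; exact: ringel_coboundary_linear.
by have [D DE] := linear_lfun Dl; exists D => g e; rewrite DE family_mkK.
Qed.

Definition glue_ext (c : forall e, 'Hom(obj M (src e), obj N (tgt e))) : ext M N :=
  Ext (glue_exact c).

(** The equivalence is the unipotent matrix with off-diagonal entry [u]. *)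
Lemma glue_ext_equiv (c c' : forall e, 'Hom(obj M (src e), obj N (tgt e)))
    (u : forall v, 'Hom(obj M v, obj N v)) :
  (forall e m, c' e m = c e m + u (tgt e) (arr M e m) - arr N e (u (src e) m)) ->
  ext_equiv (glue_ext c) (glue_ext c').
Proof.
move=> cc'; pose b v : 'Hom(obj (glued c) v, obj (glued c') v) :=
  hpair (hcop \1%VF (u v)) (hcop 0 \1%VF).
have bE v n m : b v (n, m) = (n + u v m, m).
  by rewrite hpairE !hcopE !id_lfunE zero_lfunE add0r.
have bn e x : b (tgt e) (arr (glued c) e x) = arr (glued c') e (b (src e) x).
  case: x => n m; rewrite glue_arrE !bE glue_arrE cc' linearD /=; congr (_, _).
  by rewrite -[LHS]addrA [LHS]addrC [RHS]addrC [in RHS](addrC (arr N e n)) [RHS]addrA subrK.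
have [be beE] := rhom_exists (M := glued c) (N := glued c') bn.
exists be; split; apply/rhomP => v x.
  by rewrite !rcompE ridE !glue_inE beE bE linear0 addr0.
by case: x => n m; rewrite !rcompE ridE beE bE !glue_outE.
Qed.

(** An equivalence is the identity on N and induces the identity on M, so it is unipotent; [u] is
    its off-diagonal entry. *)
Lemma glue_ext_equivV (c c' : forall e, 'Hom(obj M (src e), obj N (tgt e))) :
  ext_equiv (glue_ext c) (glue_ext c') ->
  exists u : forall v, 'Hom(obj M v, obj N v),
    forall e m, c' e m = c e m + u (tgt e) (arr M e m) - arr N e (u (src e) m).
Proof.
move=> [b [/rhomP b1 /rhomP b2]].
have bn v n : b v (n, 0) = (n, 0).
  by have := b1 v n; rewrite !rcompE ridE !glue_inE.
pose u v : 'Hom(obj M v, obj N v) := (hcop \1%VF 0 \o b v \o hpair 0 \1%VF)%VF.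
have uE v m : u v m = (b v (0, m)).1.
  by rewrite 2!comp_lfunE hpairE hcopE !id_lfunE !zero_lfunE addr0.
have bm v m : b v (0, m) = (u v m, m).
  have := b2 v (0, m); rewrite !rcompE ridE glue_outE uE.
  by case: (b v (0, m)) => n' m'; rewrite glue_outE => ->.
have bE v n m : b v (n, m) = (n + u v m, m).
  have -> : (n, m) = (n, 0) + (0, m) :> obj (glued c) v by congr (_, _); rewrite ?addr0 ?add0r.
  rewrite linearD /= bn bm; congr (_, _); exact: add0r.
exists u => e m; have := @rhomE _ _ (glued c) (glued c') b e (0, m).
rewrite glue_arrE bm glue_arrE bE linear0 add0r => -[->].
by rewrite addrC addKr.
Qed.

(** A vertexwise linear section of the projection identifies the middle term with N (+) M; the block
    is the failure of that section to be a morphism. *)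
Lemma glue_ext_surj (xi : ext M N) : exists c, ext_equiv (glue_ext c) xi.
Proof.
case: xi => E f g fg; have /short_exactE[fi ex gs] := fg.
pose s v : 'Hom(obj M v, obj E v) := ((g v)^-1)%VF.
have sK v m : g v (s v m) = m by exact: lfun_surj_invK.
pose c e : 'Hom(obj M (src e), obj N (tgt e)) := (((f (tgt e))^-1) \o
  ((arr E e \o s (src e))%VF - (s (tgt e) \o arr M e)%VF))%VF.
have cE e m : f _ (c e m) = arr E e (s _ m) - s _ (arr M e m).
  rewrite /c comp_lfunE add_lfunE opp_lfunE !comp_lfunE lfun_img_invK //.
  by apply/ex; rewrite linearB /= (rhomE g) !sK subrr.
pose b v : 'Hom(obj (glued c) v, obj E v) := hcop (f v) (s v).
have bE v n m : b v (n, m) = f v n + s v m by rewrite /b hcopE.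
have bn e x : b (tgt e) (arr (glued c) e x) = arr E e (b (src e) x).
  by case: x => n m; rewrite glue_arrE !bE !linearD /= cE rhomE -addrA subrK.
have [be beE] := rhom_exists (M := glued c) (N := E) bn.
exists c, be; split; apply/rhomP => v x.
  by rewrite !rcompE ridE glue_inE beE bE linear0 addr0.
by case: x => n m; rewrite !rcompE ridE beE bE glue_outE linearD /= sK (rexact0 _ ex) add0r.
Qed.

Lemma glue_ext_scale a (c : forall e, 'Hom(obj M (src e), obj N (tgt e))) :
  ext_map (rscale a N) (rid M) (glue_ext c) (glue_ext (fun e => a *: c e)).
Proof.
pose b v : 'Hom(obj (glued c) v, obj (glued (fun e => a *: c e)) v) :=
  hpair (hcop (a *: \1%VF) 0) (hcop 0 \1%VF).
have bE v n m : b v (n, m) = (a *: n, m).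
  by rewrite hpairE !hcopE scale_lfunE !id_lfunE !zero_lfunE add0r addr0.
have bn e x : b (tgt e) (arr (glued c) e x) = arr (glued (fun e => a *: c e)) e (b (src e) x).
  by case: x => n m; rewrite glue_arrE !bE glue_arrE scale_lfunE linearZ scalerDr.
have [be beE] := rhom_exists (M := glued c) (N := glued (fun e => a *: c e)) bn.
exists be; split; apply/rhomP => v x.
  by rewrite !rcompE rscaleE !glue_inE beE bE.
by case: x => n m; rewrite !rcompE ridE beE bE !glue_outE.
Qed.

Lemma glue_ext_baer (c c' : forall e, 'Hom(obj M (src e), obj N (tgt e))) :
  baer_sum (glue_ext c) (glue_ext c') (glue_ext (fun e => c e + c' e)).
Proof.
pose cc e : 'Hom(obj M (src e), obj (dsum N N) (tgt e)) := hpair (c e) (c' e).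
have ccE e m : cc e m = (c e m, c' e m) by rewrite /cc hpairE.
exists (Ext (glue_exact cc)); split.
  (* The witness [zeta] has the block (c, c') with values in N (+) N; pulling back along the
     diagonal duplicates the component in M. *)
  pose b v : 'Hom(obj (glued cc) v, obj (dsum (glued c) (glued c')) v) :=
    hpair (hpair (hcop (hcop \1%VF 0) 0) (hcop 0 \1%VF))
          (hpair (hcop (hcop 0 \1%VF) 0) (hcop 0 \1%VF)).
  have bE v n n' m : b v ((n, n'), m) = ((n, m), (n', m)).
    by rewrite /b !hpairE !(hcopE, id_lfunE, zero_lfunE, addr0, add0r).
  have bn e x : b (tgt e) (arr (glued cc) e x) =
      arr (dsum (glued c) (glued c')) e (b (src e) x).
    case: x => -[n n'] m; rewrite bE dsum_arrE [arr (glued cc) e _]glue_arrE.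
    by rewrite [arr (dsum N N) e _]dsum_arrE ccE [LHS]bE !glue_arrE.
  have [be beE] := rhom_exists (M := glued cc) (N := dsum (glued c) (glued c')) bn.
  exists be; split; apply/rhomP => v x.
    rewrite [LHS]rcompE [RHS]rcompE beE ridE [ein _]/= glue_inE rdsumE.
    by case: x => n n'; rewrite bE !glue_inE.
  case: x => -[n n'] m; rewrite [LHS]rcompE [RHS]rcompE beE bE.
  by rewrite [LHS]rdsumE rdiagE !glue_outE.
(* Pushing out along the fold map adds the two components in N, and with them the two blocks. *)
pose b v : 'Hom(obj (glued cc) v, obj (glued (fun e => c e + c' e)) v) :=
  hpair (hcop (hcop \1%VF \1%VF) 0) (hcop 0 \1%VF).
have bE v n n' m : b v ((n, n'), m) = (n + n', m).
  by rewrite /b !hpairE !(hcopE, id_lfunE, zero_lfunE, addr0, add0r).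
have bn e x : b (tgt e) (arr (glued cc) e x) =
    arr (glued (fun e => c e + c' e)) e (b (src e) x).
  case: x => -[n n'] m; rewrite bE [arr (glued cc) e _]glue_arrE.
  rewrite [arr (dsum N N) e _]dsum_arrE ccE [LHS]bE glue_arrE.
  by rewrite add_lfunE linearD /= addrACA.
have [be beE] := rhom_exists (M := glued cc) (N := glued (fun e => c e + c' e)) bn.
exists be; split; apply/rhomP => v x.
  rewrite [LHS]rcompE [RHS]rcompE beE [ein _]/= glue_inE.
  by case: x => n n'; rewrite bE glue_inE rfoldE.
case: x => -[n n'] m; rewrite [LHS]rcompE [RHS]rcompE beE bE ridE.
by rewrite !glue_outE.
Qed.

Lemma hom_ext_dim : exists h x : nat, [/\ hom_dim M N h, ext_dim M N x
  & h%:Z - x%:Z = (\sum_v \dim {:obj M v} * \dim {:obj N v})%N%:Z -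
      (\sum_e \dim {:obj M (src e)} * \dim {:obj N (tgt e)})%N%:Z].
Proof.
have [D DE] := ringel_map_exists.
have DE' g e m : family_get (D g) e m =
    family_get g (tgt e) (arr M e m) - arr N e (family_get g (src e) m).
  by rewrite DE /ringel_coboundary add_lfunE opp_lfunE !comp_lfunE.
exists (\dim (lker D)), (\dim (limg D)^C); split.
- pose psi (r : 'rV[F]_(\dim (lker D))) : subvs_of (lker D) := @r2v F (subvs_of (lker D)) r.
  have nat r e x : family_get (vsval (psi r)) (tgt e) (arr M e x) =
      arr N e (family_get (vsval (psi r)) (src e) x).
    have /eqP D0 : D (vsval (psi r)) == 0 by rewrite -memv_ker subvsP.
    have := DE' (vsval (psi r)) e x; rewrite D0 (lin0 (family_get_linear _)).
    by rewrite zero_lfunE => /esym/eqP; rewrite subr_eq0 => /eqP.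
  exists (fun r => mk_rhom (nat r)); split; last first.
    move=> a u w v x; rewrite !mk_rhomE /psi linearP /=.
    by rewrite family_get_linear add_lfunE scale_lfunE.
  pose inv (f : rhom M N) : 'rV[F]_(\dim (lker D)) :=
    @v2r F (subvs_of (lker D)) (vsproj (lker D) (family_mk (fun v => f v) : H0)).
  exists inv => [r|f].
    rewrite /inv; have -> : family_mk (fun v => mk_rhom (nat r) v) = vsval (psi r) :> H0.
      rewrite -[RHS]family_getK; congr family_mk.
      by apply: functional_extensionality_dep => v; rewrite ffunE.
    by rewrite vsvalK; exact: (@r2vK F (subvs_of (lker D))).
  apply/rhomP => v x; rewrite mk_rhomE /psi /inv v2rK vsprojK.
    by rewrite family_mkK.
  rewrite memv_ker; apply/eqP; rewrite -[LHS]family_getK -[RHS]family_getK.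
  congr family_mk; apply: functional_extensionality_dep => e; apply/lfunP => y.
  rewrite DE' !family_mkK rhomE subrr (lin0 (family_get_linear _)).
  by rewrite zero_lfunE.
- pose C := ((limg D)^C)%VS.
  pose psi (r : 'rV[F]_(\dim C)) : subvs_of C := @r2v F (subvs_of C) r.
  exists (fun r => glue_ext (family_get (vsval (psi r)))); split.
  (* The block of any extension splits into a coboundary, removed by an equivalence, and a part in
     the complement. *)
  + move=> xi; have [c cxi] := glue_ext_surj xi.
    have /memv_addP[y yD [z zC yz]] : (family_mk c : H1) \in (limg D + C)%VS.
      by rewrite addv_complf memvf.
    have /memv_imgP[g _ gE] := yD.
    exists (@v2r F (subvs_of C) (vsproj C z)).
    rewrite /psi v2rK vsprojK //.
    apply: ext_equiv_trans cxi.
    apply: (glue_ext_equiv (u := family_get g)) => e m.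
    have cE : c e = family_get (D g) e + family_get z e.
      by rewrite -(linD (family_get_linear e)) -gE -yz family_mkK.
    by rewrite cE add_lfunE DE' [LHS]addrC addrA.
  (* Blocks of equivalent extensions differ by a coboundary; both lying in the complement, the
     difference is zero. *)
  + move=> u w /glue_ext_equivV[g gE].
    have wu : vsval (psi w) - vsval (psi u) = D (family_mk g).
      rewrite -[LHS]family_getK -[RHS]family_getK; congr family_mk.
      apply: functional_extensionality_dep => e; apply/lfunP => m.
      rewrite (linB (family_get_linear _)) add_lfunE opp_lfunE gE DE' !family_mkK.
      by rewrite [LHS]addrAC (addrC (family_get (vsval (psi u)) e m)) addrK.
    have : vsval (psi w) - vsval (psi u) \in (limg D :&: C)%VS.
      by apply/memv_capP; split; [rewrite wu memv_img ?memvf|apply: memvB; exact: subvsP].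
    rewrite capv_compl memv0 subr_eq0 => /eqP/val_inj wE.
    by apply: (can_inj (@r2vK F (subvs_of C))); exact: esym wE.
  + move=> u w; have -> : family_get (vsval (psi (u + w))) =
        (fun e => family_get (vsval (psi u)) e + family_get (vsval (psi w)) e).
      apply: functional_extensionality_dep => e.
      by rewrite -(linD (family_get_linear e)) /psi linearD.
    exact: glue_ext_baer.
  + move=> a u; have -> : family_get (vsval (psi (a *: u))) =
        (fun e => a *: family_get (vsval (psi u)) e).
      apply: functional_extensionality_dep => e.
      by rewrite -(linZ (family_get_linear e)) /psi linearZ.
    exact: glue_ext_scale.
(* By rank-nullity, dim ker D - (dim H1 - rank D) = dim H0 - dim H1. *)
have E0 := limg_ker_dim D fullv; rewrite capfv !dimvf !dim_family_space in E0.
rewrite dimv_compl !dimvf dim_family_space.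
have DH1 : (\dim (limg D) <= \sum_e dim (U1 e))%N.
  by rewrite -dim_family_space -dimvf dimvS ?subvf.
have s0 : (\sum_v \dim {:obj M v} * \dim {:obj N v} = \sum_v dim (U0 v))%N.
  by apply: eq_bigr => v _; rewrite !dimvf.
have s1 : (\sum_e \dim {:obj M (src e)} * \dim {:obj N (tgt e)} = \sum_e dim (U1 e))%N.
  by apply: eq_bigr => e _; rewrite !dimvf.
rewrite s0 s1 -E0 -subzn // PoszD opprB addrCA addrC.
by rewrite addrAC.
Qed.

End ExtGroup.

(** * Dimension vectors on the Grothendieck group and the Ringel form *)

Section GrothendieckDim.
Variables (Q : quiver) (F : finFieldType).
Local Notation X := (isocls Q F).
Local Notation K := (K0 Q F).

Definition free_dim v (x : {malg int[X]}) : int :=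
  \sum_(k <- msupp x) x@_k * (\dim {:obj (rrepr k) v})%:Z.

Lemma free_dimD v : {morph free_dim v : x y / x + y}.
Proof.
have dimE (d : {fset X}) (x : {malg int[X]}) : (msupp x `<=` d)%fset ->
    free_dim v x = \sum_(k <- d) x@_k * (\dim {:obj (rrepr k) v})%:Z.
  move=> /fsubsetP xd; rewrite /free_dim.
  apply: big_fset_incl => [|k kd]; first exact/fsubsetP.
  by move/mcoeff_outdom => ->; rewrite mul0r.
move=> x y; pose d := (msupp x `|` (msupp y `|` msupp (x + y)))%fset.
rewrite (dimE d x) ?(dimE d y) ?(dimE d (x + y)).
- by rewrite -big_split; apply: eq_bigr => k _ /=; rewrite mcoeffD mulrDl.
- by apply/fsubsetP => p; rewrite !in_fsetU => ->; rewrite !orbT.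
- by apply/fsubsetP => p; rewrite !in_fsetU => ->; rewrite orbT.
- by apply/fsubsetP => p; rewrite !in_fsetU => ->.
Qed.

Lemma free_dim0 v : free_dim v 0 = 0.
Proof. by apply: (addrI (free_dim v 0)); rewrite -free_dimD !addr0. Qed.

Lemma free_dimB v x y : free_dim v (x - y) = free_dim v x - free_dim v y.
Proof. by apply/eqP; rewrite -subr_eq opprK -free_dimD subrK. Qed.

Lemma free_dim_cls v (M : rep Q F) : free_dim v << cls M >> = (\dim {:obj M v})%:Z.
Proof.
rewrite /free_dim msuppU oner_eq0 big_seq_fset1 mcoeffUU mul1r.
by congr (_%:Z); apply: isorep_dim; apply/cls_eqP; rewrite rreprK.
Qed.

(** The kernel of the dimension at [v] is a subgroup containing the relation of every short exact
    sequence; hence the dimension descends to K0. *)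
Lemma free_dim_rel v x : x \in @k0_rel Q F -> free_dim v x = 0.
Proof.
move=> /asboolP xI; pose J : {pred {malg int[X]}} := fun x => free_dim v x == 0.
apply/eqP; suff: x \in J by [].
apply: xI; first split=> [|y z /eqP yJ /eqP zJ]; first exact/eqP/free_dim0.
  by apply/eqP; rewrite free_dimB yJ zJ subrr.
move=> M N E f g /short_exact_dim fg; apply/eqP.
rewrite free_dimB; apply/eqP; rewrite subr_eq0; apply/eqP.
etransitivity; first exact: free_dim_cls.
rewrite fg PoszD free_dimD; congr (_ + _); apply/esym; exact: free_dim_cls.
Qed.

Definition k0_dim v (x : K) : int := free_dim v (repr x).

Lemma k0_dim_pi v x : k0_dim v (kpi x) = free_dim v x.
Proof.
apply/eqP; rewrite -subr_eq0 -free_dimB; apply/eqP/free_dim_rel.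
by rewrite idealrBE; apply/eqP; rewrite reprK.
Qed.

Lemma k0_dimD v : {morph k0_dim v : x y / x + y}.
Proof.
move=> x y; have piE (z : K) : exists u, z = kpi u by exists (repr z); rewrite /kpi reprK.
have [u ->] := piE x; have [w ->] := piE y.
have -> : kpi u + kpi w = kpi (u + w) :> K by exact/esym/pi_add.
by rewrite !k0_dim_pi free_dimD.
Qed.

Lemma k0_dim_cls v (M : rep Q F) : k0_dim v (kcls (cls M)) = (\dim {:obj M v})%:Z.
Proof. by rewrite /kcls k0_dim_pi free_dim_cls. Qed.

(** The Ringel form of the quiver. Being a formula in dimension vectors it is bilinear on all of K0,
    and on classes of representations it is the Euler characteristic of the two-term complex. *)
Definition ringel_form (x y : K) : int :=
  \sum_v k0_dim v x * k0_dim v y - \sum_e k0_dim (src e) x * k0_dim (tgt e) y.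

Lemma ringel_formE (M N : rep Q F) : ringel_form (kcls (cls M)) (kcls (cls N)) =
  (\sum_v \dim {:obj M v} * \dim {:obj N v})%N%:Z -
  (\sum_e \dim {:obj M (src e)} * \dim {:obj N (tgt e)})%N%:Z.
Proof.
rewrite /ringel_form; congr (_ - _); rewrite -natz natr_sum; apply: eq_bigr => v _;
by rewrite natz PoszM; congr (_ * _); exact: k0_dim_cls.
Qed.

Lemma ringel_form_euler : euler_form ringel_form.
Proof.
split=> [x y z|x y z|M N].
- rewrite /ringel_form addrACA -opprD -!big_split; congr (_ - _);
  by apply: eq_bigr => v _; rewrite k0_dimD mulrDl.
- rewrite /ringel_form addrACA -opprD -!big_split; congr (_ - _);
  by apply: eq_bigr => v _; rewrite k0_dimD mulrDr.
- have [h [x [hh xx E]]] := hom_ext_dim M N.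
  by exists h, x; split=> //; rewrite ringel_formE.
Qed.

End GrothendieckDim.

Theorem theorem4 (R : realType) (Q : quiver) (F : finFieldType)
    (hQ : dynkin_quiver Q) :
  exists chi : K0 Q F -> K0 Q F -> int,
    euler_form chi /\
    is_hopf (#|F|%:R : R) chi (@hall_mul Q F R) (@hall_unit Q F R)
      (@hall_comul Q F R) (@hall_counit Q F R).
Proof.
exists (@ringel_form Q F); split; first exact: ringel_form_euler.
apply: hall_hopf => x y; rewrite -{1}(rreprK x) -{1}(rreprK y).
exact: ringel_formE.
Qed.
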